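(* For every $\tau\in[0,1]$ the mappings $$\mathrm{Op}_\tau\colon S_0'(\mathbb{R}^{2d})\to \mathbb{S}_0',\qquad W_\tau\colon \mathbb{S}_0\to S_0(\mathbb{R}^{2d})$$ are linear and continuous. Moreover, $\mathrm{Op}_\tau$ is the Banach space adjoint of $W_\tau$, i.e. for every $a\in S_0'(\mathbb{R}^{2d})$ and $S\in\mathbb{S}_0$ $$\langle a, W_\tau S\rangle=\langle \mathrm{Op}_\tau(a), S\rangle .$$
   Context: All brackets $\langle\cdot,\cdot\rangle$ (the $L^2$ inner product and the duality pairings compatible with it) are linear in the first and conjugate-linear in the second argument. Feichtinger algebra: for $f,g\in L^2(\mathbb{R}^n)$ let $V_gf(x,\omega)=\int f(t)\overline{g(t-x)}e^{-2\pi i t\omega}\,dt$. $S_0(\mathbb{R}^n)=\{f\in L^2(\mathbb{R}^n): V_gf\in L^1(\mathbb{R}^{2n})\}$ with norm $\|f\|_{S_0}=\|V_gf\|_{L^1}$, for a fixed nonzero $g\in S_0(\mathbb{R}^n)$, e.g. a Gaussian (different choices give equivalent norms). $S_0'(\mathbb{R}^n)$ is its conjugate-dual. $\mathbb{S}_0'=B(S_0(\mathbb{R}^d),S_0'(\mathbb{R}^d))$ (bounded linear operators). Each $T\in\mathbb{S}_0'$ has a unique kernel $K_T\in S_0'(\mathbb{R}^{2d})$ with $\langle Tf,g\rangle=\langle K_T,K_{g\otimes f}\rangle$ for $f,g\in S_0(\mathbb{R}^d)$, where $g\otimes f$ is the rank-one operator $\psi\mapsto\langle\psi,f\rangle g$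 with kernel $K_{g\otimes f}(x,y)=g(x)\overline{f(y)}$. Feichtinger operators: $\mathbb{S}_0$ is the space of operators $S\colon S_0'(\mathbb{R}^d)\to S_0(\mathbb{R}^d)$ having a kernel $K_S\in S_0(\mathbb{R}^{2d})$, i.e. $(S\sigma)(x)=\langle\sigma,\overline{K_S(x,\cdot)}\rangle$ for $\sigma\in S_0'(\mathbb{R}^d)$ (so $Sf(x)=\int K_S(x,y)f(y)\,dy$ for $f\in S_0$), normed (up to equivalence) by $\|K_S\|_{S_0}$. The pairing between $T\in\mathbb{S}_0'$ and $S\in\mathbb{S}_0$ is $\langle T,S\rangle=\langle K_T,K_S\rangle$. $\tau$-Wigner distribution: for functions, $W_\tau(f,g)(x,\omega)=\int_{\mathbb{R}^d}e^{-2\pi i t\omega}f(x+\tau t)\overline{g(x-(1-\tau)t)}\,dt$; for an operator $S$ with kernel $K_S$, $W_\tau S(x,\omega)=\int_{\mathbb{R}^d}e^{-2\pi i t\omega}K_S(x+\tau t,x-(1-\tau)t)\,dt$. $\tau$-quantization: for $a\in S_0'(\mathbb{R}^{2d})$, $\mathrm{Op}_\tau(a)$ is defined by $\langle\mathrm{Op}_\tau(a)f,g\rangle=\langle a,W_\tau(g,f)\rangle$ for $f,g\in S_0(\mathbb{R}^d)$. *)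

(* Defs.v *)
From HB Require Import structures.
From mathcomp Require Import all_boot all_order all_algebra.
From mathcomp Require Import complex.
From mathcomp Require Import all_classical all_reals all_analysis.

Set Implicit Arguments.
Unset Strict Implicit.
Unset Printing Implicit Defensive.

Import Order.TTheory GRing.Theory Num.Theory.
Import numFieldNormedType.Exports.

Local Open Scope classical_set_scope.
Local Open Scope ring_scope.

(* Euclidean space R^n is 'rV[R]_n, with the product (= Borel) sigma-algebra;
   R^{m+n} is split into its two factors with row_mx, lsubmx and rsubmx. *)

Definition rV_display : measure_display.
Proof. exact: default_measure_display. Qed.

Section measurable_rV.
Context (R : realType) (n : nat).

Let coor (i : 'I_n) (x : 'rV[R]_n) : measurableTypeR R := x 0 i.

Let rV_set0 : g_sigma_preimage coor set0.
Proof. exact: sigma_algebra0. Qed.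

Let rV_setC A : g_sigma_preimage coor A -> g_sigma_preimage coor (~` A).
Proof. exact: sigma_algebraC. Qed.

Let rV_bigcup (F : (set 'rV[R]_n)^nat) :
  (forall i, g_sigma_preimage coor (F i)) ->
  g_sigma_preimage coor (\bigcup_i (F i)).
Proof. exact: sigma_algebra_bigcup. Qed.

HB.instance Definition _ := @isMeasurable.Build rV_display
  'rV[R]_n (g_sigma_preimage coor) rV_set0 rV_setC rV_bigcup.

Lemma measurable_coor (i : 'I_n) :
  measurable_fun [set: 'rV[R]_n] (fun x => x 0 i : measurableTypeR R).
Proof.
move=> _ Y mY; rewrite setTI; apply: sub_sigma_algebra => /=.
rewrite -bigcup_seq/=; exists i => /=; first by rewrite mem_index_enum.
by exists Y => //; rewrite setTI.
Qed.

Lemma measurable_fun_rV d (T : measurableType d) (f : T -> 'rV[R]_n) :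
  (forall i, measurable_fun [set: T] (fun t => f t 0 i : measurableTypeR R)) ->
  measurable_fun [set: T] f.
Proof.
move=> mf; apply: (@measurability _ _ _ _ [set: T] f
  (\big[setU/set0]_(i < n) preimage_set_system setT (coor i) measurable)) => //.
move=> _ [B + <-]; rewrite -bigcup_seq/= => -[i _ [Y mY <-]].
by rewrite setTI -comp_preimage; exact: mf.
Qed.

End measurable_rV.

Section lebesgue_rV_step.
Context (R : realType) (n : nat).
Variable mu : {sigma_finite_measure set 'rV[R]_n -> \bar R}.

Definition cons_rV (p : measurableTypeR R * 'rV[R]_n) : 'rV[R]_n.+1 :=
  row_mx (p.1%:M : 'rV[R]_1) p.2.

Definition uncons_rV (x : 'rV[R]_n.+1) : measurableTypeR R * 'rV[R]_n :=
  (x 0 0, rsubmx (x : 'rV[R]_(1 + n))).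

Lemma cons_rVK : cancel cons_rV uncons_rV.
Proof.
case=> a x; rewrite /uncons_rV /cons_rV /=; congr pair; last by rewrite row_mxKr.
rewrite (_ : 0 = lshift n (0 : 'I_1)) ?(row_mxEl (a%:M : 'rV[R]_1)) ?mxE//.
exact/val_inj.
Qed.

Lemma measurable_cons_rV : measurable_fun setT cons_rV.
Proof.
apply: measurable_fun_rV => i.
have [j ij|j ij] := split_ordP (i : 'I_(1 + n)).
  rewrite (_ : (fun _ => _) = fst); first exact: measurable_fst.
  apply/funext => -[a x]; rewrite /cons_rV ij (row_mxEl (a%:M : 'rV[R]_1)).
  by rewrite mxE !ord1 eqxx.
rewrite (_ : (fun _ => _) = (fun x : 'rV[R]_n => x 0 j) \o snd).
  exact: (measurableT_comp (measurable_coor j) measurable_snd).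
apply/funext => -[a x]; rewrite /cons_rV ij.
exact: (row_mxEr (a%:M : 'rV[R]_1)).
Qed.

Lemma measurable_uncons_rV : measurable_fun setT uncons_rV.
Proof.
apply: measurable_fun_pair; first exact: measurable_coor.
apply: measurable_fun_rV => i.
rewrite (_ : (fun _ => _) = fun x : 'rV[R]_n.+1 => x 0 (rshift 1 i)).
  exact: measurable_coor.
by apply/funext => x; rewrite mxE.
Qed.

Definition lebesgue_rV_succ : set 'rV[R]_n.+1 -> \bar R :=
  pushforward (@lebesgue_measure R \x mu)%E cons_rV.

Let succ0 : lebesgue_rV_succ set0 = 0%E.
Proof. by rewrite /lebesgue_rV_succ /pushforward preimage_set0 measure0. Qed.

Let succ_ge0 A : (0 <= lebesgue_rV_succ A)%E.
Proof. by apply: measure_ge0 => //; exact: measurable_cons_rV. Qed.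

Let succ_sigma_additive : semi_sigma_additive lebesgue_rV_succ.
Proof.
by apply: measure_semi_sigma_additive; exact: measurable_cons_rV.
Qed.

HB.instance Definition _ := isMeasure.Build _ _ _ lebesgue_rV_succ
  succ0 succ_ge0 succ_sigma_additive.

Let succ_sigma_finite : sigma_finite setT lebesgue_rV_succ.
Proof.
have /sigma_finiteP[F [TF ndF Foo]] := sigma_finiteT (@lebesgue_measure R).
have /sigma_finiteP[G [TG ndG Goo]] := sigma_finiteT mu.
exists (fun k => uncons_rV @^-1` (F k `*` G k)) => [|k].
  rewrite -preimage_bigcup (_ : \bigcup_k _ = setT) ?preimage_setT//.
  rewrite -subTset => -[a x] _.
  have [i _ Fa] : (\bigcup_k F k) a by rewrite -TF.
  have [j _ Gx] : (\bigcup_k G k) x by rewrite -TG.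
  exists (maxn i j) => //; split => /=.
    by move: a Fa; exact/subsetPset/ndF/leq_maxl.
  by move: x Gx; exact/subsetPset/ndG/leq_maxr.
have [[mF Fk] [mG Gk]] := (Foo k, Goo k); split.
  rewrite -[X in measurable X]setTI; apply: measurable_uncons_rV => //.
  exact: measurableX.
rewrite /lebesgue_rV_succ /pushforward -comp_preimage.
rewrite (_ : _ \o _ = id) ?preimage_id; last exact/funext/cons_rVK.
by rewrite product_measure1E// lte_mul_pinfty// ge0_fin_numE.
Qed.

HB.instance Definition _ := Measure_isSigmaFinite.Build _ _ _ lebesgue_rV_succ
  succ_sigma_finite.

End lebesgue_rV_step.

Fixpoint lebesgue_rV (R : realType) (n : nat) :
    {sigma_finite_measure set 'rV[R]_n -> \bar R} :=
  if n is m.+1 then lebesgue_rV_succ (lebesgue_rV R m)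
  else \d_(0 : 'rV[R]_0).

Local Notation normc := complex.ComplexField.Normc.normc.

Section complex_functions.
Context (R : realType) (n : nat).
Implicit Types f : 'rV[R]_n -> R[i].

Definition cmeasurable f :=
  measurable_fun setT (fun x => complex.Re (f x)) /\
  measurable_fun setT (fun x => complex.Im (f x)).

Definition cintegral f : R[i] :=
  Complex (\int[lebesgue_rV R n]_x complex.Re (f x))
          (\int[lebesgue_rV R n]_x complex.Im (f x)).

Definition Lp_norm (p : \bar R) f : \bar R :=
  ('N[lebesgue_rV R n]_p[EFin \o (fun x => normc (f x))])%E.

Definition Lp (p : \bar R) : set ('rV[R]_n -> R[i]) :=
  [set f | cmeasurable f /\ (Lp_norm p f < +oo)%E].

End complex_functions.

Section time_frequency.
Context (R : realType).

Definition dotv n (x y : 'rV[R]_n) : R := \sum_(i < n) x 0 i * y 0 i.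

(* e^{i theta} *)
Definition expi (theta : R) : R[i] := Complex (cos theta) (sin theta).

Definition gaussian n (x : 'rV[R]_n) : R[i] := (expR (- (pi * dotv x x)))%:C%C.

(* z = (x, omega) in V_g f(x, omega) *)
Definition stft n (g f : 'rV[R]_n -> R[i]) (z : 'rV[R]_(n + n)) : R[i] :=
  let x := lsubmx z in let omega := rsubmx z in
  cintegral (fun t =>
    f t * conjc (g (t - x)) * expi (- (2 * pi * dotv t omega))).

(* W_tau(f, g)(x, omega) *)
Definition wigner (tau : R) d (f g : 'rV[R]_d -> R[i]) (z : 'rV[R]_(d + d)) :
    R[i] :=
  let x := lsubmx z in let omega := rsubmx z in
  cintegral (fun t => expi (- (2 * pi * dotv t omega)) *
    f (x + tau *: t) * conjc (g (x - (1 - tau) *: t))).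

(* W_tau applied to the operator with integral kernel K *)
Definition wigner_kernel (tau : R) d (K : 'rV[R]_(d + d) -> R[i])
    (z : 'rV[R]_(d + d)) : R[i] :=
  let x := lsubmx z in let omega := rsubmx z in
  cintegral (fun t => expi (- (2 * pi * dotv t omega)) *
    K (row_mx (x + tau *: t) (x - (1 - tau) *: t))).

(* kernel of the rank-one operator g (x) f : psi |-> <psi, f> g *)
Definition tensor_kernel d (g f : 'rV[R]_d -> R[i]) (z : 'rV[R]_(d + d)) :
    R[i] :=
  g (lsubmx z) * conjc (f (rsubmx z)).

End time_frequency.

(* A complex normed space presented by representatives: its vectors are the
   elements of the subset nmem of an ambient vector space, identified along
   nequiv (almost everywhere equality for functions, equality on the domain for
   maps and functionals, whose values outside their domain are irrelevant). *)
Record nspace (R : realType) := NSpace {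
  nsort :> lmodType R[i];
  nmem : set nsort;
  nequiv : nsort -> nsort -> Prop;
  nnorm : nsort -> \bar R }.

Section normed_spaces.
Context (R : realType).
Implicit Types E F : nspace R.

Definition is_linear_map E F (T : E -> F) : Prop :=
  [/\ forall u, nmem u -> nmem (T u),
      forall u v, nmem u -> nmem v -> nequiv u v -> nequiv (T u) (T v) &
      forall (c : R[i]) u v, nmem u -> nmem v ->
        nequiv (T (c *: u + v)) (c *: T u + T v)].

Definition is_continuous_map E F (T : E -> F) : Prop :=
  forall u, nmem u -> forall e : R, 0 < e ->
  exists2 delta : R, 0 < delta & forall v, nmem v ->
    (nnorm (v - u) < delta%:E)%E -> (nnorm (T v - T u) < e%:E)%E.

Definition op_norm E F (T : E -> F) : \bar R :=
  ereal_sup [set nnorm (T u) | u in [set u | nmem u /\ (nnorm u <= 1)%E]].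

(* B(E, F) *)
Definition bounded_maps E F : nspace R := {|
  nsort := E -> F;
  nmem := [set T | is_linear_map T /\ (op_norm T < +oo)%E];
  nequiv := fun T T' => forall u, nmem u -> nequiv (T u) (T' u);
  nnorm := @op_norm E F |}.

Definition functional_norm E (s : E -> R[i]) : \bar R :=
  ereal_sup [set (normc (s u))%:E | u in [set u | nmem u /\ (nnorm u <= 1)%E]].

(* The conjugate-dual E'; the pairing <s, u> is s u. *)
Definition conj_dual E : nspace R := {|
  nsort := E -> R[i];
  nmem := [set s | (forall (c : R[i]) u v, nmem u -> nmem v ->
                      s (c *: u + v) = conjc c * s u + s v) /\
                   (functional_norm s < +oo)%E];
  nequiv := fun s s' => forall u, nmem u -> s u = s' u;
  nnorm := @functional_norm E |}.

End normed_spaces.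

Section feichtinger.
Context (R : realType).

Definition S0_norm n (f : 'rV[R]_n -> R[i]) : \bar R :=
  Lp_norm 1%E (stft (@gaussian R n) f).

Definition S0 n : nspace R := {|
  nsort := 'rV[R]_n -> R[i];
  nmem := [set f | Lp 2%:E f /\ Lp 1%E (stft (@gaussian R n) f)];
  nequiv := fun f g => {ae lebesgue_rV R n, forall x, f x = g x};
  nnorm := @S0_norm n |}.

Definition S0' n : nspace R := conj_dual (S0 n).

(* All bounded operators from S_0(R^d) to S_0'(R^d). *)
Definition OpS0' d : nspace R := bounded_maps (S0 d) (S0' d).

Definition is_kernel' d (T : OpS0' d) (k : S0' (d + d)) : Prop :=
  nmem k /\ forall f g : S0 d, nmem f -> nmem g ->
    T f g = k (tensor_kernel g f).

(* The kernel K_T, unique as an element of S0' (d + d). *)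
Definition kernel_of' d (T : OpS0' d) : S0' (d + d) :=
  xget 0 [set k | is_kernel' T k].

Definition is_kernel d (S : S0' d -> S0 d) (K : S0 (d + d)) : Prop :=
  nmem K /\ forall s : S0' d, nmem s ->
    {ae lebesgue_rV R d, forall x, S s x = s (fun y => conjc (K (row_mx x y)))}.

(* The kernel K_S, unique up to almost everywhere equality. *)
Definition kernel_of d (S : S0' d -> S0 d) : S0 (d + d) :=
  xget 0 [set K | is_kernel S K].

(* Feichtinger operators. *)
Definition OpS0 d : nspace R := {|
  nsort := S0' d -> S0 d;
  nmem := [set S | (forall s, nmem s -> nmem (S s)) /\
                   exists K, is_kernel S K];
  nequiv := fun S S' => forall s, nmem s -> nequiv (S s) (S' s);
  nnorm := fun S => nnorm (kernel_of S) |}.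

Definition op_pairing d (T : OpS0' d) (S : OpS0 d) : R[i] :=
  kernel_of' T (kernel_of S).

Definition Op (tau : R) d (a : S0' (d + d)) : OpS0' d :=
  fun f g => a (wigner tau g f).

Definition W (tau : R) d (S : OpS0 d) : S0 (d + d) :=
  wigner_kernel tau (kernel_of S).

End feichtinger.

Arguments S0 R n : clear implicits.
Arguments S0' R n : clear implicits.
Arguments OpS0' R d : clear implicits.
Arguments OpS0 R d : clear implicits.
Arguments Op {R} tau d.
Arguments W {R} tau d.

(* Main.v *)
Require Import Defs.
From HB Require Import structures.
From mathcomp Require Import all_boot all_order all_algebra complex.
From mathcomp Require Import ring lra zify.
From mathcomp Require Import all_classical all_reals all_analysis measurable_realfun.

(** Op_tau(a) f is the functional g |-> <a, W_tau(g, f)>, and W_tau(g, f) is the Wigner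
    transform of the rank-one kernel g (x) f. On such kernels the adjoint identity is
    therefore the definition of Op_tau. Everything else consists in showing that the
    objects are well defined and continuous, that operators determine their kernels,
    and that rank-one kernels are dense.

    All of this is reduced to computations with Gaussian atoms, that is, the
    time-frequency shifts of the Gaussian g. Fourier inversion yields, for f in S0 and a
    reconstruction window gam, the formula
      f(t) * int g gam = int V_g f(x, w) e(t w) gam(t - x) dx dw   for almost every t
    (stft_inversion). With gam = g it presents f as a superposition of atoms whose
    density has L1 norm at most a constant times the S0 norm of f (S0_atomic).
    Conversely the atoms all have the same S0 norm, so every superposition of atoms with
    an integrable density lies in S0, with a bound on its norm (S0_atoms). A map that
    takes atoms to multiples of atoms is thus bounded on S0. This gives the tensor
    product (S0_tensor), almost every section of a kernel (S0_section), and the Wigner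
    transform (S0_wigner_kernel); for the last one, gam is the Gaussian in the
    coordinates of the linear substitution that defines W_tau, so that the shifts of gam
    are mapped to atoms.

    Uniqueness of the kernel of a Feichtinger operator (kernel_unique) follows by
    testing the operator on the functionals given by integration over boxes. Uniqueness
    of the kernel of an operator from S0 to its dual (kernel'_unique) follows from the
    density of the atoms (S0'_eq_on_atoms), because an atom of R^{2d} is the tensor
    product of two atoms of R^d. Density is proved by rounding the points of phase space
    in the atomic representation to a finite grid: the atoms then converge pointwise with
    constant norms, hence in norm by Scheffe's lemma.

    Finally K |-> a(W_tau K) is a bounded functional on S0 that represents Op_tau(a) on
    rank-one kernels. By uniqueness it is the kernel of Op_tau(a), and its value at the
    kernel of S is the adjoint identity. *)

Set Implicit Arguments.
Unset Strict Implicit.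
Unset Printing Implicit Defensive.

Import Order.TTheory GRing.Theory Num.Theory.
Import numFieldNormedType.Exports.

Local Open Scope classical_set_scope.
Local Open Scope ring_scope.

Local Notation normc := complex.ComplexField.Normc.normc.
Local Notation Re := complex.Re.
Local Notation Im := complex.Im.
Local Notation eq0_normc := complex.ComplexField.Normc.eq0_normc.

(** * Complex numbers and complex-valued integrals *)

Section complex_numbers.
Context {R : realType}.
Implicit Types z w : R[i].

Lemma ReD z w : Re (z + w) = Re z + Re w. Proof. by case: z; case: w. Qed.
Lemma ImD z w : Im (z + w) = Im z + Im w. Proof. by case: z; case: w. Qed.
Lemma ReM z w : Re (z * w) = Re z * Re w - Im z * Im w.
Proof. by case: z; case: w. Qed.
Lemma ImM z w : Im (z * w) = Re z * Im w + Im z * Re w.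
Proof. by case: z; case: w. Qed.
Lemma ReN z : Re (- z) = - Re z. Proof. by case: z. Qed.
Lemma ImN z : Im (- z) = - Im z. Proof. by case: z. Qed.
Lemma Re_conjc z : Re (conjc z) = Re z. Proof. by case: z. Qed.
Lemma Im_conjc z : Im (conjc z) = - Im z. Proof. by case: z. Qed.
Lemma ReC (a : R) : Re a%:C%C = a. Proof. by []. Qed.
Lemma ImC (a : R) : Im a%:C%C = 0. Proof. by []. Qed.

Lemma eq_ReIm z w : Re z = Re w -> Im z = Im w -> z = w.
Proof. by case: z => a b; case: w => c d /= -> ->. Qed.

Lemma normcE z : normc z = Num.sqrt (Re z ^+ 2 + Im z ^+ 2).
Proof. by case: z. Qed.

Lemma normc_ge0 z : 0 <= normc z.
Proof. by rewrite normcE sqrtr_ge0. Qed.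

Lemma sqr_normc z : normc z ^+ 2 = Re z ^+ 2 + Im z ^+ 2.
Proof. by rewrite normcE sqr_sqrtr// addr_ge0// sqr_ge0. Qed.

Lemma normcM z w : normc (z * w) = normc z * normc w.
Proof. exact: complex.ComplexField.Normc.normcM. Qed.

Lemma le_normcD z w : normc (z + w) <= normc z + normc w.
Proof. exact: complex.le_normcD. Qed.

Lemma normcN z : normc (- z) = normc z.
Proof. exact: complex.normcN. Qed.

Lemma normc_conj z : normc (conjc z) = normc z.
Proof. by rewrite !normcE Re_conjc Im_conjc sqrrN. Qed.

Lemma normc_real (a : R) : normc a%:C%C = `|a|.
Proof. by rewrite normcE/= expr0n/= addr0 sqrtr_sqr. Qed.

Lemma normc0 : normc (0 : R[i]) = 0.
Proof. by rewrite (normc_real 0) normr0. Qed.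

Lemma normr_Re_le z : `|Re z| <= normc z.
Proof.
by rewrite -(@ler_pXn2r _ 2)// ?nnegrE ?normc_ge0// sqr_normc real_normK ?num_real// lerDl sqr_ge0.
Qed.

Lemma normr_Im_le z : `|Im z| <= normc z.
Proof.
by rewrite -(@ler_pXn2r _ 2)// ?nnegrE ?normc_ge0// sqr_normc real_normK ?num_real// lerDr sqr_ge0.
Qed.

Lemma normc_le_ReIm z : normc z <= `|Re z| + `|Im z|.
Proof.
rewrite {1}(_ : z = (Re z)%:C%C + (Complex 0 1) * (Im z)%:C%C).
  rewrite (le_trans (le_normcD _ _))// normcM !normc_real lerD2l.
  by rewrite normcE/= expr0n/= add0r expr1n sqrtr1 mul1r.
by apply: eq_ReIm; rewrite ?ReD ?ImD ?ReM ?ImM /=; ring.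
Qed.

Lemma normc_expi (t : R) : normc (expi t) = 1.
Proof. by rewrite normcE/= cos2Dsin2 sqrtr1. Qed.

Lemma expiD (s t : R) : expi (s + t) = expi s * expi t.
Proof. by apply: eq_ReIm; rewrite ?ReM ?ImM/= ?cosD ?sinD//; ring. Qed.

Lemma expi0 : expi 0 = 1 :> R[i].
Proof. by rewrite /expi cos0 sin0. Qed.

Lemma conjc_expi (t : R) : conjc (expi t) = expi (- t).
Proof. by rewrite /expi cosN sinN. Qed.

Lemma conjcM z w : conjc (z * w) = conjc z * conjc w.
Proof. exact: (rmorphM (@conjc R)). Qed.

Lemma conjcD z w : conjc (z + w) = conjc z + conjc w.
Proof. exact: (rmorphD (@conjc R)). Qed.

Lemma real_complexM (a b : R) : (a * b)%:C%C = a%:C%C * b%:C%C.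
Proof. exact: (rmorphM (real_complex R)). Qed.

(** Turns an integral onto the positive real axis, where its absolute value is a
    real part; this is how the triangle inequality for complex integrals follows
    from the real one. *)
Lemma rotation_to_norm z : exists2 u : R[i], normc u <= 1 & u * z = (normc z)%:C%C.
Proof.
have [->|z0] := eqVneq z 0; first by exists 0; rewrite ?mul0r normc0.
have nz : normc z != 0.
  by apply: contra z0 => /eqP/eq0_normc ->.
exists (conjc z * (normc z)^-1%:C%C).
  rewrite normcM normc_conj normc_real ger0_norm ?invr_ge0 ?normc_ge0//.
  by rewrite mulfV.
have zz : conjc z * z = (normc z ^+ 2)%:C%C.
  by rewrite sqr_normc; apply: eq_ReIm; rewrite ?ReM ?ImM Re_conjc Im_conjc/=; ring.
rewrite mulrAC zz -real_complexM; congr (_%:C%C).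
by rewrite expr2 mulfK.
Qed.

End complex_numbers.

Section complex_integral.
Context d (T : measurableType d) {R : realType}.
Implicit Types (f g : T -> R[i]) (h : T -> R).

Definition cmeas f :=
  measurable_fun setT (fun x => Re (f x)) /\
  measurable_fun setT (fun x => Im (f x)).

Lemma cmeas_cst (c : R[i]) : cmeas (fun=> c).
Proof. by split; exact: measurable_cst. Qed.

Lemma cmeas_real h : measurable_fun setT h -> cmeas (fun x => (h x)%:C%C).
Proof. by split => //; exact: measurable_cst. Qed.

Lemma cmeasD f g : cmeas f -> cmeas g -> cmeas (fun x => f x + g x).
Proof.
move=> [f1 f2] [g1 g2]; split.
  by under eq_fun do rewrite ReD; exact: measurable_funD.
by under eq_fun do rewrite ImD; exact: measurable_funD.
Qed.

Lemma cmeasM f g : cmeas f -> cmeas g -> cmeas (fun x => f x * g x).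
Proof.
move=> [f1 f2] [g1 g2]; split.
  under eq_fun do rewrite ReM.
  by apply: measurable_funB; exact: measurable_funM.
under eq_fun do rewrite ImM.
by apply: measurable_funD; exact: measurable_funM.
Qed.

Lemma cmeasN f : cmeas f -> cmeas (fun x => - f x).
Proof.
move=> [f1 f2]; split.
  by under eq_fun do rewrite ReN; exact: measurable_funN.
by under eq_fun do rewrite ImN; exact: measurable_funN.
Qed.

Lemma cmeasB f g : cmeas f -> cmeas g -> cmeas (fun x => f x - g x).
Proof. by move=> mf mg; apply: cmeasD => //; exact: cmeasN. Qed.

Lemma cmeas_conj f : cmeas f -> cmeas (fun x => conjc (f x)).
Proof.
move=> [f1 f2]; split.
  by under eq_fun do rewrite Re_conjc.
by under eq_fun do rewrite Im_conjc; exact: measurable_funN.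
Qed.

Lemma cmeas_expi h : measurable_fun setT h -> cmeas (fun x => expi (h x)).
Proof.
move=> mh; split => /=.
  have mc : measurable_fun [set: R] (@cos R).
    by apply: continuous_measurable_fun; exact: continuous_cos.
  exact: (measurableT_comp mc mh).
have ms : measurable_fun [set: R] (@sin R).
  by apply: continuous_measurable_fun; exact: continuous_sin.
exact: (measurableT_comp ms mh).
Qed.

Lemma measurable_normc f : cmeas f -> measurable_fun setT (fun x => normc (f x)).
Proof.
move=> [f1 f2]; under eq_fun do rewrite normcE.
have ms : measurable_fun [set: R] (@Num.sqrt R).
  by apply: continuous_measurable_fun; exact: sqrt_continuous.
apply: (measurableT_comp ms).
by apply: measurable_funD; exact: measurable_funX.
Qed.

Lemma measurable_enormc f : cmeas f ->
  measurable_fun setT (fun x => (normc (f x))%:E).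
Proof. by move=> /measurable_normc mf; exact/measurable_EFinP. Qed.

Variable mu : {measure set T -> \bar R}.

Definition cint f : R[i] := Complex (\int[mu]_x Re (f x)) (\int[mu]_x Im (f x)).

Definition norm1 f : \bar R := (\int[mu]_x (normc (f x))%:E)%E.

Definition cintegrable f := cmeas f /\ (norm1 f < +oo)%E.

Lemma norm1_ge0 f : (0 <= norm1 f)%E.
Proof. by apply: integral_ge0 => x _; rewrite lee_fin normc_ge0. Qed.

Lemma le_norm1 f (g : T -> \bar R) : cmeas f -> measurable_fun setT g ->
  (forall x, (normc (f x))%:E <= g x)%E -> (norm1 f <= \int[mu]_x g x)%E.
Proof.
move=> mf mg fg; apply: ge0_le_integral => //.
- by move=> x _; rewrite lee_fin normc_ge0.
- exact: measurable_enormc.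
Qed.

Lemma cintegrable_Re f : cintegrable f -> mu.-integrable setT (EFin \o (fun x => Re (f x))).
Proof.
move=> [mf foo]; apply/integrableP; split.
  by apply/measurable_EFinP; case: mf.
apply: le_lt_trans foo; apply: ge0_le_integral => //.
- by apply/measurableT_comp => //; apply/measurable_EFinP; case: mf.
- exact: measurable_enormc.
- by move=> x _; rewrite lee_fin normr_Re_le.
Qed.

Lemma cintegrable_Im f : cintegrable f -> mu.-integrable setT (EFin \o (fun x => Im (f x))).
Proof.
move=> [mf foo]; apply/integrableP; split.
  by apply/measurable_EFinP; case: mf.
apply: le_lt_trans foo; apply: ge0_le_integral => //.
- by apply/measurableT_comp => //; apply/measurable_EFinP; case: mf.
- exact: measurable_enormc.
- by move=> x _; rewrite lee_fin normr_Im_le.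
Qed.

Lemma norm1D f g : cmeas f -> cmeas g ->
  (norm1 (fun x => f x + g x)%R <= norm1 f + norm1 g)%E.
Proof.
move=> mf mg; rewrite -ge0_integralD//.
- apply: le_norm1; first exact: cmeasD.
    by apply: emeasurable_funD; exact: measurable_enormc.
  by move=> x; rewrite -EFinD lee_fin le_normcD.
- by move=> x _; rewrite lee_fin normc_ge0.
- exact: measurable_enormc.
- by move=> x _; rewrite lee_fin normc_ge0.
- exact: measurable_enormc.
Qed.

Lemma norm1Z (c : R[i]) f : cmeas f ->
  norm1 (fun x => c * f x) = ((normc c)%:E * norm1 f)%E.
Proof.
move=> mf; rewrite -ge0_integralZl//.
- by apply: eq_integral => x _; rewrite normcM EFinM.
- exact: measurable_enormc.
- by move=> x _; rewrite lee_fin normc_ge0.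
- by rewrite lee_fin normc_ge0.
Qed.

Lemma norm1N f : norm1 (fun x => - f x) = norm1 f.
Proof. by apply: eq_integral => x _; rewrite normcN. Qed.

Lemma norm1_conj f : norm1 (fun x => conjc (f x)) = norm1 f.
Proof. by apply: eq_integral => x _; rewrite normc_conj. Qed.

Lemma norm1B f g : cmeas f -> cmeas g ->
  (norm1 (fun x => f x - g x)%R <= norm1 f + norm1 g)%E.
Proof. by move=> mf mg; rewrite -(norm1N g); apply: norm1D => //; exact: cmeasN. Qed.

Lemma cintegrable_le f (g : T -> \bar R) : cmeas f -> measurable_fun setT g ->
  (forall x, (normc (f x))%:E <= g x)%E -> (\int[mu]_x g x < +oo)%E -> cintegrable f.
Proof. by move=> mf mg fg goo; split => //; apply: le_lt_trans goo; exact: le_norm1. Qed.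

Lemma cintegrableD f g : cintegrable f -> cintegrable g -> cintegrable (fun x => f x + g x).
Proof.
move=> [mf foo] [mg goo]; split; first exact: cmeasD.
by apply: le_lt_trans (norm1D mf mg) _; rewrite lte_add_pinfty.
Qed.

Lemma cintegrableZ (c : R[i]) f : cintegrable f -> cintegrable (fun x => c * f x).
Proof.
move=> [mf foo]; split; first by apply: cmeasM => //; exact: cmeas_cst.
by rewrite norm1Z// lte_mul_pinfty// lee_fin normc_ge0.
Qed.

Lemma cintegrableN f : cintegrable f -> cintegrable (fun x => - f x).
Proof. by move=> [mf foo]; split; [exact: cmeasN|rewrite norm1N]. Qed.

Lemma cintegrableB f g : cintegrable f -> cintegrable g -> cintegrable (fun x => f x - g x).
Proof. by move=> If Ig; apply: cintegrableD => //; exact: cintegrableN. Qed.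

Lemma cintegrable_conj f : cintegrable f -> cintegrable (fun x => conjc (f x)).
Proof. by move=> [mf foo]; split; [exact: cmeas_conj|rewrite norm1_conj]. Qed.

Lemma cintegrable_cst0 : cintegrable (fun=> 0).
Proof.
split; first exact: cmeas_cst.
by rewrite /norm1; under eq_integral do rewrite normc0; rewrite integral0.
Qed.

Lemma cintegrableM_bounded f g (M : R) : cintegrable f -> cmeas g ->
  (forall x, normc (g x) <= M) -> cintegrable (fun x => f x * g x).
Proof.
move=> [mf foo] mg gM; apply: (@cintegrable_le _ (fun x => M%:E * (normc (f x))%:E)%E).
- exact: cmeasM.
- by apply/measurable_EFinP; apply: measurable_funM => //; exact: measurable_normc.
- by move=> x; rewrite -EFinM lee_fin normcM mulrC ler_wpM2r// normc_ge0.
rewrite ge0_integralZl//.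
- rewrite lte_mul_pinfty// lee_fin.
  by apply: le_trans (gM point); rewrite normc_ge0.
- exact: measurable_enormc.
- by move=> x _; rewrite lee_fin normc_ge0.
- by rewrite lee_fin; apply: le_trans (gM point); rewrite normc_ge0.
Qed.

Lemma cintD f g : cintegrable f -> cintegrable g ->
  cint (fun x => f x + g x) = cint f + cint g.
Proof.
move=> If Ig; apply: eq_ReIm; rewrite /cint /=.
  under eq_Rintegral do rewrite ReD.
  by rewrite RintegralD//; exact: cintegrable_Re.
under eq_Rintegral do rewrite ImD.
by rewrite RintegralD//; exact: cintegrable_Im.
Qed.

Lemma cintZ (c : R[i]) f : cintegrable f -> cint (fun x => c * f x) = c * cint f.
Proof.
move=> If; have [IR II] := (cintegrable_Re If, cintegrable_Im If).
have IZ (h : T -> R) (k : R) : mu.-integrable setT (EFin \o h) ->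
    mu.-integrable setT (EFin \o (fun x => k * h x)).
  by move=> ih; exact: (integrableZl measurableT k ih).
apply: eq_ReIm; rewrite /cint ?ReM ?ImM/=.
  under eq_Rintegral do rewrite ReM.
  by rewrite RintegralB// ?RintegralZl//; exact: IZ.
under eq_Rintegral do rewrite ImM.
by rewrite RintegralD// ?RintegralZl//; exact: IZ.
Qed.

Lemma cintN f : cintegrable f -> cint (fun x => - f x) = - cint f.
Proof.
move=> If; rewrite -mulN1r -cintZ//; congr cint; apply/funext => x.
by rewrite mulN1r.
Qed.

Lemma cintB f g : cintegrable f -> cintegrable g ->
  cint (fun x => f x - g x) = cint f - cint g.
Proof. by move=> If Ig; rewrite cintD ?cintN//; exact: cintegrableN. Qed.

Lemma cint_conj f : cintegrable f -> cint (fun x => conjc (f x)) = conjc (cint f).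
Proof.
move=> If; apply: eq_ReIm; rewrite ?Re_conjc ?Im_conjc /cint/=.
  by apply: eq_Rintegral => x _; rewrite Re_conjc.
under eq_Rintegral do rewrite Im_conjc -mulN1r.
by rewrite RintegralZl// ?mulN1r//; exact: cintegrable_Im.
Qed.

Lemma cint_real (h : T -> R) : cint (fun x => (h x)%:C%C) = (\int[mu]_x h x)%:C%C.
Proof.
apply: eq_ReIm; rewrite /cint//=.
by rewrite Rintegral_cst//= mul0r.
Qed.

Lemma cint0 : cint (fun=> 0) = 0.
Proof. by rewrite (cint_real (fun=> 0)) Rintegral_cst// mul0r. Qed.

Lemma cintegrable_sum (I : Type) (s : seq I) (f : I -> T -> R[i]) :
  (forall i, cintegrable (f i)) -> cintegrable (fun x => \sum_(i <- s) f i x).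
Proof.
move=> If; elim: s => [|i s IH].
  by under eq_fun do rewrite big_nil; exact: cintegrable_cst0.
by under eq_fun do rewrite big_cons; exact: cintegrableD.
Qed.

Lemma cint_sum (I : Type) (s : seq I) (f : I -> T -> R[i]) :
  (forall i, cintegrable (f i)) ->
  cint (fun x => \sum_(i <- s) f i x) = \sum_(i <- s) cint (f i).
Proof.
move=> If; elim: s => [|i s IH].
  by under eq_fun do rewrite big_nil; rewrite big_nil cint0.
under eq_fun do rewrite big_cons; rewrite big_cons cintD ?IH//.
exact: cintegrable_sum.
Qed.

Lemma eq_cint f g : f =1 g -> cint f = cint g.
Proof. by move=> /funext ->. Qed.

Lemma ae_eq_cint f g : cmeas f -> cmeas g -> {ae mu, forall x, f x = g x} ->
  cint f = cint g.
Proof.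
move=> [mf1 mf2] [mg1 mg2] fg; apply: eq_ReIm; rewrite /cint /Rintegral/=;
  congr fine; apply: ae_eq_integral => //; try exact/measurable_EFinP;
  by apply: filterS fg => x -> .
Qed.

Lemma ae_eq_norm1 f g : cmeas f -> cmeas g -> {ae mu, forall x, f x = g x} ->
  norm1 f = norm1 g.
Proof.
move=> mf mg fg; apply: ae_eq_integral => //; try exact: measurable_enormc.
by apply: filterS fg => x ->.
Qed.

Lemma le_normc_cint f : cmeas f -> ((normc (cint f))%:E <= norm1 f)%E.
Proof.
move=> mf; have [foo|] := ltP (norm1 f) +oo%E; last first.
  by rewrite leye_eq => /eqP ->; rewrite leey.
have If : cintegrable f by [].
have [u u1 uz] := rotation_to_norm (cint f).
have {uz} -> : normc (cint f) = \int[mu]_x Re (u * f x).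
  by rewrite -[LHS]ReC -uz -cintZ.
have Iuf : cintegrable (fun x => u * f x) by exact: cintegrableZ.
apply: (@le_trans _ _ (norm1 (fun x => u * f x))).
  rewrite /Rintegral fineK; last exact: integrable_fin_num (cintegrable_Re Iuf).
  apply: le_trans (lee_abs _) _.
  apply: le_trans (le_abse_integral _ _ _) _ => //.
    by apply/measurable_EFinP; case: Iuf => -[].
  apply: ge0_le_integral => //.
  - by apply/measurableT_comp => //; apply/measurable_EFinP; case: Iuf => -[].
  - by apply: measurable_enormc; case: Iuf.
  - by move=> x _; rewrite lee_fin normr_Re_le.
by rewrite norm1Z// gee_pMl// ?norm1_ge0// ?lee_fin// ge0_fin_numE// norm1_ge0.
Qed.

Lemma norm1_fin f : cintegrable f -> norm1 f = (fine (norm1 f))%:E.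
Proof. by move=> [_ foo]; rewrite fineK// ge0_fin_numE// norm1_ge0. Qed.

Lemma le_normc_cint_fine f : cintegrable f -> normc (cint f) <= fine (norm1 f).
Proof. by move=> If; rewrite -lee_fin -norm1_fin//; apply: le_normc_cint; case: If. Qed.

Lemma dominated_cvg_norm1 (f_ : nat -> T -> R[i]) f (g : T -> \bar R) :
  (forall n, cmeas (f_ n)) -> cmeas f ->
  {ae mu, forall x, normc (f_ n x - f x) @[n --> \oo] --> 0} ->
  mu.-integrable setT g ->
  (forall n x, (normc (f_ n x - f x))%:E <= g x)%E ->
  norm1 (fun x => f_ n x - f x) @[n --> \oo] --> 0%E.
Proof.
move=> mf_ mf cf ig fg.
have [] := @dominated_convergence _ _ _ mu setT measurableT
  (fun n x => (normc (f_ n x - f x))%:E) (cst 0%E) g.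
- by move=> n; apply: measurable_enormc; exact: cmeasB.
- exact: measurable_cst.
- apply: filterS cf => x cx _.
  by apply: cvg_EFin => //; apply: nearW.
- by [].
- by apply: aeW => x n _; rewrite gee0_abs// lee_fin normc_ge0.
by move=> _ _; rewrite integral_cst//= mul0e.
Qed.

End complex_integral.

Lemma cmeas_comp d d' (T : measurableType d) (T' : measurableType d') (R : realType)
    (p : T' -> T) (f : T -> R[i]) :
  measurable_fun setT p -> cmeas f -> cmeas (fun x => f (p x)).
Proof.
move=> mp [f1 f2]; split.
  exact: (measurableT_comp f1 mp).
exact: (measurableT_comp f2 mp).
Qed.

(** * Fubini's theorem and changes of variables *)

Section null_functions.
Context d (T : measurableType d) {R : realType}.
Variable mu : {measure set T -> \bar R}.

Lemma norm1_eq0P (f : T -> R[i]) : cmeas f ->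
  norm1 mu f = 0%E <-> {ae mu, forall x, f x = 0}.
Proof.
move=> mf; have := ae_eq_integral_abs mu measurableT (measurable_enormc mf).
under eq_integral => x _ do rewrite gee0_abs ?lee_fin ?normc_ge0//.
rewrite -/(norm1 mu f) => ->; split; apply: filterS => x.
  move=> /(_ I) [n0]; exact: eq0_normc.
by move=> -> _; rewrite normc0.
Qed.

Lemma ae_eq_norm1B (f g : T -> R[i]) : cmeas f -> cmeas g ->
  {ae mu, forall x, f x = g x} <-> norm1 mu (fun x => f x - g x) = 0%E.
Proof.
move=> mf mg; rewrite norm1_eq0P; last exact: cmeasB.
split; apply: filterS => x; first by move=> ->; rewrite subrr.
exact: subr0_eq.
Qed.

End null_functions.

Section product.
Context d1 d2 (T1 : measurableType d1) (T2 : measurableType d2) {R : realType}.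
Variable m1 : {sigma_finite_measure set T1 -> \bar R}.
Variable m2 : {sigma_finite_measure set T2 -> \bar R}.
Implicit Types F G : T1 * T2 -> R[i].

Lemma cmeas_pair2 F x : cmeas F -> cmeas (fun y => F (x, y)).
Proof. by apply: cmeas_comp; apply: measurable_fun_pair. Qed.

Lemma cmeas_pair1 F y : cmeas F -> cmeas (fun x => F (x, y)).
Proof. by apply: cmeas_comp; apply: measurable_fun_pair. Qed.

Lemma measurable_Rintegral2 (h : T1 * T2 -> R) : measurable_fun setT h ->
  measurable_fun setT (fun x => \int[m2]_y h (x, y)).
Proof.
move=> mh; have mE : measurable_fun setT (EFin \o h) by exact/measurable_EFinP.
rewrite (_ : (fun _ => _) = fine \o (fun x => fubini_F m2 (EFin \o h)^\+ x -
    fubini_F m2 (EFin \o h)^\- x)%E); last first.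
  apply/funext => x; rewrite /Rintegral/fubini_F integralE /=.
  by congr (fine (_ - _)%E); apply: eq_integral => y _; rewrite ?funeposE ?funenegE.
apply: measurableT_comp => //.
by apply: emeasurable_funB; apply: measurable_fun_fubini_tonelli_F => //;
  [exact: measurable_funepos|exact: measurable_funeneg].
Qed.

Lemma cmeas_cint2 F : cmeas F -> cmeas (fun x => cint m2 (fun y => F (x, y))).
Proof.
by move=> [mF1 mF2]; split;
  [exact: (measurable_Rintegral2 mF1)|exact: (measurable_Rintegral2 mF2)].
Qed.

Lemma measurable_norm1_2 F : cmeas F ->
  measurable_fun setT (fun x => norm1 m2 (fun y => F (x, y))).
Proof.
move=> /measurable_enormc mF; apply: (measurable_fun_fubini_tonelli_F (fun z => (normc (F z))%:E)) => //.
by move=> x; rewrite lee_fin normc_ge0.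
Qed.

Lemma norm1_prod F : cmeas F ->
  norm1 (m1 \x m2)%E F = (\int[m1]_x norm1 m2 (fun y => F (x, y)))%E.
Proof.
move=> mF; rewrite /norm1 fubini_tonelli1//; first exact: measurable_enormc.
by move=> x; rewrite lee_fin normc_ge0.
Qed.

Lemma norm1_swap F : cmeas F ->
  (\int[m1]_x norm1 m2 (fun y => F (x, y)) = \int[m2]_y norm1 m1 (fun x => F (x, y)))%E.
Proof.
move=> mF; rewrite /norm1 (fubini_tonelli (fun z => (normc (F z))%:E))//.
  exact: measurable_enormc.
by move=> x; rewrite lee_fin normc_ge0.
Qed.

Lemma Rintegral_prod (h : T1 * T2 -> R) : (m1 \x m2)%E.-integrable setT (EFin \o h) ->
  \int[(m1 \x m2)%E]_z h z = \int[m1]_x \int[m2]_y h (x, y).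
Proof.
move=> ih; rewrite /Rintegral -integral12_prod_meas1//; congr fine.
have mh : measurable_fun setT h by apply/measurable_EFinP; exact: measurable_int ih.
apply: ae_eq_integral => //.
- exact: measurable_fubini_F ih.
- by apply/measurable_EFinP; exact: measurable_Rintegral2.
- have := ae_integrable1 ih; apply: filterS => x ix _.
  by rewrite fineK//; exact: integrable_fin_num ix.
Qed.

Lemma cint_prod F : cintegrable (m1 \x m2)%E F ->
  cint (m1 \x m2)%E F = cint m1 (fun x => cint m2 (fun y => F (x, y))).
Proof.
move=> iF; rewrite /cint; congr Complex.
  exact: (Rintegral_prod (cintegrable_Re iF)).
exact: (Rintegral_prod (cintegrable_Im iF)).
Qed.

Lemma cintegrable_ae2 F : cintegrable (m1 \x m2)%E F ->
  {ae m1, forall x, cintegrable m2 (fun y => F (x, y))}.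
Proof.
move=> [mF Foo]; have i1 : m1.-integrable setT (fun x => norm1 m2 (fun y => F (x, y))).
  apply/integrableP; split; first exact: measurable_norm1_2.
  under eq_integral do rewrite gee0_abs ?norm1_ge0//.
  by rewrite -norm1_prod.
have := integrable_ae measurableT i1; apply: filterS => x /(_ I) xoo.
split; first exact: cmeas_pair2.
by move: xoo; rewrite ge0_fin_numE// norm1_ge0.
Qed.

Lemma cintegrable_cint2 F : cintegrable (m1 \x m2)%E F ->
  cintegrable m1 (fun x => cint m2 (fun y => F (x, y))).
Proof.
move=> [mF Foo]; apply: (@cintegrable_le _ _ _ _ _ (fun x => norm1 m2 (fun y => F (x, y)))).
- exact: cmeas_cint2.
- exact: measurable_norm1_2.
- by move=> x; apply: le_normc_cint; exact: cmeas_pair2.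
- by rewrite -norm1_prod.
Qed.

(** Reduces almost everywhere equality on a product to the vanishing of an L1 norm,
    to which Tonelli's theorem applies; measurability of the exceptional set is thus
    never an issue. *)
Lemma ae_prod_eq F G : cmeas F -> cmeas G ->
  {ae (m1 \x m2)%E, forall z, F z = G z} <->
  {ae m1, forall x, {ae m2, forall y, F (x, y) = G (x, y)}}.
Proof.
move=> mF mG; have mB := cmeasB mF mG.
rewrite ae_eq_norm1B// norm1_prod//.
have mN := measurable_norm1_2 mB.
have := ae_eq_integral_abs m1 measurableT mN.
under eq_integral do rewrite gee0_abs ?norm1_ge0//.
move=> ->; split; apply: filterS => x.
  by move=> /(_ I) /= n0; apply/ae_eq_norm1B => //; exact: cmeas_pair2.
by move=> /ae_eq_norm1B h _; apply: h; exact: cmeas_pair2.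
Qed.

End product.

Section product_swap.
Context d1 d2 (T1 : measurableType d1) (T2 : measurableType d2) {R : realType}.
Variable m1 : {sigma_finite_measure set T1 -> \bar R}.
Variable m2 : {sigma_finite_measure set T2 -> \bar R}.
Implicit Types F G : T1 * T2 -> R[i].

Let flip (z : T2 * T1) := (z.2, z.1).

Let mflip : measurable_fun setT flip.
Proof. exact: measurable_swap. Qed.

Lemma cmeas_flip F : cmeas F -> cmeas (fun z : T2 * T1 => F (z.2, z.1)).
Proof. exact: cmeas_comp mflip. Qed.

Lemma cintegrable_flip F : cintegrable (m1 \x m2)%E F ->
  cintegrable (m2 \x m1)%E (fun z : T2 * T1 => F (z.2, z.1)).
Proof.
move=> [mF Foo]; split; first exact: cmeas_flip.
rewrite norm1_prod; last exact: cmeas_flip.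
by rewrite -(norm1_swap m1 m2 mF) -norm1_prod.
Qed.

(** Tonelli's criterion, the form in which integrability on products is checked. *)
Lemma cintegrable_prod F : cmeas F ->
  (\int[m1]_x norm1 m2 (fun y => F (x, y)) < +oo)%E -> cintegrable (m1 \x m2)%E F.
Proof. by move=> mF Foo; split => //; rewrite norm1_prod. Qed.

Lemma cint_swap F : cintegrable (m1 \x m2)%E F ->
  cint m1 (fun x => cint m2 (fun y => F (x, y))) =
  cint m2 (fun y => cint m1 (fun x => F (x, y))).
Proof.
move=> iF; have iR := cintegrable_Re iF; have iI := cintegrable_Im iF.
have key (h : T1 * T2 -> R) : (m1 \x m2)%E.-integrable setT (EFin \o h) ->
    \int[m1]_x \int[m2]_y h (x, y) = \int[m2]_y \int[m1]_x h (x, y).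
  move=> ih; rewrite -Rintegral_prod//.
  have mh : measurable_fun setT h by apply/measurable_EFinP; exact: measurable_int ih.
  rewrite /Rintegral -integral21_prod_meas1//; congr fine.
  apply: ae_eq_integral => //.
  - exact: measurable_fubini_G ih.
  - apply/measurable_EFinP.
    exact: (@measurable_Rintegral2 _ _ _ _ _ m1 (fun z => h (z.2, z.1))
      (measurableT_comp mh mflip)).
  - have := ae_integrable2 ih; apply: filterS => x ix _.
    by rewrite fineK//; exact: integrable_fin_num ix.
by rewrite /cint; congr Complex; [exact: key iR|exact: key iI].
Qed.

Lemma ae_prod_swap F G : cmeas F -> cmeas G ->
  {ae m1, forall x, {ae m2, forall y, F (x, y) = G (x, y)}} ->
  {ae m2, forall y, {ae m1, forall x, F (x, y) = G (x, y)}}.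
Proof.
move=> mF mG h; have mB := cmeasB mF mG.
apply/(ae_prod_eq m2 m1 (cmeas_flip mF) (cmeas_flip mG)).
apply/ae_eq_norm1B; [exact: cmeas_flip|exact: cmeas_flip|].
move/(ae_prod_eq m1 m2 mF mG)/(ae_eq_norm1B _ mF mG) : h => <-.
by rewrite (norm1_prod m1 m2 mB) (norm1_swap m1 m2 mB) (norm1_prod m2 m1 (cmeas_flip mB)).
Qed.

End product_swap.

Section measure_preserving.
Context d1 d2 (T1 : measurableType d1) (T2 : measurableType d2) {R : realType}.
Variables (m1 : {measure set T1 -> \bar R}) (m2 : {measure set T2 -> \bar R}).

Definition measure_preserving (p : T1 -> T2) :=
  measurable_fun setT p /\ forall A, measurable A -> m2 A = m1 (p @^-1` A).

Variables (p : T1 -> T2) (pP : measure_preserving p).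

Lemma ge0_integral_mp (f : T2 -> \bar R) : measurable_fun setT f ->
  (forall x, 0 <= f x)%E -> (\int[m2]_y f y = \int[m1]_x f (p x))%E.
Proof.
move=> mf f0; have [mp pm] := pP.
rewrite (eq_measure_integral (pushforward m1 p)); last by move=> A mA _; exact: pm.
by rewrite ge0_integral_pushforward// preimage_setT.
Qed.

Lemma integral_mp (f : T2 -> \bar R) : measurable_fun setT f ->
  (\int[m2]_y f y = \int[m1]_x f (p x))%E.
Proof.
move=> mf; rewrite integralE [RHS]integralE (funepos_comp f p) (funeneg_comp f p).
by congr (_ - _)%E; rewrite ge0_integral_mp//;
  [exact: measurable_funepos|exact: measurable_funeneg].
Qed.

Lemma cint_mp (f : T2 -> R[i]) : cmeas f -> cint m2 f = cint m1 (f \o p).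
Proof.
move=> [mf1 mf2]; rewrite /cint /Rintegral.
by congr (Complex (fine _) (fine _)); rewrite integral_mp//; exact/measurable_EFinP.
Qed.

Lemma norm1_mp (f : T2 -> R[i]) : cmeas f -> norm1 m2 f = norm1 m1 (f \o p).
Proof.
move=> mf; rewrite /norm1 ge0_integral_mp//; first exact: measurable_enormc.
by move=> x; rewrite lee_fin normc_ge0.
Qed.

Lemma cintegrable_mp (f : T2 -> R[i]) : cintegrable m2 f -> cintegrable m1 (f \o p).
Proof.
move=> [mf foo]; split; first by apply: cmeas_comp mf; case: pP.
by rewrite -norm1_mp.
Qed.

Lemma ae_mp (P : T2 -> Prop) : {ae m2, forall y, P y} -> {ae m1, forall x, P (p x)}.
Proof.
move=> [A [mA A0 PA]]; have [mp pm] := pP; exists (p @^-1` A); split.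
- by rewrite -[X in measurable X]setTI; exact: mp.
- by rewrite -A0; apply/esym/pm.
- by move=> x /= nPx; exact: PA.
Qed.

Lemma ae_eq_mp (f g : T2 -> R[i]) : cmeas f -> cmeas g ->
  {ae m2, forall y, f y = g y} <-> {ae m1, forall x, f (p x) = g (p x)}.
Proof.
move=> mf mg; have mp := pP.1.
rewrite !ae_eq_norm1B// ?norm1_mp//; first exact: cmeasB.
- exact: cmeas_comp mp mf.
- exact: cmeas_comp mp mg.
Qed.

End measure_preserving.

(** * Lebesgue measure on row vectors *)

Section measurable_rV_ops.
Context d (T : measurableType d) {R : realType}.

Lemma measurable_rV_coor n (f : T -> 'rV[R]_n) i : measurable_fun setT f ->
  measurable_fun setT (fun t => f t 0 i).
Proof. by move=> mf; exact: (measurableT_comp (measurable_coor i) mf). Qed.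

Lemma measurable_rVD n (f g : T -> 'rV[R]_n) : measurable_fun setT f ->
  measurable_fun setT g -> measurable_fun setT (fun t => f t + g t).
Proof.
move=> mf mg; apply: measurable_fun_rV => i; under eq_fun do rewrite mxE.
by apply: measurable_funD; exact: measurable_rV_coor.
Qed.

Lemma measurable_rVN n (f : T -> 'rV[R]_n) : measurable_fun setT f ->
  measurable_fun setT (fun t => - f t).
Proof.
move=> mf; apply: measurable_fun_rV => i; under eq_fun do rewrite mxE.
by apply: measurable_funN; exact: measurable_rV_coor.
Qed.

Lemma measurable_rVZ n (c : R) (f : T -> 'rV[R]_n) : measurable_fun setT f ->
  measurable_fun setT (fun t => c *: f t).
Proof.
move=> mf; apply: measurable_fun_rV => i; under eq_fun do rewrite mxE.
by apply: measurable_funM => //; exact: measurable_rV_coor.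
Qed.

Lemma measurable_rV_lsub m n (f : T -> 'rV[R]_(m + n)) : measurable_fun setT f ->
  measurable_fun setT (fun t => lsubmx (f t)).
Proof.
move=> mf; apply: measurable_fun_rV => i; under eq_fun do rewrite mxE.
exact: measurable_rV_coor.
Qed.

Lemma measurable_rV_rsub m n (f : T -> 'rV[R]_(m + n)) : measurable_fun setT f ->
  measurable_fun setT (fun t => rsubmx (f t)).
Proof.
move=> mf; apply: measurable_fun_rV => i; under eq_fun do rewrite mxE.
exact: measurable_rV_coor.
Qed.

Lemma measurable_rV_row m n (f : T -> 'rV[R]_m) (g : T -> 'rV[R]_n) :
  measurable_fun setT f -> measurable_fun setT g ->
  measurable_fun setT (fun t => row_mx (f t) (g t)).
Proof.
move=> mf mg; apply: measurable_fun_rV => i.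
have [j ->|j ->] := split_ordP i.
  by under eq_fun do rewrite row_mxEl; exact: measurable_rV_coor.
by under eq_fun do rewrite row_mxEr; exact: measurable_rV_coor.
Qed.

Lemma measurable_dotv n (f g : T -> 'rV[R]_n) : measurable_fun setT f ->
  measurable_fun setT g -> measurable_fun setT (fun t => dotv (f t) (g t)).
Proof.
move=> mf mg; apply: measurable_sum => i.
by apply: measurable_funM; exact: measurable_rV_coor.
Qed.

Lemma cmeas_gaussian n (f : T -> 'rV[R]_n) : measurable_fun setT f ->
  cmeas (fun t => gaussian (f t)).
Proof.
move=> mf; apply: cmeas_real; apply: measurableT_comp; first exact: measurable_expR.
apply: measurable_funN; apply: measurable_funM => //; exact: measurable_dotv.
Qed.

End measurable_rV_ops.

(** Decomposes a measurability goal along the algebraic structure of the function;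
    partial applications appear because unification eta-reduces. *)
Ltac measurability :=
  repeat first
  [ assumption
  | exact: measurable_id | exact: measurable_fst | exact: measurable_snd
  | exact: measurable_cst | exact: cmeas_cst
  | match goal with
    | |- cmeas (fun x => @?f x + @?g x) => apply: cmeasD
    | |- cmeas (fun x => - @?f x) => apply: cmeasN
    | |- cmeas (fun x => @?f x * @?g x) => apply: cmeasM
    | |- cmeas (fun x => conjc (@?f x)) => apply: cmeas_conj
    | |- cmeas (fun x => expi (@?f x)) => apply: cmeas_expi
    | |- cmeas (fun x => gaussian (@?f x)) => apply: cmeas_gaussian
    | |- cmeas (fun x => (@?f x)%:C%C) => apply: cmeas_real
    | H : cmeas ?h |- cmeas (fun x => ?h (@?f x)) => apply: (@cmeas_comp _ _ _ _ _ f h)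
    | H : measurable_fun _ ?h |- measurable_fun _ (fun x => ?h (@?f x)) =>
        apply: (measurableT_comp H)
    | |- measurable_fun _ (fun x => row_mx (@?f x) (@?g x)) => apply: measurable_rV_row
    | |- measurable_fun _ (fun x => lsubmx (@?f x)) => apply: measurable_rV_lsub
    | |- measurable_fun _ (fun x => rsubmx (@?f x)) => apply: measurable_rV_rsub
    | |- measurable_fun _ (fun x => _ *: (@?f x)) => apply: measurable_rVZ
    | |- measurable_fun _ (GRing.scale ?c) => exact: (measurable_rVZ c (@measurable_id _ _ setT))
    | |- measurable_fun _ (@lsubmx _ _ _ _) => exact: (measurable_rV_lsub (@measurable_id _ _ setT))
    | |- measurable_fun _ (@rsubmx _ _ _ _) => exact: (measurable_rV_rsub (@measurable_id _ _ setT))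
    | |- cmeas (@gaussian _ _) => exact: (cmeas_gaussian (@measurable_id _ _ setT))
    | |- cmeas expi => exact: (cmeas_expi (@measurable_id _ _ setT))
    | |- measurable_fun _ (dotv ?s) =>
        exact: (measurable_dotv (measurable_cst s) (@measurable_id _ _ setT))
    | |- measurable_fun _ (GRing.add ?s) => first
        [ exact: (measurable_rVD (measurable_cst s) (@measurable_id _ _ setT))
        | exact: (measurable_funD (measurable_cst s) (@measurable_id _ _ setT)) ]
    | |- measurable_fun _ (@GRing.opp _) => exact: (measurable_rVN (@measurable_id _ _ setT))
    | |- measurable_fun _ (row_mx ?s) =>
        exact: (measurable_rV_row (measurable_cst s) (@measurable_id _ _ setT))
    | |- measurable_fun _ (fun x => dotv (@?f x) (@?g x)) => apply: measurable_dotv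
    | |- measurable_fun _ (fun x => (@?f x, @?g x)) => apply: measurable_fun_pair
    | |- measurable_fun _ (fun x => @?f x + @?g x) =>
        first [apply: measurable_rVD | apply: measurable_funD]
    | |- measurable_fun _ (fun x => - @?f x) =>
        first [apply: measurable_rVN | apply: measurable_funN]
    | |- measurable_fun _ (fun x => @?f x * @?g x) => apply: measurable_funM
    | |- measurable_fun _ (fun x => (@?f x).1) => apply: (measurableT_comp measurable_fst)
    | |- measurable_fun _ (fun x => (@?f x).2) => apply: (measurableT_comp measurable_snd)
    end ].

Section lebesgue_affine.
Context {R : realType}.
Notation leb := (@lebesgue_measure R).

Let preimage_affine_itv (a b p q : R) : a != 0 ->
  leb ((fun t => a * t + b) @^-1` `]p, q]) = (`|a|^-1%:E * leb `]p, q])%E.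
Proof.
move=> a0; rewrite [in RHS]lebesgue_measure_itv/= lte_fin.
have [a_gt0|a_lt0|/eqP] := ltgtP 0 a; last by rewrite eq_sym (negbTE a0).
- rewrite (_ : _ @^-1` _ = `](p - b) / a, (q - b) / a]%classic); last first.
    apply/seteqP; split=> t; rewrite /= !in_itv/= ltr_pdivrMr// ler_pdivlMr//;
    by rewrite ltrBlDr lerBrDr (mulrC t).
  rewrite lebesgue_measure_itv/= lte_fin ltr_pM2r ?invr_gt0// ltrD2r.
  case: ifPn => _; last by rewrite mule0.
  by rewrite -!EFinD -EFinM (gtr0_norm a_gt0); congr EFin; field.
- rewrite (_ : _ @^-1` _ = `[(q - b) / a, (p - b) / a[%classic); last first.
    apply/seteqP; split=> t; rewrite /= !in_itv/= ler_ndivrMr// ltr_ndivlMr//;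
    by rewrite andbC lerBrDr ltrBlDr (mulrC t).
  rewrite lebesgue_measure_itv/= lte_fin ltr_nM2r ?invr_lt0// ltrD2r.
  case: ifPn => _; last by rewrite mule0.
  by rewrite -!EFinD -EFinM (ltr0_norm a_lt0); congr EFin; field; lra.
Qed.

Let maff (a b : R) : measurable_fun setT ((fun t => a * t + b) : measurableTypeR R -> measurableTypeR R).
Proof. by apply: measurable_funD => //; apply: measurable_funM. Qed.

Lemma ge0_integral_affine1 (a b : R) (f : R -> \bar R) : a != 0 ->
  measurable_fun setT f -> (forall x, 0 <= f x)%E ->
  (\int[leb]_t f (a * t + b)%R = `|a|^-1%:E * \int[leb]_t f t)%E.
Proof.
move=> a0 mf f0.
have a1 : 0 <= `|a|^-1 by rewrite invr_ge0.
pose k : {nonneg R} := NngNum (normr_ge0 a).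
pose g : measurableTypeR R -> measurableTypeR R := fun t => a * t + b.
pose pf : {measure set (measurableTypeR R) -> \bar R} := pushforward leb g.
pose nu := pf (maff a b).
pose nuk : {measure set (measurableTypeR R) -> \bar R} := mscale k nu.
have eqm A : measurable A -> leb A = nuk A.
  apply: lebesgue_measure_unique => X [[p q] _ <-].
  rewrite /nuk/= /mscale/= /pushforward/= preimage_affine_itv// muleA -EFinM.
  by rewrite mulfV ?normr_eq0// mul1e.
have -> : (\int[leb]_t f t = \int[nuk]_t f t)%E.
  by apply: eq_measure_integral => A mA _; exact: eqm.
rewrite ge0_integral_mscale// muleA -EFinM mulVf ?normr_eq0// mul1e.
by rewrite ge0_integral_pushforward//; exact: maff.
Qed.

End lebesgue_affine.

Section lebesgue_rV_product.
Context {R : realType}.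

Lemma cons_rVE n (a : R) (x : 'rV[R]_n) : cons_rV (a, x) = row_mx (a%:M : 'rV_1) x.
Proof. by []. Qed.

Lemma integral_rV0 (f : 'rV[R]_0 -> \bar R) : measurable_fun setT f ->
  (\int[lebesgue_rV R 0]_x f x = f 0%R)%E.
Proof.
move=> mf; rewrite [LHS](@integral_dirac _ _ (0 : 'rV[R]_0) R setT measurableT f mf).
by rewrite diracT mul1e.
Qed.

Lemma cons_rV_mp n : measure_preserving
  (@lebesgue_measure R \x lebesgue_rV R n)%E (lebesgue_rV R n.+1) (@cons_rV R n).
Proof. by split => //; exact: measurable_cons_rV. Qed.

Lemma row_mx_cons m n (a : R) (x : 'rV[R]_m) (y : 'rV[R]_n) :
  row_mx (cons_rV (a, x)) y = cons_rV (a, row_mx x y) :> 'rV_(m + n).+1.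
Proof.
rewrite !cons_rVE; have /= := @row_mxA _ _ _ _ _ (a%:M : 'rV_1) x y.
by rewrite castmx_id => ->.
Qed.

(** Makes Fubini's theorem available for the splitting of phase space into position
    and frequency. The measure adjoins one coordinate at a time on the left, which
    dictates the induction on m. *)
Lemma row_mx_mp m n : measure_preserving (lebesgue_rV R m \x lebesgue_rV R n)%E
  (lebesgue_rV R (m + n)) (fun p => row_mx p.1 p.2).
Proof.
have mrow k : measurable_fun setT (fun p : 'rV[R]_k * 'rV[R]_n => row_mx p.1 p.2).
  by measurability.
split; first exact: mrow.
elim: m => [|m IH] A mA.
  apply/esym; apply: etrans (integral_rV0 _) _.
    apply: measurable_fun_xsection.
    by rewrite -[X in measurable X]setTI; exact: mrow.
  congr (lebesgue_rV R n _); apply/seteqP; split => y.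
    by rewrite xsectionE/= row_thin_mx.
  by rewrite xsectionE/= row_thin_mx.
transitivity ((@lebesgue_measure R \x lebesgue_rV R (m + n))%E
  (@cons_rV R (m + n) @^-1` A)) => //.
rewrite /product_measure1.
have mC : measurable (@cons_rV R (m + n) @^-1` A).
  by rewrite -[X in measurable X]setTI; exact: measurable_cons_rV.
have mB : measurable ((fun p : 'rV[R]_m.+1 * 'rV[R]_n => row_mx p.1 p.2) @^-1` A).
  by rewrite -[X in measurable X]setTI; exact: mrow.
have mX := @measurable_fun_xsection _ _ _ _ R (lebesgue_rV R n) _ mB.
apply/esym; apply: (etrans (ge0_integral_mp (cons_rV_mp m) mX _)) => //.
rewrite fubini_tonelli1//; last first.
  by apply: measurableT_comp mX _; exact: measurable_cons_rV.
apply/esym; apply: eq_integral => a _; rewrite /= IH; last exact: measurable_xsection.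
rewrite /product_measure1 /fubini_F/=; apply: eq_integral => x _ /=.
congr (lebesgue_rV R n _); apply/seteqP; split => y; rewrite !xsectionE/=.
  by rewrite row_mx_cons.
by rewrite row_mx_cons.
Qed.

Lemma ge0_integral_cons n (f : 'rV[R]_n.+1 -> \bar R) : measurable_fun setT f ->
  (forall x, 0 <= f x)%E -> (\int[lebesgue_rV R n.+1]_x f x =
  \int[@lebesgue_measure R]_a \int[lebesgue_rV R n]_x f (cons_rV (a, x)))%E.
Proof.
move=> mf f0; rewrite (ge0_integral_mp (cons_rV_mp n))//.
rewrite fubini_tonelli1//; apply: measurableT_comp => //; exact: measurable_cons_rV.
Qed.

Lemma uncons_rVK n : cancel (@uncons_rV R n) (@cons_rV R n).
Proof.
move=> b; rewrite /uncons_rV cons_rVE.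
have <- : lsubmx (b : 'rV_(1 + n)) = (b 0 0)%:M.
  apply/rowP => i; rewrite !ord1 !mxE eqxx mulr1n; congr (b _ _).
  exact/val_inj.
exact: (@hsubmxK R 1 1 n b).
Qed.

Lemma cons_rV_affine n (a : R) (b : 'rV[R]_n.+1) (t : R) (x : 'rV[R]_n) :
  a *: cons_rV (t, x) + b = cons_rV (a * t + b 0 0, a *: x + rsubmx (b : 'rV_(1 + n))).
Proof.
apply: (can_inj (@uncons_rVK n)); rewrite cons_rVK /uncons_rV.
have := cons_rVK (t, x); rewrite /uncons_rV => -[e1 e2]; congr pair.
  by rewrite mxE mxE e1.
apply/rowP => i.
have e2i : cons_rV (t, x) 0 (rshift 1 i) = x 0 i by rewrite -[in RHS]e2 [RHS]mxE.
transitivity (a * cons_rV (t, x) 0 (rshift 1 i) + b 0 (rshift 1 i)).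
  by rewrite mxE mxE [X in X + _ = _]mxE.
by rewrite e2i [RHS]mxE [X in _ = X + _]mxE [X in _ = _ + X]mxE.
Qed.

Lemma ge0_integral_affine n (a : R) (b : 'rV[R]_n) (f : 'rV[R]_n -> \bar R) : a != 0 ->
  measurable_fun setT f -> (forall x, 0 <= f x)%E ->
  (\int[lebesgue_rV R n]_t f (a *: t + b)%R =
    (`|a| ^- n)%:E * \int[lebesgue_rV R n]_t f t)%E.
Proof.
move=> a0; elim: n => [|n IH] in b f *; move=> mf f0.
  rewrite !integral_rV0//; last by measurability.
  by rewrite expr0 invr1 mul1e !thinmx0.
have mc := @measurable_cons_rV R n.
pose I t := (\int[lebesgue_rV R n]_x f (cons_rV (t, x)))%E.
have mI : measurable_fun setT I.
  apply: (measurable_fun_fubini_tonelli_F (f \o @cons_rV R n)).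
    exact: (measurableT_comp mf mc).
  by move=> p; exact: f0.
have I0 t : (0 <= I t)%E by exact: integral_ge0.
transitivity (\int[@lebesgue_measure R]_t ((`|a| ^- n)%:E * I (a * t + b 0 0)%R))%E.
  rewrite ge0_integral_cons//; last by measurability.
  apply: eq_integral => t _; under eq_integral => x _ do rewrite cons_rV_affine.
  apply: (IH _ (fun x => f (cons_rV (a * t + b 0 0, x)))) => //.
  apply: (measurableT_comp mf); apply: (measurableT_comp mc).
  by apply: measurable_fun_pair.
have maff : measurable_fun setT (fun t : measurableTypeR R => a * t + b 0 0).
  by apply: measurable_funD => //; exact: measurable_funM.
rewrite ge0_integralZl//.
- rewrite ge0_integral_affine1// muleA -EFinM ge0_integral_cons//.
  by congr (_%:E * _)%E; rewrite exprSr invfM mulrC.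
- exact: (measurableT_comp mI maff).
Qed.

End lebesgue_rV_product.

Section norms_on_rV.
Context {R : realType}.

Lemma norm1_row m n (f : 'rV[R]_(m + n) -> R[i]) : cmeas f ->
  norm1 (lebesgue_rV R (m + n)) f =
  (\int[lebesgue_rV R m]_x norm1 (lebesgue_rV R n) (fun y => f (row_mx x y)))%E.
Proof.
move=> mf; rewrite (norm1_mp (row_mx_mp m n))// norm1_prod//.
by apply: cmeas_comp mf; measurability.
Qed.

Lemma cint_row m n (f : 'rV[R]_(m + n) -> R[i]) : cintegrable (lebesgue_rV R (m + n)) f ->
  cint (lebesgue_rV R (m + n)) f =
  cint (lebesgue_rV R m) (fun x => cint (lebesgue_rV R n) (fun y => f (row_mx x y))).
Proof.
move=> If; rewrite (cint_mp (row_mx_mp m n)); last by case: If.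
by rewrite cint_prod//; exact: cintegrable_mp (row_mx_mp m n) _ If.
Qed.

Lemma cintegrable_row m n (f : 'rV[R]_(m + n) -> R[i]) :
  cintegrable (lebesgue_rV R (m + n)) f ->
  cintegrable (lebesgue_rV R m \x lebesgue_rV R n)%E (fun p => f (row_mx p.1 p.2)).
Proof. exact: cintegrable_mp (row_mx_mp m n) f. Qed.

Lemma ae_row m n (f g : 'rV[R]_(m + n) -> R[i]) : cmeas f -> cmeas g ->
  {ae lebesgue_rV R (m + n), forall z, f z = g z} <->
  {ae lebesgue_rV R m, forall x, {ae lebesgue_rV R n, forall y, f (row_mx x y) = g (row_mx x y)}}.
Proof.
move=> mf mg; rewrite (ae_eq_mp (row_mx_mp m n) mf mg).
apply: (ae_prod_eq (lebesgue_rV R m) (lebesgue_rV R n)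
  (F := fun p => f (row_mx p.1 p.2)) (G := fun p => g (row_mx p.1 p.2))).
  by apply: cmeas_comp mf; measurability.
by apply: cmeas_comp mg; measurability.
Qed.

Lemma norm1_affine n (a : R) (b : 'rV[R]_n) (f : 'rV[R]_n -> R[i]) : a != 0 -> cmeas f ->
  norm1 (lebesgue_rV R n) (fun t => f (a *: t + b)) =
  ((`|a| ^- n)%:E * norm1 (lebesgue_rV R n) f)%E.
Proof.
move=> a0 mf; rewrite /norm1 (ge0_integral_affine b (f := fun t => (normc (f t))%:E))//.
  exact: measurable_enormc.
by move=> x; rewrite lee_fin normc_ge0.
Qed.

Lemma cintegrable_affine n (a : R) (b : 'rV[R]_n) (f : 'rV[R]_n -> R[i]) : a != 0 ->
  cintegrable (lebesgue_rV R n) f -> cintegrable (lebesgue_rV R n) (fun t => f (a *: t + b)).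
Proof.
move=> a0 [mf foo]; split; first by apply: cmeas_comp mf; measurability.
by rewrite norm1_affine// lte_mul_pinfty// lee_fin invr_ge0 exprn_ge0.
Qed.

Let Rintegral_affine n (a : R) (b : 'rV[R]_n) (f : 'rV[R]_n -> R) : a != 0 ->
  (lebesgue_rV R n).-integrable setT (EFin \o f) ->
  \int[lebesgue_rV R n]_t f (a *: t + b) = (`|a| ^- n) * \int[lebesgue_rV R n]_t f t.
Proof.
move=> a0 If; have mf := measurable_int _ If.
rewrite /Rintegral (integralE _ _ (EFin \o f)) integralE.
rewrite (funepos_comp (EFin \o f) (fun t => a *: t + b)).
rewrite (funeneg_comp (EFin \o f) (fun t => a *: t + b)).
rewrite (ge0_integral_affine b (f := (EFin \o f)^\+%E))//; last exact: measurable_funepos.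
rewrite (ge0_integral_affine b (f := (EFin \o f)^\-%E))//; last exact: measurable_funeneg.
have := integrable_pos_fin_num measurableT If.
have := integrable_neg_fin_num measurableT If.
move: (\int[_]_x _)%E (\int[_]_x _)%E => [p||] [q||]//= _ _.
by rewrite mulrBr.
Qed.

Lemma cint_affine n (a : R) (b : 'rV[R]_n) (f : 'rV[R]_n -> R[i]) : a != 0 ->
  cintegrable (lebesgue_rV R n) f ->
  cint (lebesgue_rV R n) (fun t => f (a *: t + b)) =
  (`|a| ^- n)%:C%C * cint (lebesgue_rV R n) f.
Proof.
move=> a0 If; apply: eq_ReIm; rewrite ?ReM ?ImM /cint /= ?mul0r ?subr0 ?addr0.
  by rewrite (Rintegral_affine b a0 (cintegrable_Re If)).
by rewrite (Rintegral_affine b a0 (cintegrable_Im If)).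
Qed.

Lemma norm1_shift n (b : 'rV[R]_n) (f : 'rV[R]_n -> R[i]) : cmeas f ->
  norm1 (lebesgue_rV R n) (fun t => f (t - b)) = norm1 (lebesgue_rV R n) f.
Proof.
move=> mf; rewrite -[RHS]mul1e; have := norm1_affine (- b) (oner_neq0 R) mf.
rewrite normr1 expr1n invr1 => <-.
by congr norm1; apply/funext => t; rewrite scale1r.
Qed.

End norms_on_rV.

(** * Gaussians and their Fourier transform *)

Section gauss1.
Context {R : realType}.
Notation leb := (@lebesgue_measure R).

Definition gauss1 (t : R) : R := expR (- (pi * t ^+ 2)).

Lemma gauss1_ge0 t : 0 <= gauss1 t. Proof. exact: expR_ge0. Qed.

Lemma measurable_gauss1 : measurable_fun setT gauss1.
Proof.
apply: measurableT_comp; first exact: measurable_expR.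
by apply: measurable_funN; apply: measurable_funM => //; exact: measurable_funX.
Qed.

Let measurable_expM2 (c : R) : measurable_fun setT (fun t : R => expR (- (c * t ^+ 2))).
Proof.
apply: measurableT_comp; first exact: measurable_expR.
by apply: measurable_funN; apply: measurable_funM => //; exact: measurable_funX.
Qed.

Lemma integral_expM2 (c : R) : 0 < c ->
  (\int[leb]_t (expR (- (c * t ^+ 2)))%:E = ((Num.sqrt c)^-1 * Num.sqrt pi)%:E)%E.
Proof.
move=> c0; rewrite EFinM -integralT_gauss.
have s0 : Num.sqrt c != 0 by rewrite gt_eqF// sqrtr_gt0.
have := @ge0_integral_affine1 R (Num.sqrt c) 0 (EFin \o gauss_fun) s0.
rewrite ger0_norm ?sqrtr_ge0// => <-//.
- apply: eq_integral => t _ /=; rewrite /gauss_fun addr0 exprMn sqr_sqrtr//.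
  exact: ltW.
- apply/measurable_EFinP; exact: measurable_gauss_fun.
- by move=> x; rewrite lee_fin gauss_fun_ge0.
Qed.

Lemma integrable_affine1 (a b : R) (f : R -> R) : a != 0 ->
  leb.-integrable setT (EFin \o f) ->
  leb.-integrable setT (EFin \o (fun t => f (a * t + b))).
Proof.
move=> a0 /integrableP[/measurable_EFinP mf foo].
have maff : measurable_fun setT (fun t : R => a * t + b).
  by apply: measurable_funD => //; exact: measurable_funM.
apply/integrableP; split; first by apply/measurable_EFinP; exact: (measurableT_comp mf maff).
rewrite (@ge0_integral_affine1 _ a b (fun t => `|(f t)%:E|)%E)//.
- by rewrite lte_mul_pinfty// lee_fin invr_ge0.
- by apply/measurable_EFinP; exact: measurableT_comp.
Qed.

Lemma Rintegral_affine1 (a b : R) (f : R -> R) : a != 0 ->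
  leb.-integrable setT (EFin \o f) ->
  \int[leb]_t f (a * t + b) = `|a|^-1 * \int[leb]_t f t.
Proof.
move=> a0 If; have mf := measurable_int _ If.
rewrite /Rintegral [X in fine X = _]integralE [X in _ = _ * fine X]integralE.
rewrite (funepos_comp (EFin \o f) (fun t => a * t + b)).
rewrite (funeneg_comp (EFin \o f) (fun t => a * t + b)).
rewrite (@ge0_integral_affine1 _ _ _ ((EFin \o f)^\+%E))//; last exact: measurable_funepos.
rewrite (@ge0_integral_affine1 _ _ _ ((EFin \o f)^\-%E))//; last exact: measurable_funeneg.
have := integrable_pos_fin_num measurableT If.
have := integrable_neg_fin_num measurableT If.
move: (\int[_]_x _)%E (\int[_]_x _)%E => [p||] [q||]//= _ _.
by rewrite mulrBr.
Qed.

Lemma integral_gauss1 : (\int[leb]_t (gauss1 t)%:E = 1)%E.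
Proof.
by rewrite /gauss1 integral_expM2 ?pi_gt0// mulVf// gt_eqF// sqrtr_gt0 pi_gt0.
Qed.

Lemma integrable_expM2 (k c : R) : 0 < c ->
  leb.-integrable setT (EFin \o (fun t => k * expR (- (c * t ^+ 2)))).
Proof.
move=> c0; have i1 : leb.-integrable setT (fun t => (expR (- (c * t ^+ 2)))%:E).
  apply/integrableP; split; first by apply/measurable_EFinP; exact: measurable_expM2.
  under eq_integral do rewrite gee0_abs ?lee_fin ?expR_ge0//.
  by rewrite integral_expM2// ltry.
exact: (integrableZl measurableT k i1).
Qed.

Lemma integrable_gauss1M (h : R -> R) : measurable_fun setT h -> (forall t, `|h t| <= 1) ->
  leb.-integrable setT (EFin \o (fun t => gauss1 t * h t)).
Proof.
move=> mh h1; apply: (le_integrable _ _ _ (integrable_expM2 1 (pi_gt0 R))) => //.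
  by apply/measurable_EFinP; apply: measurable_funM => //; exact: measurable_gauss1.
move=> t _ /=; rewrite lee_fin normrM mul1r (ger0_norm (gauss1_ge0 t)).
by rewrite ler_piMr// gauss1_ge0.
Qed.

Lemma is_derive_integral (f f' : R -> R -> R) (G : R -> R) (a : R) :
  (forall x, leb.-integrable setT (EFin \o f x)) ->
  (forall x y, is_derive x (1 : R) (f ^~ y) (f' x y)) ->
  leb.-integrable setT (EFin \o G) ->
  (forall x y, `|x - a| < 1 -> `|f' x y| <= G y) ->
  is_derive a (1 : R) (fun x => \int[leb]_y f x y) (\int[leb]_y f' a y).
Proof.
move=> intf df iG fG.
have Ia : `]a - 1, a + 1[%classic a by rewrite /= in_itv/= ltrBlDr ltrDl ltr01.
have If x : `]a - 1, a + 1[%classic x -> `|x - a| < 1.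
  by rewrite /= in_itv/= ltr_norml => /andP[h1 h2]; apply/andP; split; lra.
have G0 y : 0 <= G y by apply: le_trans (fG a y _) => //; rewrite subrr normr0.
have dE x y : partial1of2 f x y = f' x y.
  by rewrite partial1of2E; exact: (@derive_val _ _ _ _ _ _ _ (df x y)).
have i1 x : `]a - 1, a + 1[%classic x -> leb.-integrable setT (EFin \o f x).
  by move=> _; exact: intf.
have d1 x y : `]a - 1, a + 1[%classic x -> setT y -> derivable (f ^~ y) x 1.
  by move=> _ _; exact: (@ex_derive _ _ _ _ _ _ _ (df x y)).
have b1 x y : `]a - 1, a + 1[%classic x -> setT y -> `|partial1of2 f x y| <= G y.
  by move=> Ix _; rewrite dE; exact: fG (If _ Ix).
apply: DeriveDef.
  exact: (derivable_under_integral measurableT Ia i1 d1 G0 iG b1).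
rewrite -derive1E (differentiation_under_integral measurableT Ia i1 d1 G0 iG b1).
by apply: eq_Rintegral => y _; rewrite dE.
Qed.

(** Absorbs a linear factor into half of the Gaussian decay. *)
Let absorb (s : R) : `|s| * gauss1 s <= expR (- (pi / 2 * s ^+ 2)).
Proof.
have -> : gauss1 s = expR (- (pi / 2 * s ^+ 2)) * expR (- (pi / 2 * s ^+ 2)).
  by rewrite -expRD /gauss1; congr expR; lra.
rewrite mulrA ler_piMl ?expR_ge0//.
rewrite expRN ler_pdivrMr ?expR_gt0// mul1r.
have := expR_ge1Dx (pi / 2 * s ^+ 2).
have := @pi_ge2 R; have := sqr_ge0 (`|s| - 1); have := sqr_ge0 s.
rewrite -(real_normK (num_real s)); nra.
Qed.

Let decay (t h : R) : `|h| < 1 ->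
  expR (- (pi / 2 * (t + h) ^+ 2)) <= expR (pi / 2) * expR (- (pi / 4 * t ^+ 2)).
Proof.
move=> h1; rewrite -expRD ler_expR.
have h2 : h ^+ 2 <= 1 by rewrite -(real_normK (num_real h)) expr_le1// ltW.
have := pi_gt0 R; have := sqr_ge0 (t + 2 * h); nra.
Qed.

Let J (w : R) := \int[leb]_t (gauss1 t * cos (2 * pi * w * t)).
Let J' (w : R) := \int[leb]_t (- (2 * pi * t * gauss1 t * sin (2 * pi * w * t))).

Let measurable_cosM (c : R) : measurable_fun setT (fun t : R => cos (c * t)).
Proof.
apply: (measurableT_comp (f := @cos R)).
  by apply: continuous_measurable_fun; exact: continuous_cos.
exact: measurable_funM.
Qed.

Let measurable_sinM (c : R) : measurable_fun setT (fun t : R => sin (c * t)).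
Proof.
apply: (measurableT_comp (f := @sin R)).
  by apply: continuous_measurable_fun; exact: continuous_sin.
exact: measurable_funM.
Qed.

Let bound_J' x t : `|- (2 * pi * t * gauss1 t * sin (2 * pi * x * t))| <=
  2 * pi * expR (- (pi / 2 * t ^+ 2)).
Proof.
have -> : - (2 * pi * t * gauss1 t * sin (2 * pi * x * t)) =
  (2 * pi) * (t * gauss1 t * - sin (2 * pi * x * t)) by ring.
rewrite normrM (ger0_norm (mulr_ge0 (ler0n R 2) (pi_ge0 R))).
rewrite ler_wpM2l ?mulr_ge0 ?pi_ge0// (le_trans _ (absorb t))//.
rewrite normrM normrN normrM (ger0_norm (gauss1_ge0 t)).
by rewrite ler_piMr ?mulr_ge0 ?gauss1_ge0// ler_norml sin_geN1 sin_le1.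
Qed.

Let integrable_J' w : leb.-integrable setT
  (EFin \o (fun t => - (2 * pi * t * gauss1 t * sin (2 * pi * w * t)))).
Proof.
have c0 : 0 < pi / 2 :> R by rewrite divr_gt0// pi_gt0.
apply: (le_integrable _ _ _ (integrable_expM2 (2 * pi) c0)) => //.
  apply/measurable_EFinP; apply: measurable_funN.
  apply: measurable_funM; last exact: measurable_sinM.
  by apply: measurable_funM; [exact: measurable_funM|exact: measurable_gauss1].
move=> t _; rewrite lee_fin; apply: le_trans (bound_J' w t) _.
exact: ler_norm.
Qed.

Global Instance is_derive_gauss1 t : is_derive t (1 : R) gauss1 (- (2 * pi * t) * gauss1 t).
Proof.
apply: is_derive_eq.
by rewrite /gauss1 /GRing.scale/=; ring.
Qed.

Let is_derive_J w : is_derive w (1 : R) J (J' w).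
Proof.
apply: (@is_derive_integral (fun w t => gauss1 t * cos (2 * pi * w * t))
  (fun w t => - (2 * pi * t * gauss1 t * sin (2 * pi * w * t)))
  (fun t => 2 * pi * expR (- (pi / 2 * t ^+ 2)))).
- by move=> x; apply: integrable_gauss1M => // t; rewrite ler_norml cos_geN1 cos_le1.
- move=> x y; apply: is_derive_eq.
  by rewrite /GRing.scale/=; ring.
- by apply: integrable_expM2; rewrite divr_gt0// pi_gt0.
- by move=> x t _; exact: bound_J'.
Qed.

(** The integral of the derivative of an integrable function vanishes, because
   the integral of its translates is constant. *)
Let J'E w : J' w = - (2 * pi * w * J w).
Proof.
pose g (t : R) := gauss1 t * sin (2 * pi * w * t).
pose g' (t : R) := - (2 * pi * t * gauss1 t * sin (2 * pi * w * t)) +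
   2 * pi * w * (gauss1 t * cos (2 * pi * w * t)).
have ig : leb.-integrable setT (EFin \o g).
  by apply: integrable_gauss1M => // t; rewrite ler_norml sin_geN1 sin_le1.
have ic : leb.-integrable setT (EFin \o (fun t => gauss1 t * cos (2 * pi * w * t))).
  by apply: integrable_gauss1M => // t; rewrite ler_norml cos_geN1 cos_le1.
have tr h : \int[leb]_t g (t + h) = \int[leb]_t g t.
  have := Rintegral_affine1 h (oner_neq0 R) ig; rewrite normr1 invr1 mul1r => <-.
  by apply: eq_Rintegral => t _; rewrite mul1r.
have dg t : is_derive t (1 : R) g (g' t).
  apply: is_derive_eq.
  by rewrite /g' /GRing.scale/=; ring.
have : is_derive 0 (1 : R) (fun h => \int[leb]_t g (t + h)) (\int[leb]_t g' (t + 0)).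
  apply: (@is_derive_integral (fun h t => g (t + h)) (fun h t => g' (t + h))
    (fun t => (2 * pi + 2 * pi * `|w|) * expR (pi / 2) * expR (- (pi / 4 * t ^+ 2)))).
  - move=> h; have := integrable_affine1 h (oner_neq0 R) ig.
    by congr (_.-integrable _ _); apply/funext => t /=; rewrite mul1r.
  - move=> h t; have d1 : is_derive h (1 : R) (fun h => t + h) 1.
      by have := is_deriveD (is_derive_cst t h (1 : R)) (is_derive_id h (1 : R)); rewrite add0r.
    have := is_derive1_comp (dg (t + h)) d1.
    by rewrite mulr1.
  - by apply: integrable_expM2; rewrite divr_gt0// pi_gt0.
  - move=> h t; rewrite subr0 => h1; rewrite -mulrA.
    apply: le_trans (ler_wpM2l _ (decay t h1)); last first.
      by rewrite addr_ge0// !mulr_ge0// pi_ge0.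
    rewrite (le_trans (ler_normD _ _))// (mulrDl (2 * pi)) lerD ?bound_J'//.
    rewrite normrM [`|2 * pi * w|]normrM (ger0_norm (mulr_ge0 (ler0n R 2) (pi_ge0 R))).
    rewrite ler_wpM2l ?mulr_ge0 ?pi_ge0// normrM (ger0_norm (gauss1_ge0 _)).
    rewrite (@le_trans _ _ (gauss1 (t + h)))//.
      by rewrite ler_piMr ?gauss1_ge0// ler_norml cos_geN1 cos_le1.
    by rewrite ler_expR; have := pi_gt0 R; have := sqr_ge0 (t + h); nra.
under [X in is_derive _ _ X]eq_fun do rewrite tr.
move=> dk; have : \int[leb]_t g' (t + 0) = 0.
  by rewrite -(@derive_val _ _ _ _ _ _ _ dk) derive_cst.
have -> : \int[leb]_t g' (t + 0) = J' w + 2 * pi * w * J w.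
  rewrite -RintegralZl// -RintegralD//.
  - by apply: eq_Rintegral => t _; rewrite addr0.
  - exact: (integrableZl measurableT (2 * pi * w) ic).
by move=> /eqP; rewrite addr_eq0 => /eqP ->.
Qed.

(** The transform J solves J' = - 2 pi w J, by differentiation under the integral sign
    and an integration by parts; hence J(w) exp(pi w^2) is constant. *)
Lemma gauss1_cos w : \int[leb]_t (gauss1 t * cos (2 * pi * w * t)) = gauss1 w.
Proof.
pose M (w : R) := J w * expR (pi * w ^+ 2).
have dM x : is_derive x (1 : R) M 0.
  have dE : is_derive x (1 : R) (fun w => expR (pi * w ^+ 2)) (expR (pi * x ^+ 2) * (2 * pi * x)).
    apply: is_derive_eq.
    by rewrite /GRing.scale/=; ring.
  have := is_deriveM (is_derive_J x) dE.
  by congr is_derive; rewrite J'E /GRing.scale/=; ring.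
have M0 : M 0 = 1.
  rewrite /M expr0n/= mulr0 expR0 mulr1 /J.
  under eq_Rintegral do rewrite mulr0 mul0r cos0 mulr1.
  by rewrite /Rintegral integral_gauss1.
have : M w = 1 by rewrite -M0; exact: is_derive_0_is_cst.
rewrite /M -/(J w) => /(congr1 ( *%R^~ (expR (- (pi * w ^+ 2))))).
by rewrite mul1r -mulrA -expRD subrr expR0 mulr1.
Qed.

Lemma gauss1_sin w : \int[leb]_t (gauss1 t * sin (2 * pi * w * t)) = 0.
Proof.
have ig : leb.-integrable setT (EFin \o (fun t => gauss1 t * sin (2 * pi * w * t))).
  by apply: integrable_gauss1M => // t; rewrite ler_norml sin_geN1 sin_le1.
have N1 : (-1 : R) != 0 by rewrite oppr_eq0 oner_neq0.
have := Rintegral_affine1 0 N1 ig; rewrite normrN1 invr1 mul1r => e.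
have : \int[leb]_t (gauss1 t * sin (2 * pi * w * t)) =
  - \int[leb]_t (gauss1 t * sin (2 * pi * w * t)).
  rewrite -[LHS]e -[RHS]mulN1r -(RintegralZl (-1) measurableT ig).
  apply: eq_Rintegral => t _.
  by rewrite addr0 mulN1r mulrN sinN /gauss1 sqrrN mulrN mulN1r.
lra.
Qed.

End gauss1.

Section dotv_theory.
Context {R : realType}.

Lemma dotvC n (x y : 'rV[R]_n) : dotv x y = dotv y x.
Proof. by apply: eq_bigr => i _; rewrite mulrC. Qed.

Lemma dotvDl n (x y z : 'rV[R]_n) : dotv (x + y) z = dotv x z + dotv y z.
Proof. by rewrite -big_split; apply: eq_bigr => i _; rewrite mxE mulrDl. Qed.

Lemma dotvZl n (a : R) (x y : 'rV[R]_n) : dotv (a *: x) y = a * dotv x y.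
Proof. by rewrite /dotv big_distrr /=; apply: eq_bigr => i _; rewrite mxE mulrA. Qed.

Lemma dotvDr n (x y z : 'rV[R]_n) : dotv z (x + y) = dotv z x + dotv z y.
Proof. by rewrite dotvC dotvDl !(dotvC z). Qed.

Lemma dotvZr n (a : R) (x y : 'rV[R]_n) : dotv x (a *: y) = a * dotv x y.
Proof. by rewrite dotvC dotvZl dotvC. Qed.

Lemma dotvNl n (x y : 'rV[R]_n) : dotv (- x) y = - dotv x y.
Proof. by rewrite -scaleN1r dotvZl mulN1r. Qed.

Lemma dotvNr n (x y : 'rV[R]_n) : dotv x (- y) = - dotv x y.
Proof. by rewrite dotvC dotvNl dotvC. Qed.

Lemma dotv0l n (x : 'rV[R]_n) : dotv 0 x = 0.
Proof. by rewrite -(scale0r 0) dotvZl mul0r. Qed.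

Lemma dotv_row m n (x1 x2 : 'rV[R]_m) (y1 y2 : 'rV[R]_n) :
  dotv (row_mx x1 y1) (row_mx x2 y2) = dotv x1 x2 + dotv y1 y2.
Proof.
rewrite /dotv big_split_ord; congr (_ + _); apply: eq_bigr => i _.
  by rewrite !row_mxEl.
by rewrite !row_mxEr.
Qed.

Lemma dotv_cons n (a b : R) (x y : 'rV[R]_n) :
  dotv (cons_rV (a, x)) (cons_rV (b, y)) = a * b + dotv x y.
Proof.
rewrite (@dotv_row 1 n (a%:M) (b%:M) x y); congr (_ + _).
by rewrite /dotv big_ord1 !mxE eqxx !mulr1n.
Qed.

Lemma dotv_ge0 n (x : 'rV[R]_n) : 0 <= dotv x x.
Proof. by apply: sumr_ge0 => i _; rewrite -expr2 sqr_ge0. Qed.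

End dotv_theory.

Ltac dotv_expand := rewrite ?(dotvDl, dotvDr, dotvNl, dotvNr, dotvZl, dotvZr).

Section gaussian_theory.
Context {R : realType}.

Definition gaussR n (x : 'rV[R]_n) : R := expR (- (pi * dotv x x)).

Lemma gaussianE n (x : 'rV[R]_n) : gaussian x = (gaussR x)%:C%C.
Proof. by []. Qed.

Lemma gaussR_gt0 n (x : 'rV[R]_n) : 0 < gaussR x.
Proof. exact: expR_gt0. Qed.

Lemma gaussR_le1 n (x : 'rV[R]_n) : gaussR x <= 1.
Proof. by rewrite -expR0 ler_expR oppr_le0 mulr_ge0 ?pi_ge0// dotv_ge0. Qed.

Lemma normc_gaussian n (x : 'rV[R]_n) : normc (gaussian x) = gaussR x.
Proof. by rewrite gaussianE normc_real ger0_norm// ltW// gaussR_gt0. Qed.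

Lemma normc_gaussian_le1 n (x : 'rV[R]_n) : normc (gaussian x) <= 1.
Proof. by rewrite normc_gaussian gaussR_le1. Qed.

Lemma conjc_gaussian n (x : 'rV[R]_n) : conjc (gaussian x) = gaussian x.
Proof. by rewrite gaussianE conjc_real. Qed.

Lemma gaussian_row m n (x : 'rV[R]_m) (y : 'rV[R]_n) :
  gaussian (row_mx x y) = gaussian x * gaussian y.
Proof. by rewrite !gaussianE -real_complexM /gaussR dotv_row mulrDr opprD expRD. Qed.

Lemma gaussian_cons n (a : R) (x : 'rV[R]_n) :
  gaussian (cons_rV (a, x)) = (gauss1 a)%:C%C * gaussian x.
Proof.
by rewrite !gaussianE -real_complexM /gaussR dotv_cons mulrDr opprD expRD -expr2.
Qed.

Lemma gaussianN n (x : 'rV[R]_n) : gaussian (- x) = gaussian x.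
Proof. by rewrite !gaussianE /gaussR dotvNl dotvNr opprK. Qed.

Lemma norm1_gaussian n : norm1 (lebesgue_rV R n) (@gaussian R n) = 1%E.
Proof.
elim: n => [|n IH]; rewrite /norm1; first rewrite integral_rV0.
- by rewrite normc_gaussian /gaussR dotv0l mulr0 oppr0 expR0.
- by apply: measurable_enormc; measurability.
rewrite ge0_integral_cons; last 2 first.
- by apply: measurable_enormc; measurability.
- by move=> x; rewrite lee_fin normc_ge0.
rewrite -[RHS]integral_gauss1; apply: eq_integral => a _.
transitivity ((gauss1 a)%:E * norm1 (lebesgue_rV R n) (@gaussian R n))%E; last first.
  by rewrite IH mule1.
rewrite -ge0_integralZl//.
- apply: eq_integral => x _; rewrite gaussian_cons normcM normc_real EFinM.
  by rewrite ger0_norm// gauss1_ge0.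
- by apply: measurable_enormc; measurability.
- by move=> x _; rewrite lee_fin normc_ge0.
- by rewrite lee_fin gauss1_ge0.
Qed.

Lemma cintegrable_gaussian n : cintegrable (lebesgue_rV R n) (@gaussian R n).
Proof. by split; [measurability|rewrite norm1_gaussian ltry]. Qed.

Lemma cint_cons n (f : 'rV[R]_n.+1 -> R[i]) : cintegrable (lebesgue_rV R n.+1) f ->
  cint (lebesgue_rV R n.+1) f =
  cint (@lebesgue_measure R) (fun a => cint (lebesgue_rV R n) (fun x => f (cons_rV (a, x)))).
Proof.
move=> If; rewrite (cint_mp (cons_rV_mp n)); last by case: If.
by rewrite cint_prod//; exact: cintegrable_mp (cons_rV_mp n) _ If.
Qed.

Lemma cintegrable_expiM d (T : measurableType d) (mu : {measure set T -> \bar R})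
    (f : T -> R[i]) (h : T -> R) : cintegrable mu f -> measurable_fun setT h ->
  cintegrable mu (fun x => f x * expi (h x)).
Proof.
move=> If mh; apply: (@cintegrableM_bounded _ _ _ _ _ _ 1) => //.
  exact: cmeas_expi.
by move=> x; rewrite normc_expi.
Qed.

Lemma cintegrable_gauss1 : cintegrable (@lebesgue_measure R) (fun t => (gauss1 t)%:C%C).
Proof.
split; first by apply: cmeas_real; exact: measurable_gauss1.
rewrite /norm1; under eq_integral do rewrite normc_real ger0_norm ?gauss1_ge0//.
by rewrite integral_gauss1 ltry.
Qed.

Lemma cint_rV0 (f : 'rV[R]_0 -> R[i]) : cmeas f -> cint (lebesgue_rV R 0) f = f 0.
Proof.
move=> [mR mI]; apply: eq_ReIm.
  have mE : measurable_fun setT (fun x => (Re (f x))%:E) by exact/measurable_EFinP.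
  exact: (congr1 fine (integral_rV0 mE)).
have mE : measurable_fun setT (fun x => (Im (f x))%:E) by exact/measurable_EFinP.
exact: (congr1 fine (integral_rV0 mE)).
Qed.

(** Induction on the dimension: the Gaussian is a product of one-dimensional ones,
    whose cosine transform is known and whose sine transform vanishes by oddness. *)
Lemma fourier_gaussian n (y : 'rV[R]_n) :
  cint (lebesgue_rV R n) (fun t => gaussian t * expi (2 * pi * dotv t y)) = gaussian y.
Proof.
elim: n => [|n IH] in y *.
  by rewrite cint_rV0; [rewrite (thinmx0 y) dotv0l mulr0 expi0 mulr1|measurability].
have If : cintegrable (lebesgue_rV R n.+1)
    (fun t => gaussian t * expi (2 * pi * dotv t y)).
  by apply: cintegrable_expiM; [exact: cintegrable_gaussian|measurability].
rewrite cint_cons// -(uncons_rVK y) /uncons_rV; set b := y 0 0; set w := rsubmx _.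
have Ig : cintegrable (lebesgue_rV R n) (fun x => gaussian x * expi (2 * pi * dotv x w)).
  by apply: cintegrable_expiM; [exact: cintegrable_gaussian|measurability].
transitivity (cint (@lebesgue_measure R) (fun a =>
    gaussian w * ((gauss1 a)%:C%C * expi (2 * pi * (a * b))))).
  apply: eq_cint => a; rewrite (mulrC (gaussian w)) -IH -cintZ//; apply: eq_cint => x.
  rewrite gaussian_cons dotv_cons mulrDr expiD.
  by rewrite mulrACA mulrCA !mulrA.
have mb : measurable_fun setT (fun a : measurableTypeR R => 2 * pi * (a * b)).
  by apply: measurable_funM => //; exact: measurable_funM.
rewrite cintZ; last exact: cintegrable_expiM cintegrable_gauss1 mb.
rewrite gaussian_cons mulrC; congr (_ * _); apply: eq_ReIm; rewrite /cint/=.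
  rewrite -gauss1_cos; apply: eq_Rintegral => t _.
  by rewrite mul0r subr0 (mulrC t) mulrA.
rewrite -[RHS](gauss1_sin b); apply: eq_Rintegral => t _.
by rewrite mul0r addr0 (mulrC t) mulrA.
Qed.

Lemma fourier_gaussian_affine n (a : R) (m y : 'rV[R]_n) : 0 < a ->
  cint (lebesgue_rV R n) (fun t => gaussian (a *: (t - m)) * expi (2 * pi * dotv t y)) =
  (a ^- n)%:C%C * (expi (2 * pi * dotv m y) * gaussian (a^-1 *: y)).
Proof.
move=> a0; have ane0 : a != 0 by rewrite gt_eqF.
pose f (t : 'rV[R]_n) := gaussian t * expi (2 * pi * dotv t (a^-1 *: y)).
have If : cintegrable (lebesgue_rV R n) f.
  by apply: cintegrable_expiM; [exact: cintegrable_gaussian|measurability].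
rewrite -fourier_gaussian -/f -cintZ// -(gtr0_norm a0).
rewrite -(cint_affine (- (a *: m)) ane0); last exact: cintegrableZ.
apply: eq_cint => t; rewrite /f (gtr0_norm a0) scalerBr mulrCA -expiD.
congr (_ * expi _); dotv_expand; field.
exact: ane0.
Qed.

End gaussian_theory.

(** * Boxes separate integrable functions *)

Section boxes.
Context {R : realType}.

Definition box n (p q : 'rV[R]_n) : set 'rV[R]_n :=
  [set t | forall i, p 0 i < t 0 i <= q 0 i].

Lemma measurable_box n (p q : 'rV[R]_n) : measurable (box p q).
Proof.
rewrite (_ : box p q = \bigcap_(i in [set: 'I_n])
    (fun t : 'rV[R]_n => t 0 i : measurableTypeR R) @^-1` `]p 0 i, q 0 i]); last first.
  apply/seteqP; split => t /= h i; first by move=> _; rewrite /= in_itv/=; exact: h.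
  by have := h i I; rewrite /= in_itv.
apply: fin_bigcap_measurable => [|i _]; first exact: finite_finset.
rewrite -[X in measurable X]setTI; exact: measurable_coor.
Qed.

Lemma boxI n (p q p' q' : 'rV[R]_n) : box p q `&` box p' q' =
  box (\row_i Num.max (p 0 i) (p' 0 i)) (\row_i Num.min (q 0 i) (q' 0 i)).
Proof.
apply/seteqP; split => t /=.
  by move=> [h h'] i; move: (h i) (h' i); rewrite !mxE gt_max le_min => /andP[-> ->] /andP[-> ->].
move=> h; split => i; have := h i; rewrite !mxE gt_max le_min;
  by move=> /andP[/andP[h1 h2] /andP[h3 h4]]; apply/andP.
Qed.

Definition boxes n : set (set 'rV[R]_n) := [set A | exists p q, A = box p q].
Arguments boxes n : clear implicits.

Definition cube n (N : nat) : set 'rV[R]_n := box (const_mx (- N%:R)) (const_mx N%:R).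

Lemma in_cube n (t : 'rV[R]_n) : \forall N \near \oo, cube N t.
Proof.
have h i : \forall N \near \oo, - N%:R < t 0 i <= N%:R.
  near=> N; have tN : `|t 0 i| < N%:R.
    near: N; exact: nbhs_infty_gtr.
  by move: tN; rewrite ltr_norml => /andP[-> /ltW ->].
have : \forall N \near \oo, forall i, - N%:R < t 0 i <= N%:R by exact: filter_forall.
by apply: filterS => N hN i; rewrite !mxE.
Unshelve. all: by end_near. Qed.

Lemma coor_preimage_boxes n (i : 'I_n) (a b : R) :
  <<s boxes n>> ((fun t : 'rV[R]_n => t 0 i) @^-1` `]a, b]).
Proof.
rewrite (_ : _ @^-1` _ = \bigcup_N box (\row_j if j == i then a else - N%:R)
   (\row_j if j == i then b else N%:R)); last first.
  apply/seteqP; split => t /=.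
    rewrite in_itv/= => h; have [N _ hN] := in_cube t; exists N => // j.
    rewrite !mxE; case: eqP => [->//|_].
    by have := hN N (leqnn N) j; rewrite !mxE.
  by move=> [N _ /(_ i)]; rewrite !mxE eqxx in_itv.
apply: sigma_algebra_bigcup => N.
by apply: sub_sigma_algebra; eexists; eexists.
Qed.

Lemma measurable_boxesE n : @measurable _ 'rV[R]_n = <<s boxes n>>.
Proof.
apply/seteqP; split; last first.
  apply: smallest_sub; first exact: sigma_algebra_measurable.
  by move=> _ [p [q ->]]; exact: measurable_box.
apply: smallest_sub; first exact: smallest_sigma_algebra.
move=> A; rewrite -bigcup_seq/= => -[i _ [Y mY <-]]; rewrite setTI.
pose C := [set Y : set R | <<s boxes n>> ((fun t : 'rV[R]_n => t 0 i) @^-1` Y)].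
suff : <<s @ocitv R >> `<=` C by apply.
apply: smallest_sub; last by move=> _ [[a b] _ <-]; exact: coor_preimage_boxes.
split.
- by rewrite /C/= preimage_set0; exact: sigma_algebra0.
- by move=> B CB; rewrite /C/= setTD preimage_setC; exact: sigma_algebraC.
- by move=> F CF; rewrite /C/= preimage_bigcup; exact: sigma_algebra_bigcup.
Qed.

Let ae0_integral_boxes n (h : 'rV[R]_n -> R) :
  (lebesgue_rV R n).-integrable setT (EFin \o h) ->
  (\int[lebesgue_rV R n]_t (h t)%:E = 0)%E ->
  (forall p q, \int[lebesgue_rV R n]_(t in box p q) (h t)%:E = 0)%E ->
  {ae lebesgue_rV R n, forall t, h t = 0}.
Proof.
move=> ih hT hb.
have iS A : measurable A -> (lebesgue_rV R n).-integrable A (EFin \o h).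
  by move=> mA; exact: integrableS ih.
have key A : measurable A -> (\int[lebesgue_rV R n]_(t in A) (h t)%:E = 0)%E.
  rewrite measurable_boxesE; move: A.
  apply: (@dynkin_induction _ _ (boxes n)
    (fun A => \int[lebesgue_rV R n]_(t in A) (h t)%:E = 0)%E).
  - exact: measurable_boxesE.
  - by move=> _ _ [p [q ->]] [p' [q' ->]]; rewrite boxI; eexists; eexists.
  - exact: hT.
  - by move=> _ [p [q ->]]; exact: hb.
  - move=> S mS S0; move: hT; rewrite -(setUv S) integral_setU//.
    + by rewrite S0 add0e.
    + exact: measurableC.
    + by rewrite setUv; exact: measurable_int ih.
    + by rewrite disj_set2E setICr.
  - move=> F mF tF F0; rewrite integral_bigcup//.
      by rewrite eseries0.
    by apply: iS; exact: bigcup_measurable.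
have := @integral_ae_eq _ _ _ (lebesgue_rV R n) setT measurableT (cst 0%E) (EFin \o h) ih
  (measurable_cst _).
move=> /(_ _)[].
- by move=> E _ mE; rewrite key// integral0.
- move=> A hA; exists A; case: hA => [mA A0 hA]; split => // x hx.
  by apply: hA => /= e; apply: hx; have [] := e I.
Qed.

(** Boxes are stable under intersection and generate the sigma-algebra, so by
    Dynkin's lemma the integrals of f over all measurable subsets of a cube vanish
    as soon as those over boxes do. *)
Lemma boxes_ae0 n (f : 'rV[R]_n -> R[i]) : cmeas f ->
  (forall p q, cintegrable (lebesgue_rV R n) (fun t => (\1_(box p q) t)%:C%C * f t)) ->
  (forall p q, cint (lebesgue_rV R n) (fun t => (\1_(box p q) t)%:C%C * f t) = 0) ->
  {ae lebesgue_rV R n, forall t, f t = 0}.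
Proof.
move=> mf If f0.
have step N : {ae lebesgue_rV R n, forall t, cube N t -> f t = 0}.
  have sep (h : 'rV[R]_n -> R) :
      (forall p q, (lebesgue_rV R n).-integrable setT (EFin \o (fun t => \1_(box p q) t * h t))) ->
      (forall p q, \int[lebesgue_rV R n]_t (\1_(box p q) t * h t) = 0) ->
      {ae lebesgue_rV R n, forall t, \1_(cube N) t * h t = 0}.
    move=> ih h0.
    have h0E p q : (\int[lebesgue_rV R n]_t (\1_(box p q) t * h t)%:E = 0)%E.
      by have := congr1 EFin (h0 p q); rewrite /Rintegral fineK//; exact: integrable_fin_num (ih p q).
    apply: ae0_integral_boxes; [exact: ih|exact: h0E|move=> p q].
    rewrite integral_mkcond -(h0E (\row_i Num.max (p 0 i) ((const_mx (- N%:R) : 'rV_n) 0 i))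
      (\row_i Num.min (q 0 i) ((const_mx N%:R : 'rV_n) 0 i))).
    rewrite -boxI -/(cube N); apply: eq_integral => t _.
    rewrite patchE !indicE in_setI; case: (t \in box p q) => //=.
    by rewrite mul0r.
  have hR := sep (fun t => Re (f t)) _ _.
  have hI := sep (fun t => Im (f t)) _ _.
  have {hR} hR : {ae lebesgue_rV R n, forall t, \1_(cube N) t * Re (f t) = 0}.
    apply: hR => p q.
      have := cintegrable_Re (If p q); congr (_.-integrable _ _).
      by apply/funext => t /=; rewrite ReM/= mul0r subr0.
    have := congr1 (@complex.Re R) (f0 p q); rewrite /cint/= => <-.
    by apply: eq_Rintegral => t _; rewrite ReM/= mul0r subr0.
  have {hI} hI : {ae lebesgue_rV R n, forall t, \1_(cube N) t * Im (f t) = 0}.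
    apply: hI => p q.
      have := cintegrable_Im (If p q); congr (_.-integrable _ _).
      by apply/funext => t /=; rewrite ImM/= mul0r addr0.
    have := congr1 (@complex.Im R) (f0 p q); rewrite /cint/= => <-.
    by apply: eq_Rintegral => t _; rewrite ImM/= mul0r addr0.
  apply: filterS2 hR hI => t hR hI ct; move: hR hI.
  by rewrite indicE mem_set// !mul1r => hR hI; exact: eq_ReIm.
have : {ae lebesgue_rV R n, forall t, forall N, cube N t -> f t = 0} by apply: ae_foralln.
apply: filterS => t ht; have [N _ hN] := in_cube t.
exact: ht N (hN N (leqnn N)).
Qed.

Lemma hyperplane_null n (i : 'I_n) (c : R) : {ae lebesgue_rV R n, forall t : 'rV[R]_n, t 0 i != c}.
Proof.
have mH m (j : 'I_m) : measurable [set t : 'rV[R]_m | t 0 j = c].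
  rewrite -[X in measurable X]setTI.
  apply: (@measurable_coor R m j measurableT [set c]); exact: measurable_set1.
exists [set t : 'rV[R]_n | t 0 i = c]; split; first exact: mH; last first.
  by move=> t /= /negP; rewrite negbK => /eqP.
elim: n => [|n IH] in i *; first by case: i.
transitivity ((@lebesgue_measure R \x lebesgue_rV R n)%E
  (@cons_rV R n @^-1` [set t : 'rV[R]_n.+1 | t 0 i = c])) => //.
have [j ij|j ij] := split_ordP (i : 'I_(1 + n)).
  rewrite (_ : _ @^-1` _ = [set c] `*` setT).
    rewrite product_measure1E//.
    by rewrite [X in (X * _)%E](lebesgue_measure_set1 c) mul0e.
  apply/seteqP; split => -[a x] /=; rewrite cons_rVE ij (@row_mxEl _ 1 1 n) mxE ord1 eqxx mulr1n//.
  by case.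
rewrite (_ : _ @^-1` _ = setT `*` [set t : 'rV[R]_n | t 0 j = c]).
  rewrite product_measure1E//; last exact: mH.
  by rewrite [X in (_ * X)%E](IH j) mule0.
apply/seteqP; split => -[a x] /=; rewrite cons_rVE ij (@row_mxEr _ 1 1 n)//.
by case.
Qed.

Lemma indic_box_le_gaussian n (p q : 'rV[R]_n) : exists2 C : R, 0 <= C &
  forall t, \1_(box p q) t <= C * gaussR t.
Proof.
pose B := \sum_i (p 0 i ^+ 2 + q 0 i ^+ 2).
exists (expR (pi * B)); first exact: expR_ge0.
move=> t; rewrite indicE; case: (boolP (t \in box p q)) => [|_]; last first.
  by rewrite mulr_ge0 ?expR_ge0.
rewrite inE => tb; rewrite /= -expRD -[leLHS]expR0 ler_expR -mulrBr mulr_ge0 ?pi_ge0// subr_ge0.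
apply: ler_sum => i _; have /andP[] := tb i.
move: (p 0 i) (q 0 i) (t 0 i) => a b c ac cb.
by have [c0|c0] := leP 0 c; nra.
Qed.

Lemma cintegrable_indic_box n (p q : 'rV[R]_n) :
  cintegrable (lebesgue_rV R n) (fun t => (\1_(box p q) t)%:C%C).
Proof.
have [C C0 hC] := indic_box_le_gaussian p q.
have [mg goo] := cintegrable_gaussian (R := R) n.
apply: (@cintegrable_le _ _ _ _ _ (fun t => C%:E * (normc (gaussian t))%:E)%E).
- by apply: cmeas_real; apply/measurable_indicP; exact: measurable_box.
- by apply/measurable_EFinP; apply: measurable_funM => //; exact: measurable_normc.
- by move=> t; rewrite normc_real ger0_norm// lee_fin normc_gaussian hC.
rewrite ge0_integralZl//.
- by rewrite lte_mul_pinfty.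
- exact: measurable_enormc.
- by move=> x _; rewrite lee_fin normc_ge0.
Qed.

Lemma cmeas_indic d (T : measurableType d) (A : set T) : measurable A ->
  cmeas (fun t => (\1_A t : R)%:C%C).
Proof. by move=> mA; apply: cmeas_real; exact/measurable_indicP. Qed.

Lemma normc_indic T (A : set T) t : normc (\1_A t : R)%:C%C <= 1.
Proof. by rewrite normc_real indicE; case: (_ \in _); rewrite ?normr1 ?normr0 ?ler01. Qed.

(** The boundary of a box is null, and elsewhere the indicator is locally constant. *)
Lemma indic_box_cvg n (p q : 'rV[R]_n) : {ae lebesgue_rV R n, forall t : 'rV[R]_n, forall v,
  \forall k \near \oo, \1_(box p q) (t - (k.+1%:R : R)^-1 *: v) = \1_(box p q) t :> R}.
Proof.
have : {ae lebesgue_rV R n, forall t : 'rV[R]_n, forall i, t 0 i != p 0 i /\ t 0 i != q 0 i}.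
  apply: filter_forall => i.
  by apply: (filterS2 _ _ (hyperplane_null i (p 0 i)) (hyperplane_null i (q 0 i))) => t.
apply: filterS => t ht v.
have cv i : t 0 i - (k.+1%:R : R)^-1 * v 0 i @[k --> \oo] --> t 0 i.
  have h : (k.+1%:R : R)^-1 * v 0 i @[k --> \oo] --> 0 * v 0 i.
    exact: (cvgM cvg_harmonic (cvg_cst (v 0 i))).
  rewrite mul0r in h; have := cvgB (cvg_cst (t 0 i)) h; rewrite subr0; exact.
have ev i : \forall k \near \oo,
    (p 0 i < t 0 i - (k.+1%:R : R)^-1 * v 0 i <= q 0 i) = (p 0 i < t 0 i <= q 0 i).
  have [tp tq] := ht i.
  have e1 : \forall k \near \oo, (p 0 i < t 0 i - (k.+1%:R : R)^-1 * v 0 i) = (p 0 i < t 0 i).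
    have [h|h|/eqP] := ltgtP (p 0 i) (t 0 i); last by rewrite eq_sym (negbTE tp).
      by apply: (filterS _ (cvgr_gt _ (cv i) _ h)) => k ->.
    by apply: (filterS _ (cvgr_lt _ (cv i) _ h)) => k hk; rewrite ltNge (ltW hk).
  have e2 : \forall k \near \oo, (t 0 i - (k.+1%:R : R)^-1 * v 0 i <= q 0 i) = (t 0 i <= q 0 i).
    have [h|h|/eqP] := ltgtP (t 0 i) (q 0 i); last by rewrite (negbTE tq).
      by apply: (filterS _ (cvgr_lt _ (cv i) _ h)) => k /ltW ->.
    by apply: (filterS _ (cvgr_gt _ (cv i) _ h)) => k hk; rewrite leNgt hk.
  by apply: filterS2 e1 e2 => k -> ->.
have : \forall k \near \oo, forall i,
    (p 0 i < t 0 i - (k.+1%:R : R)^-1 * v 0 i <= q 0 i) = (p 0 i < t 0 i <= q 0 i).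
  exact: filter_forall.
apply: filterS => k hk; rewrite !indicE; congr ((_ : bool)%:R).
apply/idP/idP; rewrite !inE => h i; move: (h i) (hk i); rewrite !mxE.
  by move=> -> <-.
by move=> -> ->.
Qed.

End boxes.

(** * Fourier inversion *)

Section product_integrability.
Context d1 d2 (T1 : measurableType d1) (T2 : measurableType d2) {R : realType}.
Variable m1 : {sigma_finite_measure set T1 -> \bar R}.
Variable m2 : {sigma_finite_measure set T2 -> \bar R}.

Lemma norm1_tensor (f : T1 -> R[i]) (g : T2 -> R[i]) : cmeas f -> cmeas g ->
  norm1 (m1 \x m2)%E (fun z => f z.1 * g z.2) = (norm1 m1 f * norm1 m2 g)%E.
Proof.
move=> mf mg; rewrite norm1_prod; last by measurability.
transitivity (\int[m1]_x ((normc (f x))%:E * norm1 m2 g))%E.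
  by apply: eq_integral => x _; exact: (norm1Z m2 (f x) mg).
rewrite ge0_integralZr//.
- exact: measurable_enormc.
- by move=> x _; rewrite lee_fin normc_ge0.
- exact: norm1_ge0.
Qed.

Lemma cintegrable_tensor (f : T1 -> R[i]) (g : T2 -> R[i]) :
  cintegrable m1 f -> cintegrable m2 g ->
  cintegrable (m1 \x m2)%E (fun z => f z.1 * g z.2).
Proof.
move=> [mf foo] [mg goo]; split; first by measurability.
by rewrite norm1_tensor// lte_mul_pinfty ?norm1_ge0// ge0_fin_numE// norm1_ge0.
Qed.

Lemma cint_tensor (f : T1 -> R[i]) (g : T2 -> R[i]) :
  cintegrable m1 f -> cintegrable m2 g ->
  cint (m1 \x m2)%E (fun z => f z.1 * g z.2) = cint m1 f * cint m2 g.
Proof.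
move=> If Ig; rewrite cint_prod; last exact: cintegrable_tensor.
rewrite mulrC -cintZ//; apply: eq_cint => x /=.
by rewrite cintZ// mulrC.
Qed.

Lemma ae_fst (P : T1 -> Prop) : {ae m1, forall x, P x} ->
  {ae (m1 \x m2)%E, forall z, P z.1}.
Proof.
move=> [A [mA A0 PA]]; exists (A `*` setT); split.
- exact: measurableX.
- by rewrite product_measure1E// [X in (X * _)%E]A0 mul0e.
- by move=> z /= h; split => //; exact: PA.
Qed.

End product_integrability.

Lemma integrable_normc d (T : measurableType d) (R : realType)
    (mu : {measure set T -> \bar R}) (k : R) (f : T -> R[i]) : cintegrable mu f ->
  mu.-integrable setT (fun x => k%:E * (normc (f x))%:E)%E.
Proof.
move=> [mf foo]; apply: integrableZl => //; apply/integrableP; split.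
  exact: measurable_enormc.
by under eq_integral do rewrite gee0_abs ?lee_fin ?normc_ge0//.
Qed.

Lemma normc_cvg0_eq0 (R : realType) (z : R[i]) (e : nat -> \bar R) :
  (forall k, (normc z)%:E <= e k)%E -> e k @[k --> \oo] --> 0%E -> z = 0.
Proof.
move=> ze e0; apply: eq0_normc; apply/eqP.
rewrite eq_le normc_ge0 andbT -lee_fin.
by apply: (cvge_ge _ e0); apply: nearW.
Qed.

Section fourier_inversion.
Context {R : realType} (n : nat).
Notation leb := (lebesgue_rV R n).
Variable F : 'rV[R]_n -> R[i].
Hypothesis intF : cintegrable leb F.

Definition fourier (w : 'rV[R]_n) := cint leb (fun t => F t * expi (- (2 * pi * dotv t w))).

Lemma cmeas_fourier : cmeas fourier.
Proof.
have mF := intF.1; apply: (@cmeas_cint2 _ _ _ _ _ leb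
  (fun z : 'rV[R]_n * 'rV[R]_n => F z.2 * expi (- (2 * pi * dotv z.2 z.1)))).
by measurability.
Qed.

Hypothesis intFh : cintegrable leb fourier.

Let scaled_gaussian (a : R) : 0 < a -> cintegrable leb (fun w => gaussian (a *: w)).
Proof.
move=> a0; rewrite (_ : (fun _ => _) = (fun w => gaussian (a *: w + 0))).
  by apply: cintegrable_affine (cintegrable_gaussian n); rewrite gt_eqF.
by apply/funext => w; rewrite addr0.
Qed.

(** Multiplying the Fourier transform by a wide Gaussian amounts to averaging F
    over a narrow one, because the Gaussian is its own Fourier transform. *)
Lemma fourier_regularized (a : R) s : 0 < a ->
  cint leb (fun t => F t * ((a ^+ n)%:C%C * gaussian (a *: (t - s)))) =
  cint leb (fun w => fourier w * (gaussian (a^-1 *: w) * expi (2 * pi * dotv s w))).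
Proof.
move=> a0; have ai0 : 0 < a^-1 by rewrite invr_gt0.
have mF := intF.1.
pose G (z : 'rV[R]_n * 'rV[R]_n) := gaussian (a^-1 *: z.1) * F z.2 *
  expi (2 * pi * dotv (s - z.2) z.1).
have IG : cintegrable (leb \x leb)%E G.
  apply: cintegrable_expiM; last by measurability.
  exact: (cintegrable_tensor (scaled_gaussian ai0) intF).
have IFe w : cintegrable leb (fun t => F t * expi (- (2 * pi * dotv t w))).
  by apply: cintegrable_expiM => //; measurability.
transitivity (cint leb (fun w => cint leb (fun t => G (w, t)))); last first.
  apply: eq_cint => w; rewrite /fourier mulrC -cintZ//; apply: eq_cint => t.
  rewrite /G/= mulrACA -!mulrA; congr (_ * (_ * _)).
  rewrite -expiD; congr expi; dotv_expand; ring.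
rewrite cint_swap//; apply: eq_cint => t.
have Ig : cintegrable leb (fun w => gaussian (a^-1 *: w) * expi (2 * pi * dotv w (s - t))).
  by apply: cintegrable_expiM; [exact: scaled_gaussian|measurability].
transitivity (cint leb (fun w => F t * (gaussian (a^-1 *: w) * expi (2 * pi * dotv w (s - t))))).
  rewrite cintZ//; congr (_ * _).
  have := fourier_gaussian_affine 0 (s - t) ai0; rewrite dotv0l mulr0 expi0 mul1r invrK.
  under eq_cint do rewrite subr0.
  move=> ->; congr (_ * _).
    by rewrite exprVn invrK.
  by rewrite -gaussianN -scalerN opprB.
by apply: eq_cint => w; rewrite /G/= (dotvC w) mulrCA mulrA.
Qed.

Let inverse (t : 'rV[R]_n) := cint leb (fun w => fourier w * expi (2 * pi * dotv t w)).

Let cmeas_inverse : cmeas inverse.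
Proof.
have mFh := cmeas_fourier; apply: (@cmeas_cint2 _ _ _ _ _ leb
  (fun z : 'rV[R]_n * 'rV[R]_n => fourier z.2 * expi (2 * pi * dotv z.1 z.2))).
by measurability.
Qed.

Let cint_gaussian1 : cint leb (@gaussian R n) = 1.
Proof.
have := fourier_gaussian (0 : 'rV[R]_n); under eq_cint do rewrite dotvC dotv0l mulr0 expi0 mulr1.
by move=> ->; rewrite gaussianE /gaussR dotv0l mulr0 oppr0 expR0.
Qed.

Let a_ (k : nat) : R := k.+1%:R.

Section on_a_box.
Variables p q : 'rV[R]_n.
Let ind t : R[i] := (\1_(box p q) t : R)%:C%C.

Let mind : cmeas ind. Proof. by apply: cmeas_indic; exact: measurable_box. Qed.

Let P k (z : 'rV[R]_n * 'rV[R]_n) := F z.1 * gaussian z.2 * ind (z.1 - (a_ k)^-1 *: z.2).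
Let P0 (z : 'rV[R]_n * 'rV[R]_n) := F z.1 * gaussian z.2 * ind z.1.
Let Q k (z : 'rV[R]_n * 'rV[R]_n) := ind z.1 * fourier z.2 *
  expi (2 * pi * dotv z.1 z.2) * gaussian ((a_ k)^-1 *: z.2).
Let Q0 (z : 'rV[R]_n * 'rV[R]_n) := ind z.1 * fourier z.2 * expi (2 * pi * dotv z.1 z.2).

Let intFg : cintegrable (leb \x leb)%E (fun z => F z.1 * gaussian z.2).
Proof. exact: (cintegrable_tensor intF (cintegrable_gaussian n)). Qed.

Let intP k : cintegrable (leb \x leb)%E (P k).
Proof.
by apply: (cintegrableM_bounded intFg) => [|z]; [measurability|exact: normc_indic].
Qed.

Let intP0 : cintegrable (leb \x leb)%E P0.
Proof.
by apply: (cintegrableM_bounded intFg) => [|z]; [measurability|exact: normc_indic].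
Qed.

Let intQ0 : cintegrable (leb \x leb)%E Q0.
Proof.
apply: cintegrable_expiM; last by measurability.
exact: (cintegrable_tensor (cintegrable_indic_box p q) intFh).
Qed.

Let intQ k : cintegrable (leb \x leb)%E (Q k).
Proof.
by apply: (cintegrableM_bounded intQ0) => [|z]; [measurability|exact: normc_gaussian_le1].
Qed.

Let cintPQ k : cint (leb \x leb)%E (P k) = cint (leb \x leb)%E (Q k).
Proof.
have mF := intF.1; have a0 : 0 < a_ k by rewrite ltr0n.
have ane0 : a_ k != 0 by rewrite gt_eqF.
pose S (z : 'rV[R]_n * 'rV[R]_n) := ind z.1 * (F z.2 *
  ((a_ k ^+ n)%:C%C * gaussian (a_ k *: (z.2 - z.1)))).
have Ig t : cintegrable leb (fun v => gaussian v * ind (t - (a_ k)^-1 *: v)).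
  apply: (cintegrableM_bounded (cintegrable_gaussian n)) => [|z]; last exact: normc_indic.
  by measurability.
have inner t : cint leb (fun s => S (s, t)) = cint leb (fun v => P k (t, v)).
  transitivity (F t * cint leb (fun v => gaussian v * ind (t - (a_ k)^-1 *: v))); last first.
    by rewrite -cintZ//; apply: eq_cint => v; rewrite /P/= mulrA.
  have Na : - a_ k != 0 by rewrite oppr_eq0.
  pose y s := - a_ k *: s + a_ k *: t.
  have Ig2 : cintegrable leb (fun s => gaussian (y s) * ind (t - (a_ k)^-1 *: y s)).
    exact: (cintegrable_affine (a_ k *: t) Na (Ig t)).
  have -> : cint leb (fun v => gaussian v * ind (t - (a_ k)^-1 *: v)) =
      (a_ k ^+ n)%:C%C * cint leb (fun s => gaussian (y s) * ind (t - (a_ k)^-1 *: y s)).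
    rewrite [X in _ = _ * X](cint_affine (a_ k *: t) Na (Ig t)) normrN (gtr0_norm a0).
    move: (cint leb _) => X.
    by rewrite mulrA -real_complexM mulfV ?expf_neq0// mul1r.
  rewrite -cintZ// -cintZ; last exact: cintegrableZ.
  apply: eq_cint => s; rewrite /S/= /y.
  have -> : - a_ k *: s + a_ k *: t = a_ k *: (t - s) by rewrite scaleNr scalerBr addrC.
  rewrite scalerA mulVf// scale1r subKr.
  by rewrite mulrCA; congr (_ * _); rewrite mulrC mulrA.
have an0 : 0 <= a_ k ^+ n by rewrite exprn_ge0// ltW.
have bound (w : 'rV[R]_n) : normc ((a_ k ^+ n)%:C%C * gaussian w) <= a_ k ^+ n.
  by rewrite normcM normc_real ger0_norm// ler_piMr// normc_gaussian_le1.
have IS : cintegrable (leb \x leb)%E S.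
  rewrite (_ : S = fun z => (ind z.1 * F z.2) * ((a_ k ^+ n)%:C%C * gaussian (a_ k *: (z.2 - z.1)))).
    apply: (cintegrableM_bounded (cintegrable_tensor (cintegrable_indic_box p q) intF)) => [|z].
      by measurability.
    exact: bound.
  by apply/funext => z; rewrite /S mulrA.
rewrite (cint_prod (intP k)) (cint_prod (intQ k)).
transitivity (cint leb (fun t => cint leb (fun s => S (s, t)))).
  by apply: eq_cint => t; rewrite inner.
rewrite -(cint_swap IS); apply: eq_cint => s.
transitivity (ind s * cint leb (fun t => F t * ((a_ k ^+ n)%:C%C * gaussian (a_ k *: (t - s))))).
  rewrite -cintZ//.
  by apply: (cintegrableM_bounded intF) => [|t]; [measurability|exact: bound].
rewrite fourier_regularized// -cintZ.
  apply: eq_cint => w; rewrite /Q/=.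
  by rewrite -!mulrA (mulrC (expi _)).
apply: (cintegrableM_bounded intFh) => [|t]; first by measurability.
by rewrite normcM normc_expi mulr1; exact: normc_gaussian_le1.
Qed.

Let a_inv_cvg : ((a_ k)^-1 @[k --> \oo] --> (0 : R)).
Proof. exact: cvg_harmonic. Qed.

Let cvgP : norm1 (leb \x leb)%E (fun z => P k z - P0 z) @[k --> \oo] --> 0%E.
Proof.
apply: (@dominated_cvg_norm1 _ _ _ _ _ _ (fun z => 2%:E * (normc (F z.1 * gaussian z.2))%:E)%E).
- by move=> k; case: (intP k).
- by case: intP0.
- have := ae_fst leb (indic_box_cvg p q); apply: filterS => z hz.
  apply: cvg_near_cst; apply: filterS (hz z.2) => k hk.
  by rewrite /P /P0 /ind hk subrr normc0.
- exact: integrable_normc.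
- move=> k z; rewrite -EFinM lee_fin /P /P0 -mulrBr [leLHS]normcM [leLHS]mulrC ler_wpM2r ?normc_ge0//.
  rewrite (le_trans (le_normcD _ _))// normcN.
  by rewrite (_ : 2 = 1 + 1)// lerD// normc_indic.
Qed.

Let cvgQ : norm1 (leb \x leb)%E (fun z => Q k z - Q0 z) @[k --> \oo] --> 0%E.
Proof.
apply: (@dominated_cvg_norm1 _ _ _ _ _ _ (fun z => 2%:E * (normc (Q0 z))%:E)%E).
- by move=> k; case: (intQ k).
- by case: intQ0.
- apply: aeW => z.
  have h0 : - (pi * ((a_ k)^-1 * ((a_ k)^-1 * dotv z.2 z.2))) @[k --> \oo] --> (0 : R).
    have := cvgN (cvgM (cvg_cst pi) (cvgM a_inv_cvg (cvgM a_inv_cvg (cvg_cst (dotv z.2 z.2))))).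
    by rewrite !mul0r mulr0 oppr0; exact.
  have h : gaussR ((a_ k)^-1 *: z.2) @[k --> \oo] --> (1 : R).
    have h1 := cvg_comp _ _ h0 (@continuous_expR R 0); rewrite expR0 in h1.
    suff -> : (fun k => gaussR ((a_ k)^-1 *: z.2)) =
      (fun k => expR (- (pi * ((a_ k)^-1 * ((a_ k)^-1 * dotv z.2 z.2))))) by exact: h1.
    by apply/funext => k; rewrite /gaussR dotvZl dotvZr.
  have h2 := cvg_norm (cvgB (cvgM (cvg_cst (normc (Q0 z))) h) (cvg_cst (normc (Q0 z)))).
  rewrite mulr1 subrr normr0 in h2.
  suff -> : (fun k => normc (Q k z - Q0 z)) = (fun k =>
    `|normc (Q0 z) * gaussR ((a_ k)^-1 *: z.2) - normc (Q0 z)|) by exact: h2.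
  apply/funext => k; rewrite /Q -/(Q0 z) gaussianE -{2}(mulr1 (Q0 z)) -mulrBr normcM.
  rewrite -{3}(mulr1 (normc (Q0 z))) -mulrBr normrM ger0_norm ?normc_ge0//; congr (_ * _).
  by rewrite -[RHS]normc_real; congr normc; apply: eq_ReIm; rewrite ?ReD ?ImD ?ReN ?ImN/= ?subr0.
- exact: integrable_normc.
- move=> k z; rewrite -EFinM lee_fin /Q -/(Q0 z) -{2}(mulr1 (Q0 z)) -mulrBr [leLHS]normcM.
  rewrite [leLHS]mulrC ler_wpM2r ?normc_ge0// (le_trans (le_normcD _ _))// normcN.
  rewrite (_ : 2 = 1 + 1)// lerD ?normc_gaussian_le1// (normc_real 1) normr1//.
Qed.

Let int_indF : cintegrable leb (fun t => ind t * F t).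
Proof.
under eq_fun do rewrite mulrC.
by apply: (cintegrableM_bounded intF) => [//|z]; exact: normc_indic.
Qed.

Let int_indH : cintegrable leb (fun t => ind t * inverse t).
Proof.
have := cintegrable_cint2 intQ0; congr cintegrable; apply/funext => t.
rewrite /inverse -cintZ.
  by apply: eq_cint => w; rewrite /Q0/= mulrA.
by apply: cintegrable_expiM => //; measurability.
Qed.

(** Integrating the regularized identity of the previous lemma over a box moves the
    regularization from F to the indicator of the box; both sides then converge by
    dominated convergence, with limits the integrals of F and of its inverse
    transform over the box. No continuity of F enters. *)
Lemma fourier_inversion_on_box :
  cintegrable leb (fun t => ind t * (F t - inverse t)) /\
  cint leb (fun t => ind t * (F t - inverse t)) = 0.
Proof.
under eq_fun do rewrite mulrBr; split; first exact: cintegrableB.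
rewrite cintB//.
have -> : cint leb (fun t => ind t * F t) = cint (leb \x leb)%E P0.
  transitivity (cint leb (fun t => F t * ind t) * cint leb (@gaussian R n)).
    by rewrite cint_gaussian1 mulr1; apply: eq_cint => t; rewrite mulrC.
  rewrite -cint_tensor; [|by under eq_fun do rewrite mulrC|exact: cintegrable_gaussian].
  by apply: eq_cint => z; rewrite /P0 mulrAC.
have -> : cint leb (fun t => ind t * inverse t) = cint (leb \x leb)%E Q0.
  rewrite (cint_prod intQ0); apply: eq_cint => t; rewrite /inverse -cintZ.
    by apply: eq_cint => w; rewrite /Q0/= mulrA.
  by apply: cintegrable_expiM => //; measurability.
apply: (@normc_cvg0_eq0 _ _ (fun k => (norm1 (leb \x leb) (fun z => P k z - P0 z)%R
  + norm1 (leb \x leb) (fun z => Q k z - Q0 z)%R)%E)); last first.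
  by rewrite -[X in _ --> X]adde0; apply: cvgeD => //.
move=> k.
have -> : cint (leb \x leb)%E P0 - cint (leb \x leb)%E Q0 =
    - (cint (leb \x leb)%E (fun z => P k z - P0 z)) +
    cint (leb \x leb)%E (fun z => Q k z - Q0 z).
  rewrite (cintB (intP k) intP0) (cintB (intQ k) intQ0) cintPQ.
  by rewrite opprB addrA subrK.
apply: (@le_trans _ _ (normc (cint (leb \x leb)%E (fun z => P k z - P0 z)) +
  normc (cint (leb \x leb)%E (fun z => Q k z - Q0 z)))%:E).
  by rewrite lee_fin (le_trans (le_normcD _ _))// normcN.
have [mP _] := intP k; have [mP0 _] := intP0; have [mQ _] := intQ k; have [mQ0 _] := intQ0.
by rewrite EFinD; apply: leeD; apply: le_normc_cint; exact: cmeasB.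
Qed.

End on_a_box.

Theorem fourier_inversion : {ae leb, forall t, F t = inverse t}.
Proof.
have mF := intF.1.
have : {ae leb, forall t, F t - inverse t = 0}.
  apply: boxes_ae0; first exact: cmeasB.
    by move=> p q; case: (fourier_inversion_on_box p q).
  by move=> p q; case: (fourier_inversion_on_box p q).
by apply: filterS => t; exact: subr0_eq.
Qed.

End fourier_inversion.

(** * The Feichtinger algebra *)

Section feichtinger_algebra.
Context {R : realType}.

Lemma Lp1_norm1 n (f : 'rV[R]_n -> R[i]) : Lp_norm 1%E f = norm1 (lebesgue_rV R n) f.
Proof.
rewrite /Lp_norm Lnorm1; apply: eq_integral => x _ /=.
by rewrite ger0_norm ?normc_ge0.
Qed.

Lemma Lp2_ltyP n (f : 'rV[R]_n -> R[i]) : (Lp_norm 2%:E f < +oo)%E <->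
  (\int[lebesgue_rV R n]_x (normc (f x) ^+ 2)%:E < +oo)%E.
Proof.
rewrite /Lp_norm unlock.
have -> : (\int[lebesgue_rV R n]_x `|(EFin \o (fun x => normc (f x))) x| `^ 2 =
    \int[lebesgue_rV R n]_x (normc (f x) ^+ 2)%:E)%E.
  apply: eq_integral => x _ /=.
  by rewrite ger0_norm ?normc_ge0// powR_mulrn// normc_ge0.
split; last exact: poweR_lty.
by apply: lty_poweRy; rewrite invr_neq0.
Qed.

Notation V f := (stft (@gaussian R _) f).

Lemma cmeas_stft_param d (T : measurableType d) n (k : T * 'rV[R]_n -> R[i]) :
  cmeas k -> cmeas (fun z : T * 'rV[R]_(n + n) => V (fun t => k (z.1, t)) z.2).
Proof.
move=> mk; apply: (@cmeas_cint2 _ _ _ _ _ (lebesgue_rV R n)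
  (fun zt : (T * 'rV[R]_(n + n)) * 'rV[R]_n => k (zt.1.1, zt.2) *
    conjc (gaussian (zt.2 - lsubmx zt.1.2)) *
    expi (- (2 * pi * dotv zt.2 (rsubmx zt.1.2))))).
by measurability.
Qed.

Lemma cmeas_stft n (f : 'rV[R]_n -> R[i]) : cmeas f -> cmeas (V f).
Proof.
move=> mf; apply: (@cmeas_cint2 _ _ _ _ _ (lebesgue_rV R n)
  (fun zt : 'rV[R]_(n + n) * 'rV[R]_n => f zt.2 *
    conjc (gaussian (zt.2 - lsubmx zt.1)) *
    expi (- (2 * pi * dotv zt.2 (rsubmx zt.1))))).
by measurability.
Qed.

Lemma S0P n (f : S0 R n) : nmem f <-> [/\ cmeas f,
  (\int[lebesgue_rV R n]_x (normc (f x) ^+ 2)%:E < +oo)%E &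
  (norm1 (lebesgue_rV R (n + n)) (V f) < +oo)%E].
Proof.
split.
  by move=> [[mf /Lp2_ltyP f2] [mVf]]; rewrite Lp1_norm1.
move=> [mf f2 f1]; split; first by split => //; exact/Lp2_ltyP.
by split; [exact: cmeas_stft|rewrite Lp1_norm1].
Qed.

Lemma S0_nnorm n (f : S0 R n) : nnorm f = norm1 (lebesgue_rV R (n + n)) (V f).
Proof. exact: Lp1_norm1. Qed.

Lemma S0_stft n (f : S0 R n) : nmem f -> cintegrable (lebesgue_rV R (n + n)) (V f).
Proof. by move=> /S0P[mf _ f1]; split => //; exact: cmeas_stft. Qed.

Lemma S0_cmeas n (f : S0 R n) : nmem f -> cmeas f.
Proof. by case/S0P. Qed.

Lemma nnorm_ge0 n (f : S0 R n) : (0 <= nnorm f)%E.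
Proof. by rewrite S0_nnorm norm1_ge0. Qed.

Lemma cintegrable_shift_gaussian n (x : 'rV[R]_n) :
  cintegrable (lebesgue_rV R n) (fun t => gaussian (t - x)).
Proof.
split; first by measurability.
by rewrite norm1_shift ?norm1_gaussian ?ltry//; measurability.
Qed.

(** Since |f g| <= |f|^2 + |g| when |g| <= 1. This makes the short-time Fourier
    transform an absolutely convergent integral on L2. *)
Lemma S0_cintegrableM n (f : S0 R n) (g : 'rV[R]_n -> R[i]) : nmem f ->
  cintegrable (lebesgue_rV R n) g -> (forall t, normc (g t) <= 1) ->
  cintegrable (lebesgue_rV R n) (fun t => f t * g t).
Proof.
move=> /S0P[mf f2 _] [mg goo] g1.
have mf2 : measurable_fun setT (fun t => (normc (f t) ^+ 2)%:E).
  by apply/measurable_EFinP; apply: measurable_funX; exact: measurable_normc.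
apply: (@cintegrable_le _ _ _ _ _ (fun t => (normc (f t) ^+ 2)%:E + (normc (g t))%:E)%E).
- by measurability.
- by apply: emeasurable_funD => //; exact: measurable_enormc.
- move=> t; rewrite -EFinD lee_fin normcM.
  have := g1 t; have := normc_ge0 (g t); have := normc_ge0 (f t).
  move: (normc (f t)) (normc (g t)) => a b a0 b0 b1.
  have h : b * b <= b by rewrite -[leRHS]mulr1 ler_wpM2l.
  have := sqr_ge0 (a - b); have := sqr_ge0 a; rewrite !expr2; nra.
- rewrite ge0_integralD//.
  + by rewrite lte_add_pinfty.
  + by move=> x _; rewrite lee_fin sqr_ge0.
  + by move=> x _; rewrite lee_fin normc_ge0.
  + exact: measurable_enormc.
Qed.

Lemma S0_windowed n (f : S0 R n) x : nmem f ->
  cintegrable (lebesgue_rV R n) (fun t => f t * gaussian (t - x)).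
Proof.
move=> f0; apply: S0_cintegrableM => //; first exact: cintegrable_shift_gaussian.
by move=> t; exact: normc_gaussian_le1.
Qed.

Lemma stft_fourier n (f : 'rV[R]_n -> R[i]) x w :
  V f (row_mx x w) = fourier (fun t => f t * gaussian (t - x)) w.
Proof. by apply: eq_cint => t; rewrite row_mxKl row_mxKr conjc_gaussian. Qed.

(** Inversion of the short-time Fourier transform: for almost every x the
    windowed function f(t) g(t - x) is recovered from its Fourier transform
    V f(x, -), and these identities are averaged against gam(t - x). The
    reconstruction window gam is free, which is used below to choose windows
    that the Wigner transform maps to Gaussians. *)
Theorem stft_inversion n (f : S0 R n) (gam : 'rV[R]_n -> R[i]) : nmem f -> cmeas gam ->
  (forall t, normc (gam t) <= 1) ->
  {ae lebesgue_rV R n, forall t, f t * cint (lebesgue_rV R n) (fun x => gaussian x * gam x) =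
    cint (lebesgue_rV R (n + n)) (fun z => V f z *
      (expi (2 * pi * dotv t (rsubmx z)) * gam (t - lsubmx z)))}.
Proof.
move=> f0 mgam gam1; have mf := S0_cmeas f0; have IV := S0_stft f0.
have mV := cmeas_stft mf.
have inv : {ae lebesgue_rV R n, forall x, {ae lebesgue_rV R n, forall t,
    f t * gaussian (t - x) = cint (lebesgue_rV R n) (fun w =>
      V f (row_mx x w) * expi (2 * pi * dotv t w))}}.
  have := cintegrable_ae2 (cintegrable_row IV); apply: filterS => x Ix.
  have := @fourier_inversion _ _ _ (S0_windowed x f0).
  have Ifour : cintegrable (lebesgue_rV R n) (fourier (fun t => f t * gaussian (t - x))).
    have -> : fourier (fun t => f t * gaussian (t - x)) = (fun w => V f (row_mx x w)).
      by apply/funext => w; rewrite stft_fourier.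
    exact: Ix.
  move=> /(_ Ifour); apply: filterS => t ->; apply: eq_cint => w.
  by rewrite stft_fourier.
have mG : cmeas (fun z : 'rV[R]_n * 'rV[R]_n => cint (lebesgue_rV R n) (fun w =>
    V f (row_mx z.1 w) * expi (2 * pi * dotv z.2 w))).
  apply: (@cmeas_cint2 _ _ _ _ _ (lebesgue_rV R n)
    (fun zw : ('rV[R]_n * 'rV[R]_n) * 'rV[R]_n => V f (row_mx zw.1.1 zw.2) *
       expi (2 * pi * dotv zw.1.2 zw.2))).
  by measurability.
have mF : cmeas (fun z : 'rV[R]_n * 'rV[R]_n => f z.2 * gaussian (z.2 - z.1)).
  by measurability.
have := ae_prod_swap mF mG inv; apply: filterS => t {}inv.
have Igg : cintegrable (lebesgue_rV R n) (fun x => gaussian x * gam x).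
  by apply: (cintegrableM_bounded (cintegrable_gaussian n) mgam).
have N1 : (-1 : R) != 0 by rewrite oppr_eq0 oner_neq0.
have Itf : cintegrable (lebesgue_rV R (n + n)) (fun z => V f z *
    (expi (2 * pi * dotv t (rsubmx z)) * gam (t - lsubmx z))).
  apply: (cintegrableM_bounded IV); first by measurability.
  by move=> z; rewrite normcM normc_expi mul1r; exact: gam1.
rewrite (cint_row Itf).
have -> : cint (lebesgue_rV R n) (fun x => gaussian x * gam x) =
    cint (lebesgue_rV R n) (fun x => gaussian (t - x) * gam (t - x)).
  have := cint_affine t N1 Igg; rewrite normrN1 expr1n invr1 mul1r => <-.
  by apply: eq_cint => x; rewrite scaleN1r addrC.
rewrite -cintZ; last first.
  have := cintegrable_affine t N1 Igg; congr cintegrable; apply/funext => x.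
  by rewrite scaleN1r addrC.
have mcint : cmeas (fun x => cint (lebesgue_rV R n) (fun w =>
    V f (row_mx x w) * expi (2 * pi * dotv t w)) * gam (t - x)).
  apply: cmeasM; last by measurability.
  exact: (cmeas_pair1 (F := fun z : 'rV[R]_n * 'rV[R]_n => cint (lebesgue_rV R n) (fun w =>
    V f (row_mx z.1 w) * expi (2 * pi * dotv z.2 w))) t mG).
transitivity (cint (lebesgue_rV R n) (fun x => cint (lebesgue_rV R n) (fun w =>
    V f (row_mx x w) * expi (2 * pi * dotv t w)) * gam (t - x))).
  apply: ae_eq_cint => //; first by measurability.
  by apply: filterS inv => x e; rewrite mulrA e.
apply: ae_eq_cint => //.
  apply: (@cmeas_cint2 _ _ _ _ _ (lebesgue_rV R n) (fun xw : 'rV[R]_n * 'rV[R]_n =>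
    V f (row_mx xw.1 xw.2) * (expi (2 * pi * dotv t (rsubmx (row_mx xw.1 xw.2))) *
      gam (t - lsubmx (row_mx xw.1 xw.2))))).
  by measurability.
have := cintegrable_ae2 (cintegrable_row IV); apply: filterS => x Ix.
rewrite mulrC -cintZ; last by apply: cintegrable_expiM => //; measurability.
by apply: eq_cint => w; rewrite row_mxKl row_mxKr mulrC mulrA.
Qed.

(** Minkowski's integral inequality for the S0 norm. By Fubini, the short-time
    Fourier transform commutes with the superposition; the bound by F makes u bounded
    and integrable, hence square integrable. *)
Theorem S0_superposition d (Z : measurableType d)
    (nu : {sigma_finite_measure set Z -> \bar R}) n (F : Z -> R[i])
    (k : Z * 'rV[R]_n -> R[i]) (u : S0 R n) :
  cintegrable nu F -> cintegrable (nu \x lebesgue_rV R n)%E k ->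
  (forall z t, normc (k (z, t)) <= normc (F z)) ->
  (\int[nu]_z norm1 (lebesgue_rV R (n + n)) (V (fun t => k (z, t))) < +oo)%E ->
  (forall t, u t = cint nu (fun z => k (z, t))) ->
  nmem u /\ (nnorm u <= \int[nu]_z norm1 (lebesgue_rV R (n + n)) (V (fun t => k (z, t))))%E.
Proof.
move=> IF Ik kF Voo uE; have mk := Ik.1; have mF := IF.1.
have {uE} uE : u = (fun t => cint nu (fun z => k (z, t))) by apply/funext.
have mkf := cmeas_flip mk.
have mu : cmeas u.
  by rewrite uE; exact: (@cmeas_cint2 _ _ _ _ _ nu (fun tz => k (tz.2, tz.1)) mkf).
have Iu : cintegrable (lebesgue_rV R n) u.
  by rewrite uE; exact: (cintegrable_cint2 (cintegrable_flip Ik)).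
pose b := fine (norm1 nu F).
have ub t : normc (u t) <= b.
  rewrite -lee_fin -norm1_fin// uE.
  apply: le_trans (le_normc_cint nu (cmeas_pair1 t mk)) _.
  by apply: le_norm1; [exact: cmeas_pair1|exact: measurable_enormc|move=> z; rewrite lee_fin].
have mVk := cmeas_stft_param mk.
have VE w : V u w = cint nu (fun z => V (fun t => k (z, t)) w).
  pose h t : R[i] := conjc (gaussian (t - lsubmx w)) * expi (- (2 * pi * dotv t (rsubmx w))).
  have h1 t : normc (h t) <= 1.
    by rewrite normcM normc_expi mulr1 normc_conj normc_gaussian_le1.
  have mh : cmeas h by rewrite /h; measurability.
  have Ikh : cintegrable (nu \x lebesgue_rV R n)%E (fun zt => k zt * h zt.2).
    by apply: (cintegrableM_bounded Ik) => [|zt]; [measurability|exact: h1].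
  transitivity (cint (lebesgue_rV R n) (fun t => cint nu (fun z => k (z, t) * h t))).
    rewrite uE; have hE := cintegrable_ae2 (cintegrable_flip Ik).
    apply: ae_eq_cint.
    - have mu' : cmeas (fun t => cint nu (fun z => k (z, t))) by rewrite -uE.
      by measurability.
    - apply: (@cmeas_cint2 _ _ _ _ _ nu (fun tz => k (tz.2, tz.1) * h tz.1)).
      by measurability.
    - apply: filterS hE => t It; rewrite -mulrA -/(h t) mulrC -cintZ//.
      by apply: eq_cint => z; rewrite mulrC.
  rewrite -(cint_swap Ikh); apply: eq_cint => z; apply: eq_cint => t.
  by rewrite /h mulrA.
have key : (norm1 (lebesgue_rV R (n + n)) (V u) <=
    \int[nu]_z norm1 (lebesgue_rV R (n + n)) (V (fun t => k (z, t))))%E.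
  rewrite (norm1_swap nu (lebesgue_rV R (n + n)) mVk).
  apply: le_norm1; first exact: cmeas_stft.
    exact: (@measurable_norm1_2 _ _ _ _ _ nu _ (cmeas_flip mVk)).
  by move=> w; rewrite VE; apply: le_normc_cint; exact: cmeas_pair1 mVk.
split; last by rewrite S0_nnorm.
apply/S0P; split => //; last exact: le_lt_trans key _.
have b0 : 0 <= b by apply: le_trans (ub 0); exact: normc_ge0.
apply: (@le_lt_trans _ _ (\int[lebesgue_rV R n]_t (b%:E * (normc (u t))%:E))%E).
  apply: ge0_le_integral => //.
  - by move=> t _; rewrite lee_fin sqr_ge0.
  - by apply/measurable_EFinP; apply: measurable_funX; exact: measurable_normc.
  - by apply/measurable_EFinP; apply: measurable_funM => //; exact: measurable_normc.
  - by move=> t _; rewrite -EFinM lee_fin expr2 ler_wpM2r ?normc_ge0.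
rewrite ge0_integralZl//.
- by rewrite lte_mul_pinfty//; case: Iu.
- exact: measurable_enormc.
- by move=> t _; rewrite lee_fin normc_ge0.
Qed.

End feichtinger_algebra.

(** * Gaussian atoms *)

Section linear_structure.
Context {R : realType}.
Notation V f := (stft (@gaussian R _) f).

Lemma stft_lin n (c : R[i]) (f g : 'rV[R]_n -> R[i]) w :
  (forall x, cintegrable (lebesgue_rV R n) (fun t => f t * gaussian (t - x))) ->
  (forall x, cintegrable (lebesgue_rV R n) (fun t => g t * gaussian (t - x))) ->
  V (fun t => c * f t + g t) w = c * V f w + V g w.
Proof.
move=> If Ig.
pose k (h : 'rV[R]_n -> R[i]) t :=
  h t * conjc (gaussian (t - lsubmx w)) * expi (- (2 * pi * dotv t (rsubmx w))).
have I (h : 'rV[R]_n -> R[i]) :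
    (forall x, cintegrable (lebesgue_rV R n) (fun t => h t * gaussian (t - x))) ->
    cintegrable (lebesgue_rV R n) (k h).
  move=> Ih; rewrite /k; under eq_fun do rewrite conjc_gaussian.
  by apply: cintegrable_expiM => //; measurability.
have [{}If {}Ig] := (I f If, I g Ig).
change (cint (lebesgue_rV R n) (k (fun t => c * f t + g t)) =
  c * cint (lebesgue_rV R n) (k f) + cint (lebesgue_rV R n) (k g)).
rewrite -(cintZ c If) -(cintD (cintegrableZ c If) Ig).
by apply: eq_cint => t; rewrite /k !mulrDl !mulrA.
Qed.

Lemma S0_lin n (c : R[i]) (u v : S0 R n) : nmem u -> nmem v ->
  nmem (c *: u + v) /\ (nnorm (c *: u + v) <= (normc c)%:E * nnorm u + nnorm v)%E.
Proof.
move=> u0 v0; have [mu u2 u1] := (S0P _).1 u0; have [mv v2 v1] := (S0P _).1 v0.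
have muv : cmeas (c *: u + v : 'rV[R]_n -> R[i]).
  change (cmeas (fun t => c * u t + v t)).
  exact: (cmeasD (cmeasM (cmeas_cst _ c) mu) mv).
have le1 : (nnorm (c *: u + v) <= (normc c)%:E * nnorm u + nnorm v)%E.
  rewrite !S0_nnorm -norm1Z; last exact: cmeas_stft.
  rewrite (_ : V (c *: u + v) = fun w => c * V u w + V v w).
    by apply: norm1D; [apply: cmeasM; [exact: cmeas_cst|]|]; exact: cmeas_stft.
  by apply/funext => w; apply: stft_lin => x; exact: S0_windowed.
split; last exact: le1.
apply/S0P; split; [exact: muv| |]; last first.
  rewrite -S0_nnorm; apply: le_lt_trans le1 _; rewrite !S0_nnorm.
  apply: lte_add_pinfty; last exact: v1.
  by apply: lte_mul_pinfty; [rewrite lee_fin normc_ge0|by []|exact: u1].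
have m2 (f : 'rV[R]_n -> R[i]) : cmeas f -> measurable_fun setT (fun x => (normc (f x) ^+ 2)%:E).
  by move=> mf; apply/measurable_EFinP; apply: measurable_funX; exact: measurable_normc.
apply: (@le_lt_trans _ _ (\int[lebesgue_rV R n]_x
    ((2 * normc c ^+ 2)%:E * (normc (u x) ^+ 2)%:E + 2%:E * (normc (v x) ^+ 2)%:E))%E).
  apply: ge0_le_integral => //.
  - by move=> x _; rewrite lee_fin sqr_ge0.
  - exact: m2.
  - apply: emeasurable_funD; apply: emeasurable_funM => //; exact: m2.
  - move=> x _; rewrite -!EFinM -EFinD lee_fin.
    apply: (@le_trans _ _ ((normc c * normc (u x) + normc (v x)) ^+ 2)).
      rewrite ler_pXn2r ?nnegrE ?normc_ge0 ?addr_ge0 ?mulr_ge0 ?normc_ge0//.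
      by rewrite -normcM; exact: le_normcD.
    have := sqr_ge0 (normc c * normc (u x) - normc (v x)); nra.
have c2 : 0 <= 2 * normc c ^+ 2 by rewrite mulr_ge0// sqr_ge0.
rewrite ge0_integralD//.
- rewrite !ge0_integralZl//; try exact: m2; try by move=> x _; rewrite lee_fin sqr_ge0.
  by rewrite lte_add_pinfty// lte_mul_pinfty.
- by move=> x _; rewrite -EFinM lee_fin mulr_ge0// sqr_ge0.
- by apply: emeasurable_funM => //; exact: m2.
- by move=> x _; rewrite -EFinM lee_fin mulr_ge0// sqr_ge0.
- by apply: emeasurable_funM => //; exact: m2.
Qed.

Lemma S0_0 n : nmem (0 : S0 R n) /\ nnorm (0 : S0 R n) = 0%E.
Proof.
have V0 : V (0 : 'rV[R]_n -> R[i]) = fun=> 0.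
  apply/funext => w; rewrite /stft /cintegral -/(cint _ _).
  by under eq_cint do rewrite !mul0r; rewrite cint0.
have n0 k : norm1 (lebesgue_rV R k) (fun=> 0) = 0%E.
  by rewrite /norm1; under eq_integral do rewrite normc0; rewrite integral0.
split; last by rewrite S0_nnorm V0.
apply/S0P; split; first exact: cmeas_cst.
  by under eq_integral do rewrite normc0 expr0n/=; rewrite integral0.
by rewrite V0 n0.
Qed.

Lemma S0Z n (c : R[i]) (u : S0 R n) : nmem u ->
  nmem (c *: u) /\ (nnorm (c *: u) <= (normc c)%:E * nnorm u)%E.
Proof.
move=> u0; have [z0 n0] := S0_0 n; have := S0_lin c u0 z0.
by rewrite addr0 n0 adde0.
Qed.

Lemma S0B n (u v : S0 R n) : nmem u -> nmem v -> nmem (u - v).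
Proof.
move=> u0 v0; have [h _] := S0_lin (-1) v0 u0.
by rewrite addrC -scaleN1r.
Qed.

Lemma ae_eq_stft n (u v : 'rV[R]_n -> R[i]) : cmeas u -> cmeas v ->
  {ae lebesgue_rV R n, forall t, u t = v t} -> V u = V v.
Proof.
move=> mu mv uv; apply/funext => w; apply: ae_eq_cint; [measurability..|].
by apply: filterS uv => t ->.
Qed.

Lemma ae_eq_nnorm n (u v : S0 R n) : cmeas u -> cmeas v -> nequiv u v -> nnorm u = nnorm v.
Proof. by move=> mu mv uv; rewrite !S0_nnorm (ae_eq_stft mu mv uv). Qed.

Lemma ae_eq_S0 n (u v : S0 R n) : nmem u -> cmeas v -> nequiv u v -> nmem v.
Proof.
move=> u0 mv uv; have [mu u2 u1] := (S0P _).1 u0; apply/S0P; split; [exact: mv| |].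
  suff <- : (\int[lebesgue_rV R n]_x (normc (u x) ^+ 2)%:E =
    \int[lebesgue_rV R n]_x (normc (v x) ^+ 2)%:E)%E by exact: u2.
  apply: ae_eq_integral; [exact: measurableT| | |].
  - by apply/measurable_EFinP; apply: measurable_funX; exact: measurable_normc.
  - by apply/measurable_EFinP; apply: measurable_funX; exact: measurable_normc.
  - by apply: filterS uv => t ->.
rewrite -(ae_eq_stft mu mv uv); exact: u1.
Qed.

End linear_structure.

Section atoms.
Context {R : realType}.
Notation V f := (stft (@gaussian R _) f).

(** The time-frequency shift of the Gaussian by (x, w). *)
Definition atom n (x w t : 'rV[R]_n) : R[i] := gaussian (t - x) * expi (2 * pi * dotv t w).

Lemma normc_atom n (x w t : 'rV[R]_n) : normc (atom x w t) = gaussR (t - x).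
Proof. by rewrite normcM normc_expi mulr1 normc_gaussian. Qed.

Lemma normc_atom_le1 n (x w t : 'rV[R]_n) : normc (atom x w t) <= 1.
Proof. by rewrite normc_atom gaussR_le1. Qed.

Lemma cmeas_atom d (T : measurableType d) n (x w t : T -> 'rV[R]_n) :
  measurable_fun setT x -> measurable_fun setT w -> measurable_fun setT t ->
  cmeas (fun z => atom (x z) (w z) (t z)).
Proof. by move=> mx mw mt; rewrite /atom; measurability. Qed.

Lemma norm1_atom n (x w : 'rV[R]_n) : norm1 (lebesgue_rV R n) (atom x w) = 1%E.
Proof.
rewrite -(norm1_gaussian (R := R) n) -[RHS](norm1_shift x); last by measurability.
by apply: eq_integral => t _; rewrite normc_atom normc_gaussian.
Qed.

Lemma cintegrable_atom n (x w : 'rV[R]_n) : cintegrable (lebesgue_rV R n) (atom x w).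
Proof. by split; [exact: cmeas_atom|rewrite norm1_atom ltry]. Qed.

Lemma conjc_atom n (x w t : 'rV[R]_n) : conjc (atom x w t) = atom x (- w) t.
Proof. by rewrite /atom conjcM conjc_gaussian conjc_expi dotvNr mulrN. Qed.

Lemma atom_row m n (x w s : 'rV[R]_m) (y v t : 'rV[R]_n) :
  atom (row_mx x y) (row_mx w v) (row_mx s t) = atom x w s * atom y v t.
Proof.
rewrite /atom opp_row_mx add_row_mx gaussian_row dotv_row mulrDr expiD.
by rewrite mulrACA.
Qed.

Let r2 : R := Num.sqrt 2.

Let r2_gt0 : 0 < r2. Proof. by rewrite sqrtr_gt0. Qed.

Let r2_neq0 : r2 != 0. Proof. by rewrite gt_eqF. Qed.

Let r2_sqr : r2 * r2 = 2. Proof. by rewrite -expr2 sqr_sqrtr. Qed.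

(** Completing the square reduces the transform of an atom to that of a Gaussian. *)
Let gaussian_product n (x y t : 'rV[R]_n) : gaussian (t - x) * gaussian (t - y) =
  gaussian (r2^-1 *: (x - y)) * gaussian (r2 *: (t - 2^-1 *: (x + y))).
Proof.
rewrite !gaussianE -!real_complexM -!expRD; congr ((expR _)%:C%C).
rewrite -!opprD -!mulrDr; congr (- (_ * _)).
dotv_expand; rewrite (dotvC x t) (dotvC y t) (dotvC y x).
have -> : r2^-1 = r2 / 2 by apply: (mulfI r2_neq0); rewrite mulfV// mulrA r2_sqr divff.
have e : r2 * (r2 * dotv t t) = 2 * dotv t t by rewrite mulrA r2_sqr.
have q : r2 ^+ 2 = 2 by rewrite expr2.
by field: q.
Qed.

Lemma stft_atom n (x w x' w' : 'rV[R]_n) : V (atom x w) (row_mx x' w') =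
  (r2 ^- n)%:C%C * (gaussian (r2^-1 *: (x - x')) * gaussian (r2^-1 *: (w - w')) *
    expi (pi * dotv (x + x') (w - w'))).
Proof.
have Ig : cintegrable (lebesgue_rV R n) (fun t => gaussian (r2 *: (t - 2^-1 *: (x + x'))) *
    expi (2 * pi * dotv t (w - w'))).
  apply: cintegrable_expiM; last by measurability.
  have := cintegrable_affine (- (r2 *: (2^-1 *: (x + x')))) r2_neq0 (cintegrable_gaussian n).
  by under eq_fun do rewrite -scalerBr.
transitivity (gaussian (r2^-1 *: (x - x')) * cint (lebesgue_rV R n) (fun t =>
    gaussian (r2 *: (t - 2^-1 *: (x + x'))) * expi (2 * pi * dotv t (w - w')))).
  rewrite -cintZ//; apply: eq_cint => t; rewrite row_mxKl row_mxKr conjc_gaussian.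
  rewrite mulrA -gaussian_product /atom [X in X * _ = _]mulrAC
    -(mulrA (gaussian (t - x) * gaussian (t - x'))) -expiD; congr (_ * expi _).
  by dotv_expand; ring.
rewrite fourier_gaussian_affine// dotvZl; set m := dotv _ _; set c := (_)%:C%C.
rewrite (_ : 2 * pi * (2^-1 * m) = pi * m); last by field.
by rewrite mulrCA -mulrA; congr (_ * (_ * _)); rewrite mulrC.
Qed.

Let norm1_scaled n (a : R) (x : 'rV[R]_n) : 0 < a ->
  norm1 (lebesgue_rV R n) (fun x' => gaussian (a *: (x - x'))) = (a ^- n)%:E.
Proof.
move=> a0; have Na : - a != 0 by rewrite oppr_eq0 gt_eqF.
have := norm1_affine (a *: x) Na (cintegrable_gaussian (R := R) n).1.
rewrite normrN gtr0_norm// norm1_gaussian mule1 => <-.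
by congr norm1; apply/funext => x'; rewrite scaleNr scalerBr addrC.
Qed.

Definition atom_norm n : R := r2 ^+ n.

Lemma norm1_stft_atom n (x w : 'rV[R]_n) :
  norm1 (lebesgue_rV R (n + n)) (V (atom x w)) = (atom_norm n)%:E.
Proof.
have ri0 : 0 < r2^-1 by rewrite invr_gt0.
have sc : (r2^-1 : R) ^- n = r2 ^+ n by rewrite exprVn invrK.
rewrite norm1_row; last by apply: cmeas_stft; exact: (cintegrable_atom x w).1.
transitivity (\int[lebesgue_rV R n]_x' (normc (gaussian (r2^-1 *: (x - x'))))%:E)%E; last first.
  by rewrite /atom_norm -sc -(norm1_scaled x ri0).
apply: eq_integral => x' _.
transitivity (norm1 (lebesgue_rV R n) (fun w' =>
    (r2 ^- n)%:C%C * gaussian (r2^-1 *: (x - x')) * gaussian (r2^-1 *: (w - w')))).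
  apply: eq_integral => w' _; rewrite stft_atom; congr (_%:E).
  by rewrite [LHS]normcM [X in _ * X = _]normcM normc_expi mulr1 -[LHS]normcM mulrA.
rewrite norm1Z; last by measurability.
rewrite norm1_scaled// sc normcM normc_real ger0_norm ?invr_ge0 ?exprn_ge0 ?ltW//.
by rewrite -EFinM mulrAC mulVf ?mul1r// expf_neq0.
Qed.

(** All atoms have the same S0 norm, so integrable superpositions of atoms converge
    in S0. Every membership in S0 below is obtained in this way. *)
Theorem S0_atoms d (Z : measurableType d) (nu : {sigma_finite_measure set Z -> \bar R}) n
    (F : Z -> R[i]) (x w : Z -> 'rV[R]_n) (u : S0 R n) :
  cintegrable nu F -> measurable_fun setT x -> measurable_fun setT w ->
  (forall t, u t = cint nu (fun z => F z * atom (x z) (w z) t)) ->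
  nmem u /\ (nnorm u <= (atom_norm n)%:E * norm1 nu F)%E.
Proof.
move=> IF mx mw uE; have mF := IF.1.
pose k (zt : Z * 'rV[R]_n) := F zt.1 * atom (x zt.1) (w zt.1) zt.2.
have mk : cmeas k by apply: cmeasM; [measurability|apply: cmeas_atom; measurability].
have Ik : cintegrable (nu \x lebesgue_rV R n)%E k.
  split => //; rewrite norm1_prod//.
  under eq_integral => z _.
    rewrite (norm1Z _ (F z) (f := atom (x z) (w z))); last exact: (cintegrable_atom _ _).1.
    rewrite norm1_atom mule1; over.
  exact: IF.2.
have nV z : norm1 (lebesgue_rV R (n + n)) (V (fun t => k (z, t))) =
    ((atom_norm n)%:E * (normc (F z))%:E)%E.
  rewrite -(norm1_stft_atom (x z) (w z)) muleC -norm1Z; last first.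
    by apply: cmeas_stft; exact: (cintegrable_atom _ _).1.
  congr norm1; apply/funext => y; rewrite /stft /cintegral -!/(cint _ _) -cintZ.
    by apply: eq_cint => t; rewrite /k/= !mulrA.
  under eq_fun do rewrite conjc_gaussian.
  apply: cintegrable_expiM; last by measurability.
  apply: (cintegrableM_bounded (cintegrable_atom _ _)) => [|t]; first by measurability.
  exact: normc_gaussian_le1.
have An : 0 <= atom_norm n by rewrite exprn_ge0// ltW.
have VE : (\int[nu]_z norm1 (lebesgue_rV R (n + n)) (V (fun t => k (z, t))) =
    (atom_norm n)%:E * norm1 nu F)%E.
  under eq_integral do rewrite nV.
  rewrite ge0_integralZl//; first exact: measurable_enormc.
  by move=> z _; rewrite lee_fin normc_ge0.
have kF z t : normc (k (z, t)) <= normc (F z).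
  by rewrite normcM ler_piMr ?normc_ge0 ?normc_atom_le1.
have Voo : (\int[nu]_z norm1 (lebesgue_rV R (n + n)) (V (fun t => k (z, t))) < +oo)%E.
  by rewrite VE; apply: lte_mul_pinfty; [rewrite lee_fin|by []|exact: IF.2].
by have := S0_superposition IF Ik kF Voo uE; rewrite VE.
Qed.

(** The constant by which the inversion formula is divided is nonzero for every
    positive reconstruction window. *)
Lemma cint_gaussian_neq0 n (h : 'rV[R]_n -> R) : measurable_fun setT h ->
  (forall t, 0 < h t) -> (forall t, h t <= 1) ->
  cint (lebesgue_rV R n) (fun t => gaussian t * (h t)%:C%C) != 0.
Proof.
move=> mh h0 h1; pose f t : R[i] := gaussian t * (h t)%:C%C.
have If : cintegrable (lebesgue_rV R n) f.
  apply: (cintegrableM_bounded (cintegrable_gaussian n)) => [|t]; first exact: cmeas_real.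
  by rewrite normc_real gtr0_norm.
apply/eqP => e.
have : norm1 (lebesgue_rV R n) f = 0%E.
  have e0 : (\int[lebesgue_rV R n]_t (Re (f t))%:E = 0)%E.
    have e1 : \int[lebesgue_rV R n]_t Re (f t) = 0 by have := congr1 (@complex.Re R) e.
    have := congr1 EFin e1; rewrite /Rintegral fineK//.
    exact: integrable_fin_num (cintegrable_Re If).
  rewrite -[RHS]e0; apply: eq_integral => t _.
  rewrite normcM normc_gaussian normc_real gtr0_norm//; congr (_%:E).
  by rewrite /f gaussianE ReM/= mulr0 subr0.
move/(norm1_eq0P _ If.1) => f0.
have : norm1 (lebesgue_rV R n) (@gaussian R n) = 0%E.
  apply/norm1_eq0P; first exact: (cintegrable_gaussian n).1.
  apply: filterS f0 => t /eqP; rewrite mulf_eq0 => /orP[/eqP //|/eqP ht].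
  by have := h0 t; rewrite -(ReC (h t)) ht ltxx.
by rewrite norm1_gaussian => /eqP; rewrite onee_eq0.
Qed.

(** The normalization of the inversion formula whose two windows are Gaussian. *)
Definition dual_const n : R[i] :=
  (cint (lebesgue_rV R n) (fun t => gaussian t * gaussian t))^-1.

(** The inversion formula with the Gaussian itself as reconstruction window. Together
    with the bound on superpositions of atoms, it reduces statements about S0 to
    computations with atoms. *)
Theorem S0_atomic n (f : S0 R n) : nmem f -> {ae lebesgue_rV R n, forall t,
  f t = cint (lebesgue_rV R (n + n)) (fun z => dual_const n * V f z *
    atom (lsubmx z) (rsubmx z) t)}.
Proof.
move=> f0; have mg : cmeas (@gaussian R n) by exact: (cintegrable_gaussian n).1.
have := stft_inversion f0 mg (@normc_gaussian_le1 _ _); apply: filterS => t.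
have mgR : measurable_fun setT (@gaussR R n) by case: mg.
have c0 := cint_gaussian_neq0 mgR (@gaussR_gt0 R n) (@gaussR_le1 R n).
move=> /(congr1 ( *%R (dual_const n))); rewrite mulrCA mulVf// mulr1 => ->.
rewrite -cintZ.
  by apply: eq_cint => z; rewrite -[RHS]mulrA /atom (mulrC (expi _)).
apply: (cintegrableM_bounded (S0_stft f0)); first by measurability.
by move=> z; rewrite normcM normc_expi mul1r; exact: normc_gaussian_le1.
Qed.

Lemma S0_coef n (f : S0 R n) : nmem f ->
  cintegrable (lebesgue_rV R (n + n)) (fun z => dual_const n * V f z).
Proof. by move=> f0; apply: cintegrableZ; exact: S0_stft. Qed.

Lemma norm1_coef n (f : S0 R n) : nmem f ->
  norm1 (lebesgue_rV R (n + n)) (fun z => dual_const n * V f z) =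
  ((normc (dual_const n))%:E * nnorm f)%E.
Proof. by move=> f0; rewrite norm1Z ?S0_nnorm//; case: (S0_stft f0). Qed.

Lemma S0_L1 n (f : S0 R n) : nmem f -> cintegrable (lebesgue_rV R n) f /\
  (norm1 (lebesgue_rV R n) f <= (normc (dual_const n))%:E * nnorm f)%E.
Proof.
move=> f0; have mf := S0_cmeas f0; have Ic := S0_coef f0; have mV := (S0_stft f0).1.
pose k (zt : 'rV[R]_(n + n) * 'rV[R]_n) := dual_const n * V f zt.1 *
    atom (lsubmx zt.1) (rsubmx zt.1) zt.2.
have mk : cmeas k by apply: cmeasM; [measurability|apply: cmeas_atom; measurability].
have mk' := cmeas_flip mk.
have le1 : (norm1 (lebesgue_rV R n) f <= (normc (dual_const n))%:E * nnorm f)%E.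
  have mu : cmeas (fun t => cint (lebesgue_rV R (n + n)) (fun z => k (z, t))).
    exact: (@cmeas_cint2 _ _ _ _ _ (lebesgue_rV R (n + n)) (fun tz => k (tz.2, tz.1)) mk').
  rewrite (ae_eq_norm1 mf mu (S0_atomic f0)) -norm1_coef//.
  apply: (@le_trans _ _ (\int[lebesgue_rV R n]_t norm1 (lebesgue_rV R (n + n)) (fun z => k (z, t)))%E).
    apply: le_norm1 => //.
      exact: (@measurable_norm1_2 _ _ _ _ _ (lebesgue_rV R (n + n)) _ mk').
    by move=> t; apply: le_normc_cint; exact: cmeas_pair1 mk.
  rewrite -(norm1_swap (lebesgue_rV R (n + n)) (lebesgue_rV R n) mk).
  apply: ge0_le_integral => //.
  - by move=> z _; exact: norm1_ge0.
  - exact: (@measurable_norm1_2 _ _ _ _ _ (lebesgue_rV R n) _ mk).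
  - by apply: measurable_enormc; case: Ic.
  - move=> z _; have := norm1Z (lebesgue_rV R n) (dual_const n * V f z)
      (cintegrable_atom (lsubmx z) (rsubmx z)).1.
    by rewrite norm1_atom mule1 => <-.
split => //; split => //; apply: le_lt_trans le1 _.
rewrite lte_mul_pinfty ?lee_fin ?normc_ge0//.
by rewrite S0_nnorm; case/S0P: f0.
Qed.

End atoms.

(** * Tensor products and sections in S0 *)

Section operations.
Context {R : realType}.
Notation V f := (stft (@gaussian R _) f).

Lemma atom_tensor m n (p q : R[i]) (x w a : 'rV[R]_m) (y v b : 'rV[R]_n) :
  p * conjc q * atom (row_mx x y) (row_mx w (- v)) (row_mx a b) =
  (p * atom x w a) * conjc (q * atom y v b).
Proof. by rewrite atom_row conjcM conjc_atom mulrACA. Qed.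

(** Tensor products of atoms, the second one conjugated, are atoms in twice the
    dimension; superpositions of atoms therefore have tensor products that are again
    superpositions of atoms. *)
Theorem S0_tensor n : exists2 C : R, 0 <= C & forall g f : S0 R n, nmem g -> nmem f ->
  nmem (tensor_kernel g f : S0 R (n + n)) /\
  (nnorm (tensor_kernel g f : S0 R (n + n)) <= C%:E * (nnorm g * nnorm f))%E.
Proof.
pose kc : R := normc (dual_const (R := R) n).
exists (atom_norm (n + n) * (kc * kc)).
  by rewrite mulr_ge0 ?exprn_ge0 ?sqrtr_ge0// mulr_ge0 ?normc_ge0.
move=> g f g0 f0; pose L := lebesgue_rV R (n + n).
pose G z := dual_const n * V g z; pose F z := dual_const n * V f z.
have IG : cintegrable L G by exact: S0_coef.
have IF : cintegrable L F by exact: S0_coef.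
have IFc := cintegrable_conj IF.
pose P := 'rV[R]_((n + n) + (n + n)).
pose x (z : P) := row_mx (lsubmx (lsubmx z)) (lsubmx (rsubmx z)).
pose w (z : P) := row_mx (rsubmx (lsubmx z)) (- rsubmx (rsubmx z)).
pose LL := lebesgue_rV R ((n + n) + (n + n)).
pose u : S0 R (n + n) := fun t => cint LL (fun z : P =>
  G (lsubmx z) * conjc (F (rsubmx z)) * atom (x z) (w z) t).
have mGF : cmeas (fun z : P => G (lsubmx z) * conjc (F (rsubmx z))).
  by have [mG mF] := (IG.1, IF.1); measurability.
have nGF : norm1 LL (fun z : P => G (lsubmx z) * conjc (F (rsubmx z))) =
    (norm1 L G * norm1 L F)%E.
  rewrite (norm1_mp (row_mx_mp (n + n) (n + n)) mGF) -(norm1_conj L F).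
  rewrite -(norm1_tensor _ _ IG.1 IFc.1); congr norm1; apply/funext => z /=.
  by rewrite row_mxKl row_mxKr.
have IGF : cintegrable LL (fun z : P => G (lsubmx z) * conjc (F (rsubmx z))).
  split; first exact: mGF.
  rewrite nGF lte_mul_pinfty ?norm1_ge0//; last by case: IF.
  by rewrite ge0_fin_numE ?norm1_ge0//; case: IG.
have mx : measurable_fun setT x by rewrite /x; measurability.
have mw : measurable_fun setT w by rewrite /w; measurability.
have [|u0 un] := @S0_atoms R _ _ LL _ (fun z : P => G (lsubmx z) * conjc (F (rsubmx z))) x w u IGF mx mw.
  by move=> t; reflexivity.
have [mg mf] := (S0_cmeas g0, S0_cmeas f0).
have mt : cmeas (tensor_kernel g f) by rewrite /tensor_kernel; measurability.
have ut : nequiv u (tensor_kernel g f : S0 R (n + n)).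
  apply/(ae_row (S0_cmeas u0) mt).
  apply: filterS (S0_atomic g0) => a ga; apply: filterS (S0_atomic f0) => b fb.
  rewrite /tensor_kernel row_mxKl row_mxKr ga fb -cint_conj; last first.
    apply: (cintegrableM_bounded IF) => [|z]; last exact: normc_atom_le1.
    by apply: cmeas_atom; measurability.
  rewrite -cint_tensor; last 2 first.
  - apply: (cintegrableM_bounded IG) => [|z]; last exact: normc_atom_le1.
    by apply: cmeas_atom; measurability.
  - under eq_fun do rewrite conjcM; apply: (cintegrableM_bounded IFc) => [|z].
      by apply: cmeas_conj; apply: cmeas_atom; measurability.
    by rewrite normc_conj; exact: normc_atom_le1.
  rewrite /u (cint_mp (row_mx_mp (n + n) (n + n))); last first.
    by apply: cmeasM => //; apply: cmeas_atom => //; measurability.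
  apply: eq_cint => z; rewrite /comp /x /w; cbv beta; rewrite row_mxKl row_mxKr.
  exact: atom_tensor.
split; first exact: ae_eq_S0 u0 mt ut.
rewrite -(ae_eq_nnorm (S0_cmeas u0) mt ut); apply: le_trans un _.
rewrite nGF (norm1_coef g0) (norm1_coef f0).
rewrite -/kc EFinM; move: (atom_norm _) kc (nnorm g) (nnorm f) => A k a b.
by rewrite EFinM -(muleA A%:E) (muleACA k%:E a).
Qed.

(** A section of an atom of R^{m+n} is a bounded multiple of an atom of R^n, so the
    atomic representation of K restricts to almost every section. *)
Theorem S0_section m n (K : S0 R (m + n)) : nmem K ->
  {ae lebesgue_rV R m, forall x, nmem ((fun y => conjc (K (row_mx x y))) : S0 R n)}.
Proof.
pose phase := 'rV[R]_((m + n) + (m + n)).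
move=> K0; have mK := S0_cmeas K0; have Ic := S0_coef K0; have mV := (S0_stft K0).1.
pose L := lebesgue_rV R ((m + n) + (m + n)).
pose U t := cint L (fun z => dual_const (m + n) * V K z * atom (lsubmx z) (rsubmx z) t).
have mU : cmeas U.
  apply: (@cmeas_cint2 _ _ _ _ _ L (fun tz : 'rV[R]_(m + n) * phase =>
    dual_const (m + n) * V K tz.2 * atom (lsubmx tz.2) (rsubmx tz.2) tz.1)).
  by apply: cmeasM; [measurability|apply: cmeas_atom; measurability].
have := S0_atomic K0; move/(ae_row mK mU); apply: filterS => x hx.
pose F (z : phase) := conjc (dual_const (m + n) * V K z *
  atom (lsubmx (lsubmx z)) (lsubmx (rsubmx z)) x).
have IF : cintegrable L F.
  apply: cintegrable_conj; apply: (cintegrableM_bounded Ic) => [|z]; last exact: normc_atom_le1.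
  by apply: cmeas_atom; measurability.
pose a (z : phase) : 'rV[R]_n := rsubmx (lsubmx z).
pose b (z : phase) : 'rV[R]_n := - rsubmx (rsubmx z).
pose u : S0 R n := fun y => cint L (fun z => F z * atom (a z) (b z) y).
have ma : measurable_fun setT a by rewrite /a; measurability.
have mb : measurable_fun setT b by rewrite /b; measurability.
have [|u0 _] := @S0_atoms R _ _ L _ F a b u IF ma mb.
  by move=> t; reflexivity.
apply: (ae_eq_S0 u0); first by measurability.
apply: filterS hx => y ->; rewrite /u /U -cint_conj.
  apply: eq_cint => z; rewrite /F -[in RHS](hsubmxK (lsubmx z)) -[in RHS](hsubmxK (rsubmx z)).
  rewrite atom_row [RHS]conjcM [X in _ = _ * X]conjcM conjc_atom [in LHS]conjcM.
  by rewrite conjc_atom mulrA conjc_atom.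
apply: (cintegrableM_bounded Ic) => [|z]; last exact: normc_atom_le1.
by apply: cmeas_atom; measurability.
Qed.

End operations.

(** * The tau-Wigner transform of a kernel *)

Section measure_preserving_maps.
Context {R : realType}.

Lemma measure_preserving_comp d1 d2 d3 (T1 : measurableType d1) (T2 : measurableType d2)
    (T3 : measurableType d3) (m1 : {measure set T1 -> \bar R}) (m2 : {measure set T2 -> \bar R})
    (m3 : {measure set T3 -> \bar R}) (p : T1 -> T2) (q : T2 -> T3) :
  measure_preserving m1 m2 p -> measure_preserving m2 m3 q -> measure_preserving m1 m3 (q \o p).
Proof.
move=> [mp p1] [mq q1]; split; first exact: measurableT_comp mq mp.
move=> A mA; rewrite q1// p1// -[X in measurable X]setTI; exact: mq.
Qed.

Lemma measure_indic d (T : measurableType d) (m : {measure set T -> \bar R}) (A : set T) :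
  measurable A -> m A = (\int[m]_x (\1_A x : R)%:E)%E.
Proof. by move=> mA; rewrite integral_indic// setIT. Qed.

Lemma lebesgue_rV_reflect n (c : R) (b : 'rV[R]_n) (A : set 'rV[R]_n) : `|c| = 1 ->
  measurable A -> lebesgue_rV R n A = lebesgue_rV R n ((fun t => c *: t + b) @^-1` A).
Proof.
move=> c1 mA; have c0 : c != 0 by rewrite -normr_eq0 c1 oner_eq0.
have maff : measurable_fun setT (fun t : 'rV[R]_n => c *: t + b) by measurability.
have mA' : measurable ((fun t => c *: t + b) @^-1` A).
  by rewrite -[X in measurable X]setTI; exact: maff.
have := ge0_integral_affine b (f := fun t => (\1_A t)%:E) c0.
rewrite c1 expr1n invr1 mul1e => e.
rewrite measure_indic// -e.
- by rewrite [RHS]measure_indic.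
- by apply/measurable_EFinP; apply/measurable_indicP.
- by move=> t; rewrite lee_fin.
Qed.

(** Shears and fibrewise reflections preserve the product measure, because
    translations and reflections preserve the measure of every fibre. *)
Lemma fiberwise_mp d (T : measurableType d) (mu : {sigma_finite_measure set T -> \bar R}) n
    (c : R) (b : T -> 'rV[R]_n) : `|c| = 1 -> measurable_fun setT b ->
  measure_preserving (mu \x lebesgue_rV R n)%E (mu \x lebesgue_rV R n)%E
    (fun z => (z.1, c *: z.2 + b z.1)).
Proof.
move=> c1 mb; split; first by measurability.
move=> A mA; rewrite /product_measure1; apply: eq_integral => x _ /=.
rewrite (lebesgue_rV_reflect (b x) c1); last exact: measurable_xsection.
by congr (lebesgue_rV R n _); apply/seteqP; split => t; rewrite /= !xsectionE.
Qed.

Lemma swap_mp d1 d2 (T1 : measurableType d1) (T2 : measurableType d2)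
    (m1 : {sigma_finite_measure set T1 -> \bar R}) (m2 : {sigma_finite_measure set T2 -> \bar R}) :
  measure_preserving (m2 \x m1)%E (m1 \x m2)%E (fun z => (z.2, z.1)).
Proof.
have ms : measurable_fun setT (fun z : T2 * T1 => (z.2, z.1)) by exact: measurable_swap.
split; first exact: ms.
move=> A mA; pose A' := (fun z : T2 * T1 => (z.2, z.1)) @^-1` A.
have mA' : measurable A' by rewrite -[X in measurable X]setTI; exact: ms.
have mf : measurable_fun setT (fun z : T1 * T2 => (\1_A z : R)%:E).
  by apply/measurable_EFinP; apply/measurable_indicP.
have f0 z : (0 <= (\1_A z : R)%:E)%E by rewrite lee_fin.
transitivity (\int[m1]_x \int[m2]_y (\1_A (x, y) : R)%:E)%E.
  rewrite /product_measure1; apply: eq_integral => x _.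
  apply: etrans (measure_indic m2 (measurable_xsection x mA)) _.
  by apply: eq_integral => y _; rewrite !indicE mem_xsection.
rewrite (fubini_tonelli (fun z : T1 * T2 => (\1_A z : R)%:E) mf f0) /product_measure1; apply: eq_integral => y _.
apply: etrans (esym (measure_indic m1 (measurable_xsection y mA'))).
apply: eq_integral => x _; rewrite !indicE mem_xsection /A'; congr (_%:R%:E).
Qed.

(** With a = x + tau t, the second component is a - t: the substitution is a shear in
    the first variable followed by a fibrewise reflection in the second one. *)
Lemma wigner_mp d (tau : R) :
  measure_preserving (lebesgue_rV R d \x lebesgue_rV R d)%E (lebesgue_rV R (d + d))
    (fun z => row_mx (z.1 + tau *: z.2) (z.1 - (1 - tau) *: z.2)).
Proof.
have mb : measurable_fun setT (fun t : 'rV[R]_d => tau *: t) by measurability.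
have n1 : `|1 : R| = 1 by rewrite normr1.
have nN1 : `|-1 : R| = 1 by rewrite normrN1.
have sw := swap_mp (lebesgue_rV R d) (lebesgue_rV R d).
have s1 := fiberwise_mp (lebesgue_rV R d) n1 mb.
have s2 := @fiberwise_mp _ _ (lebesgue_rV R d) d (-1) id nN1 (@measurable_id _ _ _).
have := measure_preserving_comp (measure_preserving_comp (measure_preserving_comp
  (measure_preserving_comp sw s1) sw) s2) (row_mx_mp d d).
congr measure_preserving; apply/funext => -[x t] /=.
by congr row_mx; apply/rowP => i; rewrite !mxE; ring.
Qed.

End measure_preserving_maps.


Section wigner_transform.
Context {R : realType} (d : nat) (tau : R).
Notation V f := (stft (@gaussian R _) f).
Notation leb := (lebesgue_rV R d).
Notation phase := 'rV[R]_((d + d) + (d + d)).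
Implicit Types K : 'rV[R]_(d + d) -> R[i].

Let point_of (x t : 'rV[R]_d) : 'rV[R]_(d + d) :=
  row_mx (x + tau *: t) (x - (1 - tau) *: t).

Let mpoint d' (T : measurableType d') (x t : T -> 'rV[R]_d) : measurable_fun setT x ->
  measurable_fun setT t -> measurable_fun setT (fun s => point_of (x s) (t s)).
Proof. by move=> mx mt; rewrite /point_of; measurability. Qed.

Lemma cmeas_wigner_kernel K : cmeas K -> cmeas (wigner_kernel tau K).
Proof.
move=> mK; apply: (@cmeas_cint2 _ _ _ _ _ leb (fun zt : 'rV[R]_(d + d) * 'rV[R]_d =>
  expi (- (2 * pi * dotv zt.2 (rsubmx zt.1))) * K (point_of (lsubmx zt.1) zt.2))).
apply: cmeasM; first by measurability.
by apply: cmeas_comp mK; apply: mpoint; measurability.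
Qed.

(** A null set of R^{2d} pulls back to a null set under the substitution of the
    transform; its slices at almost every x are null, whatever the frequency is. *)
Lemma ae_eq_wigner_kernel K K' : cmeas K -> cmeas K' ->
  {ae lebesgue_rV R (d + d), forall y, K y = K' y} ->
  {ae lebesgue_rV R (d + d), forall z, wigner_kernel tau K z = wigner_kernel tau K' z}.
Proof.
move=> mK mK' /(ae_mp (wigner_mp d tau)) e.
have mp := (wigner_mp d tau).1.
have {e} e := (ae_prod_eq leb leb (cmeas_comp mp mK) (cmeas_comp mp mK')).1 e.
apply/(ae_row (cmeas_wigner_kernel mK) (cmeas_wigner_kernel mK')).
apply: filterS e => x e; apply: filterE => w; rewrite /wigner_kernel row_mxKl row_mxKr.
have mL K1 : cmeas K1 -> cmeas (fun t => expi (- (2 * pi * dotv t w)) * K1 (point_of x t)).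
  move=> m1; apply: cmeasM; first by measurability.
  by apply: cmeas_comp m1; apply: mpoint; measurability.
apply: (ae_eq_cint (mL K mK) (mL K' mK')).
by apply: filterS e => t e; congr (_ * _).
Qed.

Lemma wigner_kernel_lin (c : R[i]) K K' : cintegrable (lebesgue_rV R (d + d)) K ->
  cintegrable (lebesgue_rV R (d + d)) K' ->
  {ae lebesgue_rV R (d + d), forall z, wigner_kernel tau (fun y => c * K y + K' y) z =
    c * wigner_kernel tau K z + wigner_kernel tau K' z}.
Proof.
move=> IK IK'; have [mK mK'] := (IK.1, IK'.1).
have aeI K1 : cintegrable (lebesgue_rV R (d + d)) K1 ->
    {ae leb, forall x, cintegrable leb (fun t => K1 (point_of x t))}.
  by move=> I1; exact: cintegrable_ae2 (cintegrable_mp (wigner_mp d tau) I1).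
have mR : cmeas (fun z => c * wigner_kernel tau K z + wigner_kernel tau K' z).
  have [] := (cmeas_wigner_kernel mK, cmeas_wigner_kernel mK').
  by move=> w1 w2; apply: cmeasD => //; apply: cmeasM => //; exact: cmeas_cst.
have mL : cmeas (fun y => c * K y + K' y).
  by apply: cmeasD => //; apply: cmeasM => //; exact: cmeas_cst.
apply/(ae_row (cmeas_wigner_kernel mL) mR).
apply: filterS2 (aeI _ IK) (aeI _ IK') => x I1 I2; apply: filterE => w.
rewrite /wigner_kernel row_mxKl row_mxKr -!/(cint _ _).
have e1 K1 : cintegrable leb (fun t => K1 (point_of x t)) ->
    cintegrable leb (fun t => expi (- (2 * pi * dotv t w)) * K1 (point_of x t)).
  move=> I; under eq_fun do rewrite mulrC.
  by apply: cintegrable_expiM => //; measurability.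
rewrite -(cintZ c (e1 _ I1)) -(cintD (cintegrableZ c (e1 _ I1)) (e1 _ I2)).
by apply: eq_cint => t; rewrite mulrDr mulrCA.
Qed.

(** A window whose time-frequency shifts are mapped to Gaussian atoms: the
    linear change of variables of the Wigner transform turns it into a tensor
    product of Gaussians. *)
Let window (y : 'rV[R]_(d + d)) : R :=
  gaussR ((1 - tau) *: lsubmx y + tau *: rsubmx y) * gaussR (lsubmx y - rsubmx y).

Let mwindow : measurable_fun setT window.
Proof.
have mg : cmeas (fun y : 'rV[R]_(d + d) => gaussian ((1 - tau) *: lsubmx y + tau *: rsubmx y) *
  gaussian (lsubmx y - rsubmx y)) by measurability.
have [mR _] := mg; move: mR; congr measurable_fun; apply/funext => y.
by rewrite ReM !gaussianE /= mulr0 subr0.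
Qed.

Let window_gt0 y : 0 < window y.
Proof. by rewrite mulr_gt0 ?gaussR_gt0. Qed.

Let window_le1 y : window y <= 1.
Proof. by rewrite mulr_ile1 ?gaussR_le1 ?ltW ?gaussR_gt0. Qed.

Let tcen (z : phase) : 'rV[R]_d := lsubmx (lsubmx z) - rsubmx (lsubmx z).
Let xcen (z : phase) : 'rV[R]_d :=
  (1 - tau) *: lsubmx (lsubmx z) + tau *: rsubmx (lsubmx z).
Let nucen (z : phase) : 'rV[R]_d :=
  tau *: lsubmx (rsubmx z) - (1 - tau) *: rsubmx (rsubmx z).
Let wcen (z : phase) : 'rV[R]_d := lsubmx (rsubmx z) + rsubmx (rsubmx z).

Let shifted (z : phase) (y : 'rV[R]_(d + d)) : R[i] :=
  expi (2 * pi * dotv y (rsubmx z)) * (window (y - lsubmx z))%:C%C.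

Let reorder (a b p q : R[i]) : a * b * (p * q) = p * a * (q * b).
Proof. by rewrite [LHS]mulrC [LHS]mulrACA. Qed.

Let normc_modulated (p q : R[i]) (a b : R) : normc (p * expi a * (q * expi b)) = normc p * normc q.
Proof. by rewrite normcM !(normcM _ (expi _)) !normc_expi !mulr1. Qed.

Let shiftedE z x t : shifted z (point_of x t) =
  (gaussian (x - xcen z) * expi (2 * pi * dotv x (wcen z))) *
  (gaussian (t - tcen z) * expi (2 * pi * dotv t (nucen z))).
Proof.
rewrite /shifted; have -> : dotv (point_of x t) (rsubmx z) = dotv x (wcen z) + dotv t (nucen z).
  rewrite -[in LHS](hsubmxK (rsubmx z)) /point_of dotv_row /wcen /nucen; dotv_expand.
  by ring.
have -> : window (point_of x t - lsubmx z) = gaussR (x - xcen z) * gaussR (t - tcen z).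
  rewrite /window /point_of -[in LHS](hsubmxK (lsubmx z)) opp_row_mx add_row_mx.
  rewrite row_mxKl row_mxKr; congr (_ * _); congr gaussR;
    by apply/rowP => i; rewrite /xcen /tcen !mxE; ring.
rewrite !gaussianE mulrDr expiD real_complexM.
exact: reorder.
Qed.

Let normc_shifted z x t : normc (shifted z (point_of x t)) <= normc (gaussian (t - tcen z)).
Proof.
rewrite shiftedE normc_modulated.
by rewrite ler_piMl ?normc_ge0// normc_gaussian_le1.
Qed.

Let cint_shifted z x w :
  cint leb (fun t => expi (- (2 * pi * dotv t w)) * shifted z (point_of x t)) =
  expi (2 * pi * dotv (tcen z) (nucen z)) *
    atom (row_mx (xcen z) (nucen z)) (row_mx (wcen z) (- tcen z)) (row_mx x w).
Proof.
pose G := gaussian (x - xcen z) * expi (2 * pi * dotv x (wcen z)).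
have Ig : cintegrable leb (fun t => gaussian (1 *: (t - tcen z)) *
    expi (2 * pi * dotv t (nucen z - w))).
  apply: cintegrable_expiM; last by measurability.
  by under eq_fun do rewrite scale1r; exact: cintegrable_shift_gaussian.
transitivity (G * cint leb (fun t => gaussian (1 *: (t - tcen z)) *
    expi (2 * pi * dotv t (nucen z - w)))).
  rewrite -cintZ//; apply: eq_cint => t; rewrite shiftedE scale1r mulrCA; congr (_ * _).
  by rewrite mulrCA -expiD; congr (_ * expi _); dotv_expand; ring.
rewrite fourier_gaussian_affine// expr1n invr1 mul1r scale1r.
rewrite atom_row /G /atom -(gaussianN (nucen z - w)) opprB.
rewrite [RHS]mulrCA; congr (_ * _); rewrite [RHS]mulrCA [LHS]mulrC; congr (_ * _).
rewrite -expiD; congr expi; move: (tcen z) (nucen z) => a b; dotv_expand.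
by rewrite (dotvC w); ring.
Qed.

Let norm1_shifted (b : 'rV[R]_d) : norm1 leb (fun t => gaussian (t - b)) = 1%E.
Proof. by rewrite (norm1_shift b (cintegrable_gaussian d).1) norm1_gaussian. Qed.

(** The reconstruction window in the inversion formula is chosen such that the
    Wigner transform maps its time-frequency shifts to Gaussian atoms, up to phase
    factors. The Wigner transform of K is then a superposition of atoms whose
    density differs from that of K by phase factors only. *)
Theorem S0_wigner_kernel : exists2 C : R, 0 <= C & forall K : S0 R (d + d), nmem K ->
  nmem (wigner_kernel tau K : S0 R (d + d)) /\
  (nnorm (wigner_kernel tau K : S0 R (d + d)) <= C%:E * nnorm K)%E.
Proof.
pose kap := (cint (lebesgue_rV R (d + d)) (fun y => gaussian y * (window y)%:C%C))^-1.
exists (atom_norm (d + d) * normc kap).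
  by rewrite mulr_ge0 ?normc_ge0// exprn_ge0// sqrtr_ge0.
move=> K K0; have mK := S0_cmeas K0; have IV := S0_stft K0.
pose L := lebesgue_rV R ((d + d) + (d + d)).
have IkV : cintegrable L (fun z => kap * V K z) by exact: cintegrableZ.
have mwin : cmeas (fun y => (window y)%:C%C) by exact: cmeas_real.
have mshift : cmeas (fun p : 'rV[R]_(d + d) * phase => shifted p.2 p.1).
  by rewrite /shifted; measurability.
pose U y := cint L (fun z => kap * V K z * shifted z y).
have mU : cmeas U.
  apply: (@cmeas_cint2 _ _ _ _ _ L (fun yz : 'rV[R]_(d + d) * phase =>
    kap * V K yz.2 * shifted yz.2 yz.1)).
  have mkV := IkV.1; apply: cmeasM; last exact: mshift.
  exact: (cmeas_comp measurable_snd mkV).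
have KU : {ae lebesgue_rV R (d + d), forall y, K y = U y}.
  have n1 y : normc (window y)%:C%C <= 1 by rewrite normc_real gtr0_norm.
  have := stft_inversion K0 mwin n1; apply: filterS => y.
  move=> /(congr1 ( *%R kap)); rewrite mulrCA mulVf ?mulr1; last exact: cint_gaussian_neq0.
  move=> ->; rewrite -cintZ; first by apply: eq_cint => z; rewrite mulrA.
  apply: (cintegrableM_bounded IV); first by measurability.
  by move=> z; rewrite normcM normc_expi mul1r.
pose F z := kap * V K z * expi (2 * pi * dotv (tcen z) (nucen z)).
have mt : measurable_fun setT tcen by rewrite /tcen; measurability.
have mx : measurable_fun setT xcen by rewrite /xcen; measurability.
have mnu : measurable_fun setT nucen by rewrite /nucen; measurability.
have mw : measurable_fun setT wcen by rewrite /wcen; measurability.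
have IF : cintegrable L F by apply: cintegrable_expiM => //; measurability.
pose x z := row_mx (xcen z) (nucen z); pose w z := row_mx (wcen z) (- tcen z).
have mx' : measurable_fun setT x by rewrite /x; measurability.
have mw' : measurable_fun setT w by rewrite /w; measurability.
have WU y : wigner_kernel tau U y = cint L (fun z => F z * atom (x z) (w z) y).
  pose e t := expi (- (2 * pi * dotv t (rsubmx y))) : R[i].
  pose k (zt : phase * 'rV[R]_d) :=
    kap * V K zt.1 * (e zt.2 * shifted zt.1 (point_of (lsubmx y) zt.2)).
  have mk : cmeas k.
    apply: cmeasM; first exact: (cmeas_comp measurable_fst IkV.1).
    apply: cmeasM; first by rewrite /e; measurability.
    apply: (cmeas_comp (p := fun zt : phase * 'rV[R]_d =>
      (point_of (lsubmx y) zt.2, zt.1)) _ mshift).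
    by apply: measurable_fun_pair; [apply: mpoint; measurability|measurability].
  have nk z : (norm1 leb (fun t => k (z, t)) <= (normc (kap * V K z))%:E)%E.
    have mgt : cmeas (fun t : 'rV[R]_d => gaussian (t - tcen z)) := (cintegrable_shift_gaussian (tcen z)).1.
    have e1 : norm1 leb (fun t => gaussian (t - tcen z)) = 1%E.
      exact: norm1_shifted.
    have := norm1Z leb (kap * V K z) mgt; rewrite e1 mule1 => <-.
    apply: le_norm1; [exact: (cmeas_pair2 z mk)| |].
      by apply: measurable_enormc; apply: cmeasM => //; exact: cmeas_cst.
    move=> t; rewrite lee_fin /k [leLHS]normcM [leRHS]normcM ler_wpM2l ?normc_ge0//.
    by rewrite normcM normc_expi mul1r; exact: normc_shifted.
  have Ik : cintegrable (L \x leb)%E k.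
    apply: cintegrable_prod => //; apply: le_lt_trans IkV.2.
    apply: ge0_le_integral => //.
    - by move=> z _; exact: norm1_ge0.
    - exact: (@measurable_norm1_2 _ _ _ _ _ leb _ mk).
    - by apply: measurable_enormc; case: IkV.
  transitivity (cint leb (fun t => cint L (fun z => k (z, t)))).
    apply: eq_cint => t; rewrite -/(e t) -/(point_of _ _) /U -cintZ.
      by apply: eq_cint => z; rewrite /k/= mulrCA.
    apply: (cintegrableM_bounded IkV) => [|z].
      exact: (cmeas_pair2 (F := fun p : 'rV[R]_(d + d) * phase =>
        shifted p.2 p.1) _ mshift).
    by apply: le_trans (normc_shifted _ _ _) _; exact: normc_gaussian_le1.
  rewrite -(cint_swap Ik); apply: eq_cint => z.
  transitivity (kap * V K z * cint leb (fun t => e t * shifted z (point_of (lsubmx y) t))).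
    rewrite -cintZ; first by reflexivity.
    under eq_fun do rewrite mulrC; apply: cintegrable_expiM; last by measurability.
    apply: (@cintegrable_le _ _ _ _ _ (fun t : 'rV[R]_d => (normc (gaussian (t - tcen z)))%:E)).
    - apply: (cmeas_comp (p := fun t => (point_of (lsubmx y) t, z)) _ mshift).
      by apply: measurable_fun_pair; [apply: mpoint; measurability|measurability].
    - by apply: measurable_enormc; measurability.
    - by move=> t; rewrite lee_fin normc_shifted.
    - exact: (cintegrable_shift_gaussian (tcen z)).2.
  by rewrite /e cint_shifted /F /x /w hsubmxK mulrA.
have [u0 un] := @S0_atoms R _ _ L _ F x w (wigner_kernel tau U : S0 R (d + d)) IF mx' mw' WU.
have UK : {ae lebesgue_rV R (d + d), forall y, U y = K y} by apply: filterS KU => y ->.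
have e := ae_eq_wigner_kernel mU mK UK; have mWK := cmeas_wigner_kernel mK.
split; first exact: ae_eq_S0 u0 mWK e.
rewrite -(ae_eq_nnorm (cmeas_wigner_kernel mU) mWK e); apply: le_trans un _.
have -> : norm1 L F = ((normc kap)%:E * nnorm K)%E.
  rewrite S0_nnorm -norm1Z; last by case: IV.
  apply: eq_integral => z _; congr (_%:E).
  by rewrite /F (normcM (kap * V K z)) normc_expi mulr1.
by rewrite EFinM muleA.
Qed.

End wigner_transform.

(** * Rounding atoms to a grid *)

Section scheffe.
Context d (T : measurableType d) {R : realType} (mu : {measure set T -> \bar R}).

(** Scheffe's lemma: the functions |f_n| + |f| - |f_n - f| are nonnegative and tend
    to 2|f|, so Fatou's lemma forbids norms of f_n - f that stay away from 0. *)
Lemma scheffe (f_ : nat -> T -> R[i]) f : (forall n, cmeas (f_ n)) -> cintegrable mu f ->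
  (forall n, norm1 mu (f_ n) = norm1 mu f) ->
  (forall x, normc (f_ n x - f x) @[n --> \oo] --> 0) ->
  forall e : R, 0 < e -> exists n, (norm1 mu (fun x => (f_ n x - f x)%R) < e%:E)%E.
Proof.
move=> mf_ If nE cf e e0; have mf := If.1.
apply: contrapT => /forallNP h1.
have {}h1 n : (e%:E <= norm1 mu (fun x => (f_ n x - f x)%R))%E.
  by rewrite leNgt; apply/negP; exact: h1.
pose h n x := (normc (f_ n x) + normc (f x) - normc (f_ n x - f x))%:E.
have h0 n x : (0 <= h n x)%E.
  by rewrite lee_fin subr_ge0 -(normcN (f x)); exact: le_normcD.
have mB n : cmeas (fun x => f_ n x - f x) by exact: cmeasB.
have mh n : measurable_fun setT (h n).
  apply/measurable_EFinP; apply: measurable_funB; last exact: measurable_normc.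
  by apply: measurable_funD; exact: measurable_normc.
pose a := fine (norm1 mu f); have aE : norm1 mu f = a%:E by exact: norm1_fin.
have hE n : (\int[mu]_x h n x + norm1 mu (fun x => (f_ n x - f x)%R) = (a + a)%:E)%E.
  rewrite /norm1 -ge0_integralD//; first last.
  - exact: measurable_enormc.
  - by move=> x _; rewrite lee_fin normc_ge0.
  rewrite EFinD -{1}aE -(nE n) -aE /norm1 -ge0_integralD//; first last.
  - exact: measurable_enormc.
  - by move=> x _; rewrite lee_fin normc_ge0.
  - exact: measurable_enormc.
  - by move=> x _; rewrite lee_fin normc_ge0.
  by apply: eq_integral => x _; rewrite -!EFinD subrK.
have hx x : limn_einf (h ^~ x) = (2 * normc (f x))%:E.
  suff c : h ^~ x @ \oo --> (2 * normc (f x))%:E by have [] := cvg_limn_einf_sup c.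
  apply: cvg_EFin; first by apply: nearW.
  apply: (@squeeze_cvgr _ _ _ _ (fun n => 2 * normc (f x) - 2 * normc (f_ n x - f x))
    (fun=> 2 * normc (f x)) _); last 2 first.
  - rewrite -[X in _ --> X]subr0 -[X in _ --> _ - X](mulr0 2).
    by apply: cvgB; [exact: cvg_cst|apply: cvgM; [exact: cvg_cst|exact: cf]].
  - exact: cvg_cst.
  apply: nearW => n /=.
  have le1 : normc (f x) <= normc (f_ n x) + normc (f_ n x - f x).
    rewrite -{1}(subrK (f_ n x) (f x)) addrC; apply: le_trans (le_normcD _ _) _.
    by rewrite lerD2l -normcN opprB.
  have le2 : normc (f_ n x) <= normc (f x) + normc (f_ n x - f x).
    by rewrite -{1}(subrK (f x) (f_ n x)) addrC; exact: le_normcD.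
  by apply/andP; split; lra.
have := fatou mu measurableT mh (fun n x _ => h0 n x).
under eq_integral do rewrite hx.
have -> : (\int[mu]_x (2 * normc (f x))%:E = (a + a)%:E)%E.
  rewrite EFinD -aE /norm1 -ge0_integralD//; first last.
  - exact: measurable_enormc.
  - by move=> x _; rewrite lee_fin normc_ge0.
  - exact: measurable_enormc.
  - by move=> x _; rewrite lee_fin normc_ge0.
  by apply: eq_integral => x _; rewrite -EFinD -mulr2n mulr_natl.
apply/negP; rewrite -ltNge; apply: (@le_lt_trans _ _ (a + a - e)%:E); last first.
  by rewrite lte_fin gtrBl.
rewrite limn_einf_lim; apply: lime_le; first exact: is_cvg_einfs.
apply: nearW => n; apply: (@le_trans _ _ (\int[mu]_x h n x)%E).
  by apply: ereal_inf_lbound; exists n => /=.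
by rewrite EFinB leeBrDr// -(hE n) leeD2l.
Qed.

End scheffe.

Section rounding.
Context {R : realType}.

Definition grid_point (N j : nat) : R := j%:R / N.+1%:R - N%:R.

(** Rounds down to a multiple of the mesh 1/(N+1) when |x| <= N; clamping makes the
    range finite and leaves the function monotone, hence measurable. *)
Definition round1 (N : nat) (x : R) : R :=
  grid_point N (minn (Num.truncn ((x + N%:R) * N.+1%:R)) (2 * N * N.+1)).

Lemma measurable_round1 N : measurable_fun setT (round1 N).
Proof.
apply: nondecreasing_measurable => // x y xy.
rewrite lerD2r ler_pM2r ?invr_gt0// ler_nat leq_min geq_minr andbT.
by apply: leq_trans (geq_minl _ _) _; apply: le_truncn; rewrite ler_wpM2r ?lerD2r.
Qed.

Lemma round1_near (N : nat) x : `|x| <= N%:R -> `|round1 N x - x| <= N.+1%:R^-1.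
Proof.
rewrite ler_norml => /andP[x1 x2]; have N0 : 0 < N.+1%:R :> R by [].
have y0 : 0 <= (x + N%:R) * N.+1%:R by rewrite mulr_ge0// -lerBlDr sub0r.
have yN : (Num.truncn ((x + N%:R) * N.+1%:R) <= 2 * N * N.+1)%N.
  rewrite truncn_le_nat; apply: (@le_lt_trans _ _ (2 * N * N.+1)%:R); last by rewrite ltr_nat.
  by rewrite natrM ler_wpM2r// natrM mulr_natl mulr2n lerD2r.
rewrite /round1 (minn_idPl yN) /grid_point; have /andP[] := truncn_itv y0.
move: (Num.truncn _) => j; rewrite -ler_pdivrMr// -ltr_pdivlMr// -(natr1 j) mulrDl mul1r.
set p := j%:R / _; set q := N.+1%:R^-1; clearbody p q => h1 h2.
by rewrite ler_norml; apply/andP; split; lra.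
Qed.

Lemma round1_cvg x : round1 N x @[N --> \oo] --> x.
Proof.
apply/subr_cvg0; apply: norm_cvg0.
apply: (@squeeze_cvgr _ _ _ _ (fun=> 0) (fun N => N.+1%:R^-1) _); last 2 first.
- exact: cvg_cst.
- exact: cvg_harmonic.
near=> N; rewrite normr_ge0/=; apply: round1_near.
near: N; exact: nbhs_infty_ger.
Unshelve. all: by end_near. Qed.

Definition round n (N : nat) (z : 'rV[R]_n) : 'rV[R]_n := \row_i round1 N (z 0 i).

Definition grid n (N : nat) : seq 'rV[R]_n :=
  undup [seq \row_i grid_point N (f i) | f : {ffun 'I_n -> 'I_(2 * N * N.+1).+1}].

Lemma measurable_round n N : measurable_fun setT (@round n N).
Proof.
apply: measurable_fun_rV => i; under eq_fun do rewrite mxE.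
exact: measurableT_comp (measurable_round1 N) (measurable_coor i).
Qed.

Lemma round_in_grid n N (z : 'rV[R]_n) : round N z \in grid n N.
Proof.
rewrite mem_undup; apply/mapP.
exists [ffun i => inord (minn (Num.truncn ((z 0 i + N%:R) * N.+1%:R)) (2 * N * N.+1))].
  by rewrite mem_enum.
by apply/rowP => i; rewrite !mxE ffunE inordK// ltnS geq_minr.
Qed.

Lemma dotv_cvg n (x_ y_ : nat -> 'rV[R]_n) (x y : 'rV[R]_n) :
  (forall i, x_ N 0 i @[N --> \oo] --> x 0 i) -> (forall i, y_ N 0 i @[N --> \oo] --> y 0 i) ->
  dotv (x_ N) (y_ N) @[N --> \oo] --> dotv x y.
Proof.
move=> cx cy; apply: cvg_big => [|i _]; last by apply: cvgM.
exact: add_continuous.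
Qed.

Lemma polar_cvg (r_ th_ : nat -> R) (r th : R) : r_ N @[N --> \oo] --> r ->
  th_ N @[N --> \oo] --> th ->
  normc ((r_ N)%:C%C * expi (th_ N) - r%:C%C * expi th) @[N --> \oo] --> 0.
Proof.
move=> cr cth.
have c1 : r_ N * cos (th_ N) @[N --> \oo] --> r * cos th.
  by apply: cvgM => //; apply: continuous_cvg => //; exact: continuous_cos.
have c2 : r_ N * sin (th_ N) @[N --> \oo] --> r * sin th.
  by apply: cvgM => //; apply: continuous_cvg => //; exact: continuous_sin.
apply: (@squeeze_cvgr _ _ _ _ (fun=> 0) (fun N => `|r_ N * cos (th_ N) - r * cos th| +
  `|r_ N * sin (th_ N) - r * sin th|) _); last 2 first.
- exact: cvg_cst.
- rewrite -[X in _ --> X](addr0 0); apply: cvgD; rewrite -(normr0 R); apply: cvg_norm.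
    exact/subr_cvg0.
  exact/subr_cvg0.
apply: nearW => N; apply/andP; split; first exact: normc_ge0.
apply: le_trans (normc_le_ReIm _) _.
by rewrite ReD ImD ReN ImN !ReM !ImM !ReC !ImC !mul0r !subr0 !addr0.
Qed.

Lemma stft_atom_cvg n (x_ w_ : nat -> 'rV[R]_n) (x w : 'rV[R]_n) y :
  (forall i, x_ N 0 i @[N --> \oo] --> x 0 i) -> (forall i, w_ N 0 i @[N --> \oo] --> w 0 i) ->
  normc (stft (@gaussian R n) (atom (x_ N) (w_ N)) y - stft (@gaussian R n) (atom x w) y)
    @[N --> \oo] --> 0.
Proof.
move=> cx cw; rewrite -(hsubmxK y); set x' := lsubmx y; set w' := rsubmx y.
pose a : R := (Num.sqrt 2)^-1.
have E u v : stft (@gaussian R n) (atom u v) (row_mx x' w') =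
    (a ^+ n * gaussR (a *: (u - x')) * gaussR (a *: (v - w')))%:C%C *
    expi (pi * dotv (u + x') (v - w')).
  by rewrite stft_atom !gaussianE !real_complexM -exprVn !mulrA.
have cB (u_ : nat -> 'rV[R]_n) (u v : 'rV[R]_n) : (forall i, u_ N 0 i @[N --> \oo] --> u 0 i) ->
    forall i, (u_ N + v) 0 i @[N --> \oo] --> (u + v) 0 i.
  move=> c i; rewrite mxE; under eq_fun do rewrite mxE.
  by apply: cvgD => //; exact: cvg_cst.
have cG (u_ : nat -> 'rV[R]_n) (u v : 'rV[R]_n) : (forall i, u_ N 0 i @[N --> \oo] --> u 0 i) ->
    gaussR (a *: (u_ N - v)) @[N --> \oo] --> gaussR (a *: (u - v)).
  move=> c; rewrite /gaussR; apply: continuous_cvg; first exact: continuous_expR.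
  apply: cvgN; apply: cvgM; first exact: cvg_cst.
  apply: dotv_cvg => i; rewrite mxE; under eq_fun do rewrite mxE;
    by apply: cvgM; [exact: cvg_cst|exact: cB].
rewrite E; under eq_fun do rewrite E.
apply: polar_cvg; last by apply: cvgM; [exact: cvg_cst|apply: dotv_cvg; exact: cB].
by apply: cvgM; [apply: cvgM; [exact: cvg_cst|exact: cG]|exact: cG].
Qed.

End rounding.

(** * Functionals on S0 and density of the atoms *)

Section functionals.
Context {R : realType} (n : nat).
Notation V f := (stft (@gaussian R _) f).
Implicit Types (s : S0' R n) (u v : S0 R n).

Lemma nnorm_fin u : nmem u -> nnorm u = (fine (nnorm u))%:E.
Proof.
move=> u0; rewrite fineK// ge0_fin_numE ?nnorm_ge0//.
by rewrite S0_nnorm; have [] := (S0P u).1 u0.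
Qed.

Lemma S0'_0 s : nmem s -> s 0 = 0.
Proof.
move=> [lin _]; have [z0 _] := S0_0 (R := R) n.
have := lin 1 0 0 z0 z0; rewrite scaler0 addr0 conjc1 mul1r.
by move=> /(congr1 (fun x => x - s 0)); rewrite subrr addrK.
Qed.

Lemma S0'_Z s (c : R[i]) u : nmem s -> nmem u -> s (c *: u) = conjc c * s u.
Proof.
move=> s0 u0; have [z0 _] := S0_0 (R := R) n.
by rewrite -[c *: u]addr0 s0.1// S0'_0// addr0.
Qed.

Lemma S0'_B s u v : nmem s -> nmem u -> nmem v -> s (u - v) = s u - s v.
Proof.
move=> s0 u0 v0; rewrite addrC -scaleN1r s0.1//.
have -> : conjc (-1) = -1 :> R[i].
  by apply: eq_ReIm; rewrite ?Re_conjc ?Im_conjc ?ReN ?ImN//= !oppr0.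
by rewrite mulN1r addrC.
Qed.

(** The functional norm only sees the unit ball; rescaling extends the bound to all
    of S0, including vectors of norm 0, which have arbitrarily large multiples in the
    ball. *)
Lemma S0'_bound s : nmem s -> exists2 M : R, 0 <= M /\ functional_norm s = M%:E &
  forall u, nmem u -> normc (s u) <= M * fine (nnorm u).
Proof.
move=> s0; have [_ soo] := s0.
have ubs u : nmem u -> (nnorm u <= 1)%E -> ((normc (s u))%:E <= functional_norm s)%E.
  by move=> u0 u1; apply: ereal_sup_ubound; exists u.
have [z0 nz0] := S0_0 (R := R) n.
have sge0 : (0 <= functional_norm s)%E.
  apply: le_trans (ubs 0 z0 _); first by rewrite lee_fin normc_ge0.
  by rewrite nz0.
have sE : functional_norm s = (fine (functional_norm s))%:E by rewrite fineK// ge0_fin_numE.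
set M := fine _ in sE; have M0 : 0 <= M by rewrite -lee_fin -sE.
exists M; first by split.
move=> u u0; set r := fine (nnorm u).
have r0 : 0 <= r by rewrite -lee_fin /r -nnorm_fin// nnorm_ge0.
have key (a : R) : 0 <= a -> a * r <= 1 -> a * normc (s u) <= M.
  move=> a0 ar; have [au0 aun] := S0Z a%:C%C u0.
  rewrite -lee_fin -sE; have na : normc a%:C%C = a by rewrite normc_real ger0_norm.
  have -> : a * normc (s u) = normc (s (a%:C%C *: u)).
    by rewrite S0'_Z// [RHS]normcM normc_conj na.
  apply: ubs => //; apply: le_trans aun _.
  by rewrite (nnorm_fin u0) -/r na -EFinM lee_fin.
have [r1|r1] := eqVneq r 0.
  rewrite r1 mulr0 leNgt; apply/negP => su0.
  have := key ((M + 1) / normc (s u)); rewrite r1 mulr0 ler01 divfK ?gt_eqF//.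
  have M1 : 0 <= (M + 1) / normc (s u) by rewrite divr_ge0 ?addr_ge0// ltW.
  by move=> /(_ M1 isT); rewrite gerDl ler10.
have rgt0 : 0 < r by rewrite lt_neqAle eq_sym r1.
rewrite -ler_pdivrMr// mulrC; apply: key; first by rewrite invr_ge0.
by rewrite mulVf.
Qed.

Lemma S0'_intro s (M : R) : 0 <= M ->
  (forall (c : R[i]) u v, nmem u -> nmem v -> s (c *: u + v) = conjc c * s u + s v) ->
  (forall u, nmem u -> normc (s u) <= M * fine (nnorm u)) ->
  nmem s /\ (functional_norm s <= M%:E)%E.
Proof.
move=> M0 lin Ms; suff le1 : (functional_norm s <= M%:E)%E.
  by split => //; split; [exact: lin|exact: le_lt_trans le1 (ltry _)].
apply: ge_ereal_sup => _ [u [u0 u1] <-]; rewrite lee_fin.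
apply: le_trans (Ms u u0) _; rewrite -[leRHS]mulr1 ler_wpM2l//.
by rewrite -lee_fin -nnorm_fin.
Qed.

(** Functionals act on representatives; they respect almost everywhere equality
    because the difference of two representatives has norm 0. *)
Lemma S0'_ext s u v : nmem s -> nmem u -> nmem v -> nequiv u v -> s u = s v.
Proof.
move=> s0 u0 v0 uv; have [M M0 Ms] := S0'_bound s0.
have uv0 := S0B u0 v0; have [z0 nz0] := S0_0 (R := R) n.
have n0 : nnorm (u - v) = 0%E.
  rewrite -nz0; apply: (ae_eq_nnorm (S0_cmeas uv0) (S0_cmeas z0)).
  by apply: filterS uv => t e; rewrite /= fctE e subrr.
have := Ms _ uv0; rewrite n0/= mulr0 S0'_B// => h.
apply/eqP; rewrite -subr_eq0; apply/eqP/eq0_normc/eqP.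
by rewrite eq_le h normc_ge0.
Qed.

Lemma S0_atom (x w : 'rV[R]_n) : nmem (atom x w : S0 R n).
Proof.
have Ia := cintegrable_atom x w; apply/S0P; split; first exact: Ia.1.
  apply: le_lt_trans Ia.2; apply: ge0_le_integral => //.
  - by move=> t _; rewrite lee_fin sqr_ge0.
  - by apply/measurable_EFinP; apply: measurable_funX; apply: measurable_normc; exact: Ia.1.
  - by apply: measurable_enormc; exact: Ia.1.
  - by move=> t _; rewrite lee_fin expr2 ler_piMl ?normc_ge0 ?normc_atom_le1.
by rewrite norm1_stft_atom ltry.
Qed.

Lemma S0'_eq_sum s s' (I : Type) (r : seq I) (c : I -> R[i]) (v : I -> S0 R n) :
  nmem s -> nmem s' -> (forall i, nmem (v i)) -> (forall i, s (v i) = s' (v i)) ->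
  let u : S0 R n := \sum_(i <- r) c i *: v i in nmem u /\ s u = s' u.
Proof.
move=> s0 s'0 v0 sv; elim: r => [|i r /= [u0 su]] /=.
  have [z0 _] := S0_0 (R := R) n.
  by rewrite big_nil (S0'_0 s0) (S0'_0 s'0); split; [exact: z0|reflexivity].
rewrite big_cons; have [w0 _] := S0_lin (c i) (v0 i) u0; split => //.
by rewrite (s0.1 _ _ _ (v0 i) u0) (s'0.1 _ _ _ (v0 i) u0) su sv.
Qed.

Let windowed (x w y : 'rV[R]_n) :
  cintegrable (lebesgue_rV R n) (fun t => atom x w t * gaussian (t - y)).
Proof.
apply: (cintegrableM_bounded (cintegrable_atom x w)) => [|t]; first by measurability.
exact: normc_gaussian_le1.
Qed.

Let is_windowed (h : 'rV[R]_n -> R[i]) :=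
  forall y, cintegrable (lebesgue_rV R n) (fun t => h t * gaussian (t - y)).

Let stftZ (c : R[i]) h y : is_windowed h -> V (fun t => c * h t) y = c * V h y.
Proof.
move=> Ih; have -> : (fun t => c * h t) = (fun t => (c - 1) * h t + h t).
  by apply/funext => t; rewrite mulrBl mul1r subrK.
rewrite (stft_lin (c - 1) y Ih Ih); move: (V h y) => a.
by rewrite mulrBl mul1r subrK.
Qed.

Let stftB h h' y : is_windowed h -> is_windowed h' ->
  V (fun t => h t - h' t) y = V h y - V h' y.
Proof.
move=> I I'; have -> : (fun t => h t - h' t) = (fun t => -1 * h' t + h t).
  by apply/funext => t; rewrite mulN1r addrC.
rewrite (stft_lin (-1) y I' I); move: (V h y) (V h' y) => a b.
by rewrite mulN1r addrC.
Qed.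

Lemma dotv_eq0 m (x : 'rV[R]_m) : (dotv x x == 0) = (x == 0).
Proof.
apply/eqP/eqP => [|->]; last by rewrite dotv0l.
move=> /psumr_eq0P h; apply/rowP => i; rewrite mxE.
have /eqP := h (fun j _ => sqr_ge0 (x 0 j)) i isT.
by rewrite mulf_eq0 orbb => /eqP.
Qed.

(** A point is the zero set of a measurable squared distance. *)
Lemma cmeas_eq_op m d (T : measurableType d) (f : T -> 'rV[R]_m) (p : 'rV[R]_m) :
  measurable_fun setT f -> cmeas (fun z => (f z == p)%:R : R[i]).
Proof.
move=> mf; have mh : measurable_fun setT (fun z => dotv (f z - p) (f z - p)) by measurability.
have -> : (fun z => (f z == p)%:R : R[i]) =
    (fun z => (\1_[set 0 : R] (dotv (f z - p) (f z - p)))%:C%C).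
  apply/funext => z; rewrite indicE -(subr_eq0 (f z)) -dotv_eq0.
  rewrite (_ : (_ \in [set 0 : R]) = (dotv (f z - p) (f z - p) == 0)).
    by case: (_ == _).
  by apply/idP/idP; rewrite inE => /eqP.
apply: cmeas_real; apply: measurableT_comp mh.
by apply/measurable_indicP; exact: measurable_set1.
Qed.

(** The Gaussian atoms span a dense subspace of S0: by the atomic representation
    an element of S0 is the superposition of the atoms at z with density c(z), and
    rounding each z to a point of a finite grid turns it into a finite sum of
    atoms. The short-time Fourier transforms of the superposed atoms all have the
    same norm, so pointwise convergence suffices for convergence in norm. *)
Theorem S0'_eq_on_atoms s s' : nmem s -> nmem s' ->
  (forall x w, s (atom x w) = s' (atom x w)) -> forall u, nmem u -> s u = s' u.
Proof.
move=> s0 s'0 sa u u0; pose L := lebesgue_rV R (n + n).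
pose c z := dual_const n * V u z; have Ic : cintegrable L c by exact: S0_coef.
have mc := Ic.1.
pose k (q : 'rV[R]_(n + n) -> 'rV[R]_(n + n)) (zt : 'rV[R]_(n + n) * 'rV[R]_n) :=
  c zt.1 * atom (lsubmx (q zt.1)) (rsubmx (q zt.1)) zt.2.
have mk q : measurable_fun setT q -> cmeas (k q).
  move=> mq; apply: cmeasM; first by measurability.
  by apply: cmeas_atom; measurability.
pose U q : S0 R n := fun t => cint L (fun z => k q (z, t)).
have U0 q : measurable_fun setT q -> nmem (U q).
  move=> mq; have mx : measurable_fun setT (fun z => lsubmx (q z) : 'rV[R]_n) by measurability.
  have mw : measurable_fun setT (fun z => rsubmx (q z) : 'rV[R]_n) by measurability.
  have [|h _] := @S0_atoms R _ _ L n c _ _ (U q) Ic mx mw.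
    by move=> t; reflexivity.
  exact: h.
have mid : measurable_fun setT (@id 'rV[R]_(n + n)) by exact: measurable_id.
have uU : nequiv u (U id) by exact: S0_atomic.
rewrite (S0'_ext s0 u0 (U0 _ mid) uU) (S0'_ext s'0 u0 (U0 _ mid) uU).
have sU N : s (U (@round R _ N)) = s' (U (@round R _ N)).
  pose C p := cint L (fun z => (round N z == p)%:R * c z).
  pose v (p : 'rV[R]_(n + n)) : S0 R n := atom (lsubmx p) (rsubmx p).
  have [_] := @S0'_eq_sum s s' _ (grid (n + n) N) C v s0 s'0
    (fun p => S0_atom _ _) (fun p => sa _ _).
  suff -> : \sum_(p <- grid (n + n) N) C p *: v p = U (@round R _ N) by [].
  have I p : cintegrable L (fun z => (round N z == p)%:R * c z).
    under eq_fun do rewrite mulrC.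
    apply: (@cintegrableM_bounded _ _ _ _ _ _ 1 Ic).
      by apply: cmeas_eq_op; exact: measurable_round.
    by move=> z; case: (_ == _); rewrite ?normc0 ?ler01// -expi0 normc_expi.
  apply/funext => t; rewrite fct_sumE.
  transitivity (cint L (fun z => \sum_(p <- grid (n + n) N)
      v p t * ((round N z == p)%:R * c z))).
    rewrite cint_sum; last by move=> p; apply: cintegrableZ.
    by apply: eq_bigr => p _; rewrite cintZ// mulrC.
  apply: eq_cint => z; rewrite (bigD1_seq (round N z)) ?round_in_grid ?undup_uniq//=.
  rewrite eqxx mul1r big1 ?addr0; first by rewrite mulrC.
  by move=> p /negbTE; rewrite eq_sym => ->; rewrite mul0r mulr0.
have [M [M0 _] Ms] := S0'_bound s0; have [M' [M'0 _] Ms'] := S0'_bound s'0.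
pose f q (zy : 'rV[R]_(n + n) * 'rV[R]_(n + n)) := V (fun t => k q (zy.1, t)) zy.2.
have fE q z y : f q (z, y) = c z * V (atom (lsubmx (q z)) (rsubmx (q z))) y.
  exact: (stftZ (c z) y (@windowed (lsubmx (q z)) (rsubmx (q z)))).
have mf q : measurable_fun setT q -> cmeas (f q).
  by move=> mq; exact: (cmeas_stft_param (mk q mq)).
have mr N := @measurable_round R (n + n) N.
have nf q : measurable_fun setT q ->
    norm1 (L \x L)%E (f q) = ((atom_norm n)%:E * norm1 L c)%E.
  move=> mq; rewrite (norm1_prod L L (mf q mq)).
  rewrite -ge0_integralZl//; last 3 first.
  - exact: measurable_enormc.
  - by move=> z _; rewrite lee_fin normc_ge0.
  - by rewrite lee_fin exprn_ge0// sqrtr_ge0.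
  apply: eq_integral => z _; rewrite -(norm1_stft_atom (lsubmx (q z)) (rsubmx (q z))) muleC.
  rewrite -norm1Z; last by apply: cmeas_stft; exact: (cintegrable_atom _ _).1.
  by congr norm1; apply/funext => y; exact: fE.
have If : cintegrable (L \x L)%E (f id).
  split; first exact: mf.
  rewrite (nf _ mid).
  by apply: lte_mul_pinfty; [rewrite lee_fin exprn_ge0 ?sqrtr_ge0|reflexivity|exact: Ic.2].
have cf zy : normc (f (@round R _ N) zy - f id zy) @[N --> \oo] --> 0.
  case: zy => z y; under eq_fun do rewrite !fE -mulrBr normcM.
  rewrite -(mulr0 (normc (c z))).
  apply: cvgM; first exact: cvg_cst.
  apply: stft_atom_cvg => i; rewrite mxE; under eq_fun do rewrite !mxE; exact: round1_cvg.
have close N : (nnorm (U (@round R _ N) - U id) <=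
    norm1 (L \x L)%E (fun zy => (f (@round R _ N) zy - f id zy)%R))%E.
  pose q := @round R (n + n) N; have mq : measurable_fun setT q := mr N.
  have mfB : cmeas (fun zy => f q zy - f id zy) by apply: cmeasB; exact: mf.
  rewrite (norm1_prod L L mfB).
  pose k' zt := k q zt - k id zt.
  have mk' : cmeas k' by apply: cmeasB; exact: mk.
  have IF : cintegrable L (fun z => 2%:C%C * c z) by exact: cintegrableZ.
  have kF z t : normc (k' (z, t)) <= normc (2%:C%C * c z).
    rewrite /k' /k -mulrBr [leLHS]normcM mulrC [leRHS]normcM ler_wpM2r ?normc_ge0//.
    apply: le_trans (le_normcD _ _) _; rewrite normcN normc_real normr_nat.
    by apply: le_trans (lerD (normc_atom_le1 _ _ _) (normc_atom_le1 _ _ _)) _.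
  have wk (q' : 'rV[R]_(n + n) -> 'rV[R]_(n + n)) z : is_windowed (fun t => k q' (z, t)).
    move=> y; have := cintegrableZ (c z) (windowed (lsubmx (q' z)) (rsubmx (q' z)) y).
    by under eq_fun do rewrite mulrA.
  have Vk z : norm1 L (V (fun t => k' (z, t))) = norm1 L (fun y => f q (z, y) - f id (z, y)).
    by congr norm1; apply/funext => y; exact: (stftB y (wk q z) (wk id z)).
  have nk : (\int[L]_z norm1 L (V (fun t => k' (z, t))) =
      \int[L]_z norm1 L (fun y => (f q (z, y) - f id (z, y))%R))%E.
    by apply: eq_integral => z _; exact: Vk.
  have Ik q' : measurable_fun setT q' -> cintegrable (L \x lebesgue_rV R n)%E (k q').
    move=> mq'; apply: cintegrable_prod; first exact: mk.
    suff -> : (\int[L]_z norm1 (lebesgue_rV R n) (fun t => k q' (z, t)) = norm1 L c)%E.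
      exact: Ic.2.
    apply: eq_integral => z _; have := norm1Z (lebesgue_rV R n) (c z)
      (cintegrable_atom (lsubmx (q' z)) (rsubmx (q' z))).1.
    by rewrite norm1_atom mule1 => <-.
  have Ik' : cintegrable (L \x lebesgue_rV R n)%E k' by apply: cintegrableB; exact: Ik.
  have UE t : (U q - U id : S0 R n) t = cint L (fun z => k' (z, t)).
    have I q' : measurable_fun setT q' -> cintegrable L (fun z => k q' (z, t)).
      move=> mq'; apply: (cintegrableM_bounded Ic) => [|z]; last exact: normc_atom_le1.
      by apply: cmeas_atom; measurability.
    exact: esym (cintB (I q mq) (I id mid)).
  have Voo : (\int[L]_z norm1 L (V (fun t => k' (z, t))) < +oo)%E.
    rewrite nk -(norm1_prod L L mfB); apply: le_lt_trans (norm1B _ (mf _ mq) (mf _ mid)) _.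
    rewrite (nf _ mq) (nf _ mid); have Aoo : ((atom_norm n)%:E * norm1 L c < +oo)%E.
      by apply: lte_mul_pinfty; [rewrite lee_fin exprn_ge0 ?sqrtr_ge0|reflexivity|exact: Ic.2].
    exact: lte_add_pinfty.
  have [_ h] := S0_superposition IF Ik' kF Voo UE.
  by rewrite -nk; exact: h.
apply: contrapT => /eqP; rewrite -subr_eq0 => ne.
have a0 : 0 < normc (s (U id) - s' (U id)).
  by rewrite lt_neqAle normc_ge0 andbT eq_sym; apply: contra ne => /eqP/eq0_normc ->.
have B0 : 0 < M + M' + 1 by rewrite ltr_wpDl// addr_ge0.
have [|N hN] := scheffe (fun N => mf _ (mr N)) If
  (fun N => etrans (nf _ (mr N)) (esym (nf _ mid))) cf (e := normc (s (U id) - s' (U id)) / (M + M' + 1)).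
  by rewrite divr_gt0.
pose D := U (@round R _ N) - U id; have D0 : nmem D by apply: S0B; exact: U0.
have := le_lt_trans (close N) hN; rewrite -/D (nnorm_fin D0) lte_fin ltr_pdivlMr//.
apply/negP; rewrite -leNgt; apply: (@le_trans _ _ ((M + M') * fine (nnorm D))); last first.
  rewrite mulrC ler_wpM2l// ?lerDl//.
  by rewrite -lee_fin -nnorm_fin// nnorm_ge0.
have -> : s (U id) - s' (U id) = s' D - s D.
  rewrite /D (S0'_B s0 (U0 _ (mr N)) (U0 _ mid)) (S0'_B s'0 (U0 _ (mr N)) (U0 _ mid)).
  by rewrite (sU N); ring.
rewrite mulrDl addrC; apply: le_trans (le_normcD _ _) _.
by rewrite normcN lerD ?Ms ?Ms'.
Qed.

End functionals.

(** * Kernels *)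

Section kernels.
Context {R : realType} (d : nat).
Implicit Types (K : S0 R (d + d)) (S : S0' R d -> S0 R d).
Notation leb := (lebesgue_rV R d).

(** These functionals suffice to recognize a kernel. They are bounded because S0
    embeds into L1. *)
Lemma S0'_box (p q : 'rV[R]_d) :
  nmem ((fun u : S0 R d => cint leb (fun y => (\1_(box p q) y)%:C%C * conjc (u y))) : S0' R d).
Proof.
have mb : cmeas (fun y : 'rV[R]_d => (\1_(box p q) y : R)%:C%C).
  by apply: cmeas_indic; exact: measurable_box.
have I (u : S0 R d) : nmem u ->
    cintegrable leb (fun y => (\1_(box p q) y)%:C%C * conjc (u y)).
  move=> u0; have [Iu _] := S0_L1 u0; under eq_fun do rewrite mulrC.
  by apply: (cintegrableM_bounded (cintegrable_conj Iu) mb) => y; exact: normc_indic.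
pose k : R := normc (dual_const (R := R) d).
have k0 : 0 <= k by exact: normc_ge0.
apply: (proj1 (S0'_intro k0 _ _)).
  move=> c u v u0 v0; rewrite -(cintZ (conjc c) (I u u0)).
  rewrite -(cintD (cintegrableZ (conjc c) (I u u0)) (I v v0)); apply: eq_cint => y.
  change (conjc ((c *: u + v) y)) with (conjc (c * u y + v y)).
  by rewrite conjcD conjcM mulrDr mulrCA.
move=> u u0; have [Iu nu] := S0_L1 u0; apply: le_trans (le_normc_cint_fine (I u u0)) _.
rewrite -lee_fin -norm1_fin; last exact: I.
apply: (@le_trans _ _ (norm1 leb u)); last by move: nu; rewrite (nnorm_fin u0) -EFinM.
apply: le_norm1; [exact: (I u u0).1|exact: measurable_enormc Iu.1|].
by move=> y; rewrite lee_fin normcM normc_conj ler_piMl ?normc_ge0// normc_indic.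
Qed.

Lemma indic_box_row (p q : 'rV[R]_(d + d)) (x y : 'rV[R]_d) :
  \1_(box p q) (row_mx x y) =
  \1_(box (lsubmx p) (lsubmx q)) x * \1_(box (rsubmx p) (rsubmx q)) y :> R.
Proof.
have e : box p q (row_mx x y) <->
    box (lsubmx p) (lsubmx q) x /\ box (rsubmx p) (rsubmx q) y.
  split => [h|[hx hy] i].
    by split => i; rewrite !mxE; [have := h (lshift d i)|have := h (rshift d i)];
      rewrite ?row_mxEl ?row_mxEr.
  have [j ->|j ->] := split_ordP i; rewrite ?row_mxEl ?row_mxEr.
    by have := hx j; rewrite !mxE.
  by have := hy j; rewrite !mxE.
rewrite !indicE -natrM mulnb; congr (_%:R); congr nat_of_bool.
apply/idP/andP; first by rewrite inE => /e[h1 h2]; split; rewrite inE.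
by move=> [h1 h2]; rewrite inE; apply/e; split; [move: h1|move: h2]; rewrite inE.
Qed.

(** A kernel is determined by the operator: tested against the functional of a box
    B, the operator yields the integrals of almost every section of the kernel over
    B, hence the integrals of the kernel over all products of boxes. *)
Theorem kernel_unique S S' K K' : is_kernel S K -> is_kernel S' K' ->
  (forall s, nmem s -> nequiv (S s) (S' s)) -> nequiv K K'.
Proof.
move=> [K0 SK] [K'0 SK'] SS'; have [IK _] := S0_L1 K0; have [IK' _] := S0_L1 K'0.
have IB := cintegrableB IK IK'.
have If p q : cintegrable (lebesgue_rV R (d + d))
    (fun t => (\1_(box p q) t)%:C%C * (K t - K' t)).
  under eq_fun do rewrite mulrC; apply: (cintegrableM_bounded IB) => [|t].
    by apply: cmeas_indic; exact: measurable_box.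
  exact: normc_indic.
suff : {ae lebesgue_rV R (d + d), forall t, K t - K' t = 0}.
  by apply: filterS => t /eqP; rewrite subr_eq0 => /eqP.
apply: (boxes_ae0 IB.1 If) => p q; rewrite (cint_row (If p q)).
rewrite -[RHS](cint0 leb); apply: ae_eq_cint.
- apply: (@cmeas_cint2 _ _ _ _ _ leb (fun xy : 'rV[R]_d * 'rV[R]_d =>
    (\1_(box p q) (row_mx xy.1 xy.2))%:C%C * (K (row_mx xy.1 xy.2) - K' (row_mx xy.1 xy.2)))).
  by have := (cintegrable_row (If p q)).1.
- exact: cmeas_cst.
pose B := box (rsubmx p) (rsubmx q).
have sB := S0'_box (rsubmx p) (rsubmx q).
have Isec K1 : cintegrable (lebesgue_rV R (d + d)) K1 ->
    {ae leb, forall x, cintegrable leb (fun y => (\1_B y)%:C%C * K1 (row_mx x y))}.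
  move=> I1; have := cintegrable_ae2 (cintegrable_row I1); apply: filterS => x Ix.
  under eq_fun do rewrite mulrC; apply: (cintegrableM_bounded Ix) => [|y].
    by apply: cmeas_indic; exact: measurable_box.
  exact: normc_indic.
have cc (K1 : S0 R (d + d)) x : cint leb (fun y => (\1_B y)%:C%C * K1 (row_mx x y)) =
    cint leb (fun y => (\1_B y)%:C%C * conjc (conjc (K1 (row_mx x y)))).
  by apply: eq_cint => y; rewrite conjcK.
have : {ae leb, forall x, cint leb (fun y => (\1_B y)%:C%C * K (row_mx x y)) =
    cint leb (fun y => (\1_B y)%:C%C * K' (row_mx x y))}.
  apply: filterS3 (SK _ sB) (SK' _ sB) (SS' _ sB) => x e1 e2 e.
  by rewrite (cc K) (cc K'); apply: etrans (esym e1) (etrans e e2).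
apply: filterS3 (Isec _ IK) (Isec _ IK') => x I1 I2 e.
transitivity ((\1_(box (lsubmx p) (lsubmx q)) x : R)%:C%C *
    (cint leb (fun y => (\1_B y)%:C%C * K (row_mx x y)) -
     cint leb (fun y => (\1_B y)%:C%C * K' (row_mx x y)))).
  rewrite -(cintB I1 I2) -(cintZ _ (cintegrableB I1 I2)); apply: eq_cint => y.
  by rewrite indic_box_row real_complexM -mulrA -mulrBr.
by rewrite e subrr mulr0.
Qed.

Lemma kernel_ofP S : (exists K, is_kernel S K) -> is_kernel S (kernel_of S).
Proof. by move=> h; exact: (xgetPex 0 h). Qed.

(** The sections of kernels lie in S0 for almost every x only, hence the linearity of
    s may be used there. *)
Lemma kernel_lin (c : R[i]) S S' K K' : is_kernel S K -> is_kernel S' K' ->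
  is_kernel (c *: (S : OpS0 R d) + (S' : OpS0 R d)) (c *: K + K').
Proof.
move=> [K0 SK] [K'0 SK']; have [L0 _] := S0_lin c K0 K'0; split; first exact: L0.
move=> s s0; have h : {ae leb, forall x, c * S s x + S' s x =
    c * s (fun y => conjc (K (row_mx x y))) + s (fun y => conjc (K' (row_mx x y)))}.
  by apply: filterS2 (SK s s0) (SK' s s0) => x -> ->.
apply: filterS3 h (S0_section K0) (S0_section K'0) => x e x0 x'0.
change (c * S s x + S' s x = s (fun y => conjc (c * K (row_mx x y) + K' (row_mx x y)))).
rewrite e; have := s0.1 (conjc c) _ _ x0 x'0; rewrite conjcK => <-; congr s.
by apply/funext => y; rewrite conjcD conjcM.
Qed.

Lemma atom_tensor_kernel (x w : 'rV[R]_(d + d)) : atom x w =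
  tensor_kernel (atom (lsubmx x) (lsubmx w)) (atom (rsubmx x) (- rsubmx w)).
Proof.
apply/funext => z; rewrite /tensor_kernel conjc_atom opprK -atom_row.
by rewrite !hsubmxK.
Qed.

(** The atoms of R^{2d} are kernels of rank-one operators, and they span a dense
    subspace. *)
Theorem kernel'_unique (T : OpS0' R d) (k k' : S0' R (d + d)) : is_kernel' T k ->
  is_kernel' T k' -> nequiv k k'.
Proof.
move=> [k0 kT] [k'0 k'T]; apply: (S0'_eq_on_atoms k0 k'0) => x w.
have a1 := @S0_atom R d; rewrite (atom_tensor_kernel x w).
by rewrite -(kT _ _ (a1 _ _) (a1 _ _)) -(k'T _ _ (a1 _ _) (a1 _ _)).
Qed.

End kernels.

(** * The quantization Op and its adjoint W *)

Section quantization.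
Context {R : realType} (tau : R) (d : nat).
Notation wk := (wigner_kernel tau).

Lemma wigner_tensor (g f : 'rV[R]_d -> R[i]) : wigner tau g f = wk (tensor_kernel g f).
Proof.
apply/funext => z; apply: eq_cint => t; rewrite /tensor_kernel row_mxKl row_mxKr.
exact: esym (mulrA _ _ _).
Qed.

Let bounded_wk : exists2 C : R, 0 <= C & forall K : S0 R (d + d), nmem K ->
  nmem (wk K : S0 R (d + d)) /\ fine (nnorm (wk K : S0 R (d + d))) <= C * fine (nnorm K).
Proof.
have [C C0 hC] := S0_wigner_kernel (R := R) d tau; exists C => // K K0.
have [w0 le1] := hC K K0; split => //.
by move: le1; rewrite (nnorm_fin w0) (nnorm_fin K0) -EFinM lee_fin.
Qed.

Let bounded_tensor : exists2 C : R, 0 <= C & forall g f : S0 R d, nmem g -> nmem f ->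
  nmem (tensor_kernel g f : S0 R (d + d)) /\
  fine (nnorm (tensor_kernel g f : S0 R (d + d))) <= C * (fine (nnorm g) * fine (nnorm f)).
Proof.
have [C C0 hC] := S0_tensor (R := R) d; exists C => // g f g0 f0.
have [t0 le1] := hC g f g0 f0; split => //.
by move: le1; rewrite (nnorm_fin t0) (nnorm_fin g0) (nnorm_fin f0) -!EFinM lee_fin.
Qed.

Let tensor_linl (c : R[i]) (g g' f : S0 R d) :
  tensor_kernel (c *: g + g') f =
  c *: (tensor_kernel g f : S0 R (d + d)) + (tensor_kernel g' f : S0 R (d + d)).
Proof.
apply/funext => z; change ((c * g (lsubmx z) + g' (lsubmx z)) * conjc (f (rsubmx z)) =
  c * (g (lsubmx z) * conjc (f (rsubmx z))) + g' (lsubmx z) * conjc (f (rsubmx z))).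
by rewrite mulrDl mulrA.
Qed.

Let tensor_linr (c : R[i]) (g f f' : S0 R d) :
  tensor_kernel g (c *: f + f') =
  conjc c *: (tensor_kernel g f : S0 R (d + d)) + (tensor_kernel g f' : S0 R (d + d)).
Proof.
apply/funext => z; change (g (lsubmx z) * conjc (c * f (rsubmx z) + f' (rsubmx z)) =
  conjc c * (g (lsubmx z) * conjc (f (rsubmx z))) + g (lsubmx z) * conjc (f' (rsubmx z))).
by rewrite conjcD conjcM mulrDr mulrCA.
Qed.

Let nequiv_tensor (g g' f f' : S0 R d) : nmem g -> nmem g' -> nmem f -> nmem f' ->
  nequiv g g' -> nequiv f f' ->
  nequiv (tensor_kernel g f : S0 R (d + d)) (tensor_kernel g' f' : S0 R (d + d)).
Proof.
move=> g0 g'0 f0 f'0 gg ff; have [mg mg'] := (S0_cmeas g0, S0_cmeas g'0).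
have [mf mf'] := (S0_cmeas f0, S0_cmeas f'0).
have m1 : cmeas (tensor_kernel g f) by rewrite /tensor_kernel; measurability.
have m2 : cmeas (tensor_kernel g' f') by rewrite /tensor_kernel; measurability.
apply/(ae_row m1 m2); apply: filterS gg => x ex; apply: filterS ff => y ey.
by rewrite /tensor_kernel !row_mxKl !row_mxKr ex ey.
Qed.

(** The functional on kernels obtained from a symbol by transposing the Wigner
    transform; it is the kernel of the quantized operator. *)
Definition transpose (a : S0' R (d + d)) : S0' R (d + d) := fun K => a (wk K).

Lemma OpE (a : S0' R (d + d)) f g : Op tau d a f g = transpose a (tensor_kernel g f).
Proof. by rewrite /Op wigner_tensor. Qed.

Let wk_lin (c : R[i]) (K K' : S0 R (d + d)) : nmem K -> nmem K' ->
  nequiv (wk (c *: K + K') : S0 R (d + d)) (c *: (wk K : S0 R (d + d)) + (wk K' : S0 R (d + d))).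
Proof.
move=> K0 K'0; have [[I _] [I' _]] := (S0_L1 K0, S0_L1 K'0).
exact: wigner_kernel_lin.
Qed.

Lemma transpose_bound : exists2 C : R, 0 <= C & forall (a : S0' R (d + d)) (M : R),
  nmem a -> functional_norm a = M%:E ->
  nmem (transpose a) /\ (functional_norm (transpose a) <= (M * C)%:E)%E.
Proof.
have [C C0 hC] := bounded_wk; exists C => // a M a0 aM.
have [N [N0 aN] aB] := S0'_bound a0; have {aN} NM : N = M by move: aN; rewrite aM => -[].
rewrite {}NM in N0 aB; apply: S0'_intro; first exact: mulr_ge0.
  move=> c K K' K0 K'0; have [W0 _] := hC K K0; have [W'0 _] := hC K' K'0.
  have [L0 _] := S0_lin c K0 K'0; have [V0 _] := hC _ L0; have [U0 _] := S0_lin c W0 W'0.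
  by rewrite /transpose (S0'_ext a0 V0 U0 (wk_lin c K0 K'0)); exact: a0.1.
move=> K K0; have [W0 nW] := hC K K0; apply: le_trans (aB _ W0) _.
by rewrite -mulrA ler_wpM2l.
Qed.

(** Boundedness is that of the tensor product in S0. The dependence on f is linear
    because f enters the tensor product conjugated and k is conjugate-linear. *)
Lemma bounded_of_kernel' : exists2 C : R, 0 <= C & forall (k : S0' R (d + d)) (M : R),
  nmem k -> functional_norm k = M%:E ->
  nmem ((fun f g => k (tensor_kernel g f)) : OpS0' R d) /\
  (op_norm ((fun f g => k (tensor_kernel g f)) : S0 R d -> S0' R d) <= (M * C)%:E)%E.
Proof.
have [C C0 hC] := bounded_tensor; exists C => // k M k0 kM.
have [N [N0 kN] kB] := S0'_bound k0; have {kN} NM : N = M by move: kN; rewrite kM => -[].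
rewrite {}NM in N0 kB.
pose T f : S0' R d := fun g => k (tensor_kernel g f).
have Tf (f : S0 R d) : nmem f -> nmem (T f) /\
    (functional_norm (T f) <= (M * C * fine (nnorm f))%:E)%E.
  move=> f0; have nf0 : 0 <= fine (nnorm f) by rewrite -lee_fin -nnorm_fin// nnorm_ge0.
  apply: S0'_intro; first by rewrite !mulr_ge0.
    move=> c g g' g0 g'0; have [t0 _] := hC g f g0 f0; have [t'0 _] := hC g' f g'0 f0.
    by rewrite /T tensor_linl; exact: k0.1.
  move=> g g0; have [t0 nt] := hC g f g0 f0; apply: le_trans (kB _ t0) _.
  by rewrite -!mulrA ler_wpM2l// (mulrC (fine (nnorm f))).
have le1 : (op_norm (T : S0 R d -> S0' R d) <= (M * C)%:E)%E.
  apply: ge_ereal_sup => _ [f [f0 f1] <-]; have [_ le1] := Tf f f0.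
  apply: le_trans le1 _; rewrite lee_fin -[leRHS]mulr1 ler_wpM2l ?mulr_ge0//.
  by rewrite -lee_fin -nnorm_fin.
split; last exact: le1.
split; last exact: le_lt_trans le1 (ltry _).
split.
- by move=> f f0; have [] := Tf f f0.
- move=> f f' f0 f'0 ff' g g0; have [t0 _] := hC g f g0 f0; have [t'0 _] := hC g f' g0 f'0.
  apply: (S0'_ext k0 t0 t'0); apply: nequiv_tensor => //.
  by apply: filterE => t; reflexivity.
- move=> c f f' f0 f'0 g g0; have [t0 _] := hC g f g0 f0; have [t'0 _] := hC g f' g0 f'0.
  change (k (tensor_kernel g (c *: f + f')) =
    c * k (tensor_kernel g f) + k (tensor_kernel g f')).
  by rewrite tensor_linr k0.1// conjcK.
Qed.

Lemma Op_bound : exists2 C : R, 0 <= C & forall (a : S0' R (d + d)) (M : R),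
  nmem a -> functional_norm a = M%:E ->
  nmem (Op tau d a) /\ (op_norm (Op tau d a) <= (M * C)%:E)%E.
Proof.
have [C C0 hC] := transpose_bound; have [D D0 hD] := bounded_of_kernel'.
exists (C * D) => [|a M a0 aM]; first exact: mulr_ge0.
have [t0 nt] := hC a M a0 aM; have [N [N0 tN] _] := S0'_bound t0.
have [T0 nT] := hD _ N t0 tN.
have -> : Op tau d a = ((fun f g => transpose a (tensor_kernel g f)) : OpS0' R d).
  by apply/funext => f; apply/funext => g; exact: OpE.
split; first exact: T0.
apply: le_trans nT _; rewrite lee_fin mulrA ler_wpM2r//.
by move: nt; rewrite tN lee_fin.
Qed.

Lemma wigner_S0 (g f : S0 R d) : nmem g -> nmem f -> nmem (wigner tau g f : S0 R (d + d)).
Proof.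
move=> g0 f0; have [C _ hC] := bounded_wk; have [D _ hD] := bounded_tensor.
by rewrite wigner_tensor; have [] := hC _ (hD g f g0 f0).1.
Qed.

Theorem Op_linear : is_linear_map (Op tau d).
Proof.
have [C _ hC] := Op_bound; split.
- by move=> a a0; have [M [_ aM] _] := S0'_bound a0; have [] := hC a M a0 aM.
- by move=> a a' _ _ aa' f f0 g g0; apply: aa'; exact: wigner_S0.
- by move=> c a a' _ _ f f0 g g0; reflexivity.
Qed.

Lemma S0'_mem_sub (a b : S0' R (d + d)) : nmem a -> nmem b ->
  (functional_norm (b - a : S0' R (d + d))%R < +oo)%E -> nmem (b - a).
Proof.
move=> a0 b0 boo; split; last exact: boo.
move=> c u v u0 v0; change (b (c *: u + v) - a (c *: u + v) =
  conjc c * (b u - a u) + (b v - a v)).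
by rewrite b0.1// a0.1// opprD mulrBr addrACA.
Qed.

Theorem Op_continuous : is_continuous_map (Op tau d).
Proof.
have [C C0 hC] := Op_bound; move=> a a0 e e0.
have C1 : 0 < C + 1 by rewrite ltr_wpDl.
exists (e / (C + 1)) => [|b b0 ba]; first exact: divr_gt0.
have c0 : nmem (b - a) by apply: S0'_mem_sub => //; exact: lt_trans ba (ltry _).
have [M [M0 cM] _] := S0'_bound c0; have [_ le1] := hC _ M c0 cM.
apply: (@le_lt_trans _ _ (M * C)%:E); first exact: le1.
have : (functional_norm (b - a : S0' R (d + d))%R < (e / (C + 1))%:E)%E by exact: ba.
rewrite cM !lte_fin ltr_pdivlMr//; apply: le_lt_trans.
by rewrite ler_wpM2l// lerDl.
Qed.

Lemma kernel_of_memP (S : OpS0 R d) : nmem S -> is_kernel S (kernel_of S).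
Proof. by move=> [_ h]; exact: kernel_ofP. Qed.

Let nequiv_wk (K K' : S0 R (d + d)) : nmem K -> nmem K' -> nequiv K K' ->
  nequiv (wk K : S0 R (d + d)) (wk K' : S0 R (d + d)).
Proof. by move=> K0 K'0; apply: ae_eq_wigner_kernel; exact: S0_cmeas. Qed.

Lemma kernel_of_lin (c : R[i]) (S S' : OpS0 R d) : nmem S -> nmem S' ->
  is_kernel (c *: S + S') (kernel_of (c *: S + S')) /\
  nequiv (kernel_of (c *: S + S') : S0 R (d + d)) (c *: kernel_of S + kernel_of S').
Proof.
move=> S0 S'0; have h := kernel_lin c (kernel_of_memP S0) (kernel_of_memP S'0).
have hk : is_kernel (c *: S + S') (kernel_of (c *: S + S')).
  by apply: kernel_ofP; eexists; exact: h.
split; first exact: hk.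
by apply: (kernel_unique hk h) => s s0; apply: filterE => x; reflexivity.
Qed.

(** Linearity holds up to equivalence: the kernel of a linear combination is chosen
    independently, but kernels are unique almost everywhere. *)
Lemma W_lin (c : R[i]) (S S' : OpS0 R d) : nmem S -> nmem S' ->
  nequiv (W tau d (c *: S + S')) (c *: W tau d S + W tau d S').
Proof.
move=> S0 S'0; have [[k0 _] kE] := kernel_of_lin c S0 S'0.
have [[K0 _] [K'0 _]] := (kernel_of_memP S0, kernel_of_memP S'0).
have [L0 _] := S0_lin c K0 K'0.
by apply: filterS2 (nequiv_wk k0 L0 kE) (wk_lin c K0 K'0) => x; exact: etrans.
Qed.

Lemma W_mem (S : OpS0 R d) : nmem S -> nmem (W tau d S).
Proof.
move=> S0; have [C _ hC] := bounded_wk; have [K0 _] := kernel_of_memP S0.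
by have [] := hC _ K0.
Qed.

Theorem W_linear : is_linear_map (W tau d).
Proof.
split; [exact: W_mem| |exact: W_lin].
move=> S S' S0 S'0 SS'; have [kS kS'] := (kernel_of_memP S0, kernel_of_memP S'0).
by apply: nequiv_wk; [exact: kS.1|exact: kS'.1|exact: kernel_unique kS kS' SS'].
Qed.

Theorem W_continuous : is_continuous_map (W tau d).
Proof.
have [C C0 hC] := bounded_wk; move=> S S0 e e0.
have C1 : 0 < C + 1 by rewrite ltr_wpDl.
exists (e / (C + 1)) => [|S' S'0 ba]; first exact: divr_gt0.
have dE : S' - S = -1 *: S + S' by rewrite scaleN1r addrC.
have [[k0 _] _] := kernel_of_lin (-1) S0 S'0.
have [w0 nw] := hC _ k0.
have eq1 : nequiv (W tau d (-1 *: S + S')) (W tau d S' - W tau d S).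
  have := W_lin (-1) S0 S'0; apply: filterS => x ->.
  by rewrite scaleN1r addrC.
have m2 := S0_cmeas (S0B (W_mem S'0) (W_mem S0)).
rewrite -(ae_eq_nnorm (S0_cmeas w0) m2 eq1) (nnorm_fin w0) lte_fin.
apply: le_lt_trans nw _.
have : (nnorm (kernel_of (-1 *: S + S')%R) < (e / (C + 1))%:E)%E by rewrite -dE; exact: ba.
rewrite (nnorm_fin k0) lte_fin ltr_pdivlMr//; apply: le_lt_trans.
rewrite mulrC ler_wpM2l ?lerDl//.
by rewrite -lee_fin -nnorm_fin// nnorm_ge0.
Qed.

(** The transposed functional satisfies the defining property of the kernel of the
    quantized operator, so uniqueness identifies the two, in particular on the kernel
    of S. *)
Theorem Op_adjoint (a : S0' R (d + d)) (S : OpS0 R d) : nmem a -> nmem S ->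
  a (W tau d S) = op_pairing (Op tau d a) S.
Proof.
move=> a0 S0; have [C _ hC] := transpose_bound; have [M [_ aM] _] := S0'_bound a0.
have [t0 _] := hC a M a0 aM; have [K0 _] := kernel_of_memP S0.
have ker : is_kernel' (Op tau d a) (transpose a).
  by split; [exact: t0|move=> f g _ _; exact: OpE].
have ker' : is_kernel' (Op tau d a) (kernel_of' (Op tau d a)).
  exact: (xgetPex 0 (ex_intro _ _ ker)).
exact: (kernel'_unique ker ker' K0).
Qed.

End quantization.

Theorem theorem3p7 (R : realType) (d : nat) (tau : R) :
  0 <= tau <= 1 ->
  (is_linear_map (Op tau d) /\ is_continuous_map (Op tau d)) /\
  (is_linear_map (W tau d) /\ is_continuous_map (W tau d)) /\
  (forall (a : S0' R (d + d)) (S : OpS0 R d), nmem a -> nmem S ->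
     a (W tau d S) = op_pairing (Op tau d a) S).
Proof.
move=> _; split; [|split].
- by split; [exact: Op_linear|exact: Op_continuous].
- by split; [exact: W_linear|exact: W_continuous].
- exact: Op_adjoint.
Qed.
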